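(* Let $m\ge 1$. For $i=1,\dots,m$ let $(a_i,b_i]$ be an interval in the positive half-line (with $(a_i,\infty)$ allowed when $b_i=\infty$), let $h_i:(a_i,b_i]\to\mathbb{R}$ be a continuous function of bounded variation, and let $\rho_i$ be a positive, possibly infinite, measure on $[0,\infty)$ given by the increments of a time change $r_i$ on $(a_i,b_i]$. Put $\mathbf{(a,b]}:=(a_1,b_1]\times\dots\times(a_m,b_m]$, let $\boldsymbol{\rho}:=\rho_1\times\dots\times\rho_m$ be the product measure (considered on $\mathbf{(a,b]}$), let $\mathbf{h}:=h_1\otimes\dots\otimes h_m$, i.e. $\mathbf{h}(t_1,\dots,t_m):=h_1(t_1)\cdots h_m(t_m)$ for $a_i<t_i\le b_i$, and let $\mathbf{h}\boldsymbol{\rho}$ be the image of the measure $\boldsymbol{\rho}$ under $\mathbf{h}$. Suppose that the image $\mathbf{h}(\mathbf{(a,b]})$ is an interval $(c,d]\subset\mathbb{R}^+$ (read as $(c,\infty)$ if $d=\infty$). Let $I^{t,\mathbf{h}\boldsymbol{\rho}}_{(c,d]}$ be the random integral mapping with integrand the identity function $t\mapsto t$ on $(c,d]$ and measure $\mathbf{h}\boldsymbol{\rho}$, and let $\mathcal{D}^{t,\mathbf{h}\boldsymbol{\rho}}_{(c,d]}$ be its domain. Then for every $\nu\in \mathcal{D}^{t,\mathbf{h}\boldsymbol{\rho}}_{(c,d]}\subset ID(\mathbb{R}^d)$, $$I_{(a_1,b_1]}^{h_1,\rho_1}\big(I_{(a_2,b_2]}^{h_2,\rho_2}(\dots(I_{(a_m,b_m]}^{h_m,\rho_m}(\nu))\dots)\big)=I_{(c,d]}^{t,\,\mathbf{h}\boldsymbol{\rho}}(\nu).$$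 Moreover, the random integral mappings $I^{h_i,\rho_i}_{(a_i,b_i]}$, $i=1,\dots,m$, commute on the domain $\mathcal{D}^{t,\mathbf{h}\boldsymbol{\rho}}_{(c,d]}$, i.e. on this domain their composition does not depend on the order in which they are composed.
   Context: $ID(\mathbb{R}^d)$ is the set of infinitely divisible probability measures on $\mathbb{R}^d$. Each $\nu\in ID(\mathbb{R}^d)$ has characteristic function $\hat\nu(y)=e^{\Phi(y)}$ with $$\Phi(y)=i\langle y,z\rangle-\tfrac12\langle y,Ry\rangle+\int_{\mathbb{R}^d\setminus\{0\}}\big[e^{i\langle y,x\rangle}-1-i\langle y,x\rangle 1_{\{\|x\|\le1\}}(x)\big]M(dx),$$ where $z\in\mathbb{R}^d$, $R$ is a covariance operator and $M$ is a Lévy measure; a function $\Phi$ of this form is called a Lévy exponent (the Lévy exponent of $\nu$). Random integrals: for a continuous real function $h$ of bounded variation on $(a,b]$, a nonnegative monotone time change $r$ on $(a,b]$ (non-decreasing right-continuous, or non-increasing left-continuous) and a càdlàg Lévy process $Y_\nu$ with $Y_\nu(1)$ having law $\nu$, the integral is defined pathwise by $$\int_{(a,b]}h(t)\,dY_\nu(r(t)):=h(b)Y_\nu(r(b))-h(a)Y_\nu(r(a))-\int_{(a,b]}Y_\nu(r(t)-)\,dh(t),$$ and integrals over other intervals (improper ones, half-lines, etc.) are weak limits of integrals over intervals of the form $(a,b]$. $I^{h,r}_{(a,b]}(\nu)$ denotes the law of this integral and its domain $\mathcal{D}^{h,r}_{(a,b]}\subset ID(\mathbb{R}^d)$ is the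 set of $\nu$ for which the integral is well defined. If $\nu$ has Lévy exponent $\Phi$, then $I^{h,r}_{(a,b]}(\nu)$ has Lévy exponent $y\mapsto\int_{(a,b]}\Phi(h(t)y)\,dr(t)$ for non-decreasing $r$, and $y\mapsto\int_{(a,b]}\Phi(-h(t)y)\,|dr(t)|$ for non-increasing $r$; an improper integral is well defined if and only if the corresponding (Lebesgue–Stieltjes) integral defines a Lévy exponent. Measure notation: for a positive measure $\rho$, $I^{h,\rho}_{(a,b]}(\nu)$ is the infinitely divisible law with Lévy exponent $y\mapsto\int_{(a,b]}\Phi(h(t)y)\,\rho(dt)$, with domain $\mathcal{D}^{h,\rho}_{(a,b]}$ the set of $\nu\in ID(\mathbb{R}^d)$ for which this integral defines a Lévy exponent. That is, it is $I^{h,r}_{(a,b]}$ with $r(t)=\rho\{s:s\le t\}$, or, when the non-increasing time change $r(t)=\rho\{s:s>t\}$ is used, $I^{-h,r}_{(a,b]}$.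
   Formalization: Each measure ρ_i is assumed nonzero on (a_i,b_i]: if some ρ_i vanishes there, the right-hand side is δ_0 with domain all of ID(R^d), while another mapping in the composition may be undefined, so the claim would fail. *)

(* Defs.v *)
(* MathComp-Analysis, over an arbitrary R : realType. *)
From HB Require Import structures.
From mathcomp Require Import all_boot all_order all_algebra all_fingroup.
From mathcomp Require Import complex.
From mathcomp Require Import all_classical all_reals all_analysis.
From mathcomp Require Import measurable_realfun giry.

Set Implicit Arguments.
Unset Strict Implicit.
Unset Printing Implicit Defensive.
Import Order.TTheory GRing.Theory Num.Theory.
Import numFieldNormedType.Exports.

Local Open Scope classical_set_scope.
Local Open Scope ring_scope.

(* Points of R^d are d-tuples, which carry the product (= Borel)
   sigma-algebra. *)
Section euclidean.
Context {R : realType} {d : nat}.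
Implicit Types x y : d.-tuple R.

Definition inner x y : R := \sum_(i < d) tnth x i * tnth y i.

Definition enorm x : R := Num.sqrt (inner x x).

Definition scalev (c : R) y : d.-tuple R := [tuple c * tnth y i | i < d].

Definition mulmxv (S : 'M[R]_d) y : d.-tuple R :=
  [tuple \sum_(j < d) S i j * tnth y j | i < d].

Definition zerov : d.-tuple R := [tuple 0 | _ < d].

Definition vadd (p : d.-tuple R * d.-tuple R) : d.-tuple R :=
  [tuple tnth p.1 i + tnth p.2 i | i < d].

Lemma measurable_vadd : measurable_fun [set: d.-tuple R * d.-tuple R] vadd.
Proof.
apply/measurable_fun_tnthP => i.
rewrite (_ : _ \o vadd = fun p => tnth p.1 i + tnth p.2 i); last first.
  by apply/funext => p /=; rewrite tnth_mktuple.
by apply: measurable_funD;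
  [exact: (measurableT_comp (measurable_tnth i) measurable_fst)
  |exact: (measurableT_comp (measurable_tnth i) measurable_snd)].
Qed.

HB.instance Definition _ := isMeasurableFun.Build _ _ _ _ vadd measurable_vadd.

End euclidean.

Section complex_integral.
Context {R : realType}.

Definition expC (z : R[i]) : R[i] :=
  ((expR (complex.Re z) * cos (complex.Im z))
   +i* (expR (complex.Re z) * sin (complex.Im z)))%C.

(* Absolute (Lebesgue) integrability of a complex function. *)
Definition Cintegrable {d} {T : measurableType d} (mu : set T -> \bar R)
    (D : set T) (f : T -> R[i]) : Prop :=
  mu.-integrable D (fun x => (complex.Re (f x))%:E) /\
  mu.-integrable D (fun x => (complex.Im (f x))%:E).

Definition Cintegral {d} {T : measurableType d} (mu : set T -> \bar R)
    (D : set T) (f : T -> R[i]) : R[i] :=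
  (fine (\int[mu]_(x in D) (complex.Re (f x))%:E)
   +i* fine (\int[mu]_(x in D) (complex.Im (f x))%:E))%C.

End complex_integral.

Section infinitely_divisible_laws.
Context {R : realType} {d : nat}.
Local Notation V := (d.-tuple R).

Definition convolution (mu nu : probability V R) : probability V R :=
  distribution (mu \x nu)%E vadd.

Fixpoint convolution_power (mu : probability V R) (n : nat) :
    probability V R :=
  if n is n'.+1 then convolution mu (convolution_power mu n')
  else \d_(zerov : V).

Definition infinitely_divisible (nu : probability V R) : Prop :=
  forall n, (0 < n)%N ->
    exists mu : probability V R, measure_eq nu (convolution_power mu n).

Definition charfun (nu : probability V R) (y : V) : R[i] :=
  Cintegral nu setT (fun x => expC (0 +i* inner y x)%C).

Definition covariance_mx (S : 'M[R]_d) : Prop :=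
  (S^T)%R = S /\ forall y : V, 0 <= inner y (mulmxv S y).

Definition levy_measure (M : {measure set V -> \bar R}) : Prop :=
  M [set zerov] = 0%E /\
  (\int[M]_x (Num.min 1 (enorm x ^+ 2))%:E < +oo)%E.

Definition levy_khintchine (z : V) (S : 'M[R]_d)
    (M : {measure set V -> \bar R}) (y : V) : R[i] :=
  (0 +i* inner y z)%C - (2^-1 * inner y (mulmxv S y))%:C%C
  + Cintegral M (~` [set zerov])
      (fun x => expC (0 +i* inner y x)%C - 1
                - (0 +i* (inner y x * (enorm x <= 1)%R%:R))%C).

Definition levy_exponent (Phi : V -> R[i]) : Prop :=
  exists (z : V) (S : 'M[R]_d) (M : {measure set V -> \bar R}),
    [/\ covariance_mx S, levy_measure M & Phi = levy_khintchine z S M].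

Definition levy_exponent_of (nu : probability V R) (Phi : V -> R[i]) : Prop :=
  levy_exponent Phi /\ forall y, charfun nu y = expC (Phi y).

End infinitely_divisible_laws.

Section random_integral.
Context {R : realType} {d : nat}.
Local Notation V := (d.-tuple R).

(* The interval (a, b], read as (a, oo) when b = +oo. *)
Definition oc_itv (a : R) (b : \bar R) : set R :=
  [set t | a < t /\ (t%:E <= b)%E].

Definition ri_exponent (a : R) (b : \bar R) (h : R -> R)
    (rho : set R -> \bar R) (Phi : V -> R[i]) (y : V) : R[i] :=
  Cintegral rho (oc_itv a b) (fun t => Phi (scalev (h t) y)).

Definition ri_exponent_integrable (a : R) (b : \bar R) (h : R -> R)
    (rho : set R -> \bar R) (Phi : V -> R[i]) : Prop :=
  forall y, Cintegrable rho (oc_itv a b) (fun t => Phi (scalev (h t) y)).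

Definition ri_domain (a : R) (b : \bar R) (h : R -> R)
    (rho : set R -> \bar R) : set (probability V R) :=
  [set nu | infinitely_divisible nu /\
    exists Phi, [/\ levy_exponent_of nu Phi,
      ri_exponent_integrable a b h rho Phi &
      levy_exponent (ri_exponent a b h rho Phi)]].

Definition ri_laws (a : R) (b : \bar R) (h : R -> R)
    (rho : set R -> \bar R) (nu : probability V R) : set (probability V R) :=
  [set mu | infinitely_divisible mu /\
    exists2 Phi, levy_exponent_of nu Phi &
      levy_exponent_of mu (ri_exponent a b h rho Phi)].

(* On ri_domain all elements of ri_laws agree on measurable sets, since a
   characteristic function determines the law; off ri_domain the value is
   meaningless. *)
Definition random_integral (a : R) (b : \bar R) (h : R -> R)
    (rho : set R -> \bar R) (nu : probability V R) : probability V R :=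
  xget (\d_(zerov : V) : probability V R) (ri_laws a b h rho nu).

End random_integral.

Section composition.
Context {R : realType} {d m : nat}.
Local Notation V := (d.-tuple R).
Variables (a : 'I_m -> R) (b : 'I_m -> \bar R) (h : 'I_m -> R -> R)
  (rho : 'I_m -> set R -> \bar R).

(* For s = [:: i_1; ...; i_k] this is I_(i_1) (I_(i_2) (... (I_(i_k) nu))). *)
Definition ri_comp (s : seq 'I_m) (nu : probability V R) : probability V R :=
  foldr (fun i => random_integral (a i) (b i) (h i) (rho i)) nu s.

Fixpoint ri_comp_domain (s : seq 'I_m) : set (probability V R) :=
  if s is i :: s' then
    [set nu | ri_comp_domain s' nu /\
              ri_domain (a i) (b i) (h i) (rho i) (ri_comp s' nu)]
  else [set nu | infinitely_divisible nu].

End composition.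

Section time_change.
Context {R : realType}.

Definition time_change_incr (a : R) (b : \bar R) (r : R -> R) : Prop :=
  [/\ forall t, oc_itv a b t -> 0 <= r t,
      forall s t, oc_itv a b s -> oc_itv a b t -> s <= t -> r s <= r t &
      forall t, a < t -> (t%:E < b)%E -> r x @[x --> t^'+] --> r t].

Definition time_change_decr (a : R) (b : \bar R) (r : R -> R) : Prop :=
  [/\ forall t, oc_itv a b t -> 0 <= r t,
      forall s t, oc_itv a b s -> oc_itv a b t -> s <= t -> r t <= r s &
      forall t, oc_itv a b t -> r x @[x --> t^'-] --> r t].

(* rho restricted to (a, b] is the measure |dr|; its mass near a or near +oo
   may be infinite.  In the non-increasing, left-continuous case increments of
   r are masses of intervals [s, t), and the atom at a finite b is
   r(b) - r(b+), where r(b+) >= 0 is not prescribed by r on (a, b].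
   The measures with r(t) = rho (t, oo) are covered, through t |-> r(t-). *)
Definition increments_of (a : R) (b : \bar R) (r : R -> R)
    (rho : set R -> \bar R) : Prop :=
  (time_change_incr a b r /\
   forall s t, oc_itv a b s -> oc_itv a b t -> s <= t ->
     rho `]s, t]%classic = (r t - r s)%:E) \/
  [/\ time_change_decr a b r,
      forall s t, oc_itv a b s -> oc_itv a b t -> s <= t ->
        rho `[s, t[%classic = (r s - r t)%:E &
      forall t, b = t%:E -> (rho [set t] <= (r t)%:E)%E].

(* Bounded variation on compact subintervals, so that for instance the
   identity is admissible on (a, oo). *)
Definition bounded_variation_oc (a : R) (b : \bar R) (h : R -> R) : Prop :=
  forall s t, oc_itv a b s -> oc_itv a b t -> s <= t ->
    bounded_variation s t h.

End time_change.

Section product.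
Context {R : realType} {m : nat}.
Variables (a : 'I_m -> R) (b : 'I_m -> \bar R).

Definition oc_box : set (m.-tuple R) :=
  [set t | forall i, oc_itv (a i) (b i) (tnth t i)].

Definition tensor (h : 'I_m -> R -> R) (t : m.-tuple R) : R :=
  \prod_(i < m) h i (tnth t i).

(* Each rho i is sigma-finite on (a i, b i] under increments_of, so there is
   exactly one such measure on the box. *)
Definition product_measure_on_box (rho : 'I_m -> set R -> \bar R)
    (prho : {measure set (m.-tuple R) -> \bar R}) : Prop :=
  forall A : 'I_m -> set R, (forall i, measurable (A i)) ->
    prho (oc_box `&` [set t | forall i, A i (tnth t i)]) =
    \big[*%E/1%E]_(i < m) rho i (oc_itv (a i) (b i) `&` A i).

Definition tensor_image (h : 'I_m -> R -> R)
    (prho : set (m.-tuple R) -> \bar R) : set R -> \bar R :=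
  fun A => prho (oc_box `&` tensor h @^-1` A).

End product.

(* Main.v *)
Require Import Defs.
From HB Require Import structures.
From mathcomp Require Import all_boot all_order all_algebra all_fingroup.
From mathcomp Require Import complex.
From mathcomp Require Import all_classical all_reals all_analysis.
From mathcomp Require Import giry.
From mathcomp Require Import measurable_realfun ring lra.

(** Why the composition is a single random integral. On the level of Levy exponents a random
    integral with integrand [h] and measure [rho] replaces [Phi] by the mixture
    [y |-> int Phi (h t *: y) rho (dt)]. Composing two of them multiplies the integrands, and
    by Fubini the result is the mixture over the product measure with integrand the tensor
    product. A change of variables along the tensor product turns this into the integral of
    the identity against the image measure. The order of the factors is invisible there, and
    the law is determined by its exponent.

    Two points need work: the intermediate integrals must exist, and Fubini must apply to an
    integrand with changing signs. Absolute integrability on the product is part of the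
    definition of the domain; the question is whether the inner mixtures are again Levy
    exponents. The real part of a Levy exponent is a sum of nonpositive terms. If the total
    mixture is a Levy exponent, then averaging its real part over a segment shows that the
    jumps [h t *: x] satisfy the integrability condition of a Levy measure on the product
    space, and that the variances are integrable ([mix_levy_integrable]). These conditions are
    positive, so Tonelli passes them to almost every section, hence to the inner factors since
    they are invariant under rescaling ([regular_mixing_snd]). Conversely, together with
    integrability of the exponent they yield the triplet of the mixture
    ([jumps_mix_exponent]). Induction on the number of factors gives [ri_comp_law].

    To speak of the law with a given exponent one needs that it exists, is unique and
    determines the exponent. Uniqueness of the law is [charfun_inj]: the indicator of an
    orthant is a double bounded limit of trigonometric polynomials. Existence is [levy_law]:
    Gaussian and jump parts are limits of compound Poisson laws, and these are limits of
    convolution powers, by the continuity theorem [levy_continuity]. For the latter, weak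
    limits of tight sequences are built as laws of standard parts under a Loeb measure
    ([weak_limit]). The exponent is determined by the law, [levy_exponent_inj], because it is
    continuous along rays and vanishes at the origin. *)

Set Implicit Arguments.
Unset Strict Implicit.
Unset Printing Implicit Defensive.
Import Order.TTheory GRing.Theory Num.Theory.
Import numFieldNormedType.Exports.
Local Open Scope classical_set_scope.
Local Open Scope ring_scope.

(** * Integrals of real functions *)

Section integration_tools.
Context {d : measure_display} {T : measurableType d} {R : realType}.
Variable mu : {measure set T -> \bar R}.
Implicit Types f g : T -> R.

Lemma bounded_integrable f (B : R) : (mu setT < +oo)%E ->
  measurable_fun setT f -> (forall x, `|f x| <= B) ->
  mu.-integrable setT (EFin \o f).
Proof.
move=> muT mf fB; apply: measurable_bounded_integrable => //.
by exists B; split; [exact: num_real|move=> y By x _; exact: le_trans (fB x) (ltW By)].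
Qed.

Lemma le_integrableR f g : measurable_fun setT f -> (forall x, `|f x| <= g x) ->
  mu.-integrable setT (EFin \o g) -> mu.-integrable setT (EFin \o f).
Proof.
move=> mf fg; apply: le_integrable => //; first exact/measurable_EFinP.
by move=> x _ /=; rewrite lee_fin (le_trans (fg x))// ler_norm.
Qed.

Lemma cvg_Rintegral (fn : nat -> T -> R) f g :
  (forall n, measurable_fun setT (fn n)) ->
  (forall x, fn n x @[n --> \oo] --> f x) ->
  mu.-integrable setT (EFin \o g) -> (forall n x, `|fn n x| <= g x) ->
  \int[mu]_x fn n x @[n --> \oo] --> \int[mu]_x f x.
Proof.
move=> mfn fnf ig fng.
have mf : measurable_fun setT f by apply: (measurable_fun_cvg mfn).
have fg x : `|f x| <= g x.
  apply: (ler_cvg_to (cvg_norm (fnf x)) (cvg_cst (g x))).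
  by apply: nearW => n; exact: fng.
have if_ := le_integrableR mf fg ig.
apply: fine_cvg; rewrite fineK; last exact: integrable_fin_num.
apply: (@dominated_cvg _ _ _ _ _ _ _ _ (EFin \o g)) => //.
- by move=> n; exact/measurable_EFinP.
- by move=> x _; apply: cvg_EFin; [exact: nearW|exact: fnf].
- by move=> n x _ /=; rewrite lee_fin.
Qed.

Lemma Rintegral_sum (I : Type) (s : seq I) (h : I -> T -> R) :
  (forall i, mu.-integrable setT (EFin \o h i)) ->
  \int[mu]_x (\sum_(i <- s) h i x) = \sum_(i <- s) \int[mu]_x h i x.
Proof.
move=> ih; elim: s => [|i s IH].
  by rewrite big_nil; under eq_Rintegral do rewrite big_nil; rewrite Rintegral_cst// mul0r.
rewrite big_cons -IH -RintegralD//.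
  by apply: eq_Rintegral => x _; rewrite big_cons.
rewrite (_ : _ \o _ = fun x => (\sum_(j <- s) (EFin \o h j) x)%E).
  exact: integrable_sum.
by apply/funext => x /=; rewrite sumEFin.
Qed.

Lemma Rintegral_indic (A : set T) : measurable A ->
  \int[mu]_x (\1_A x) = fine (mu A).
Proof. by move=> mA; rewrite /Rintegral integral_indic// setIT. Qed.

End integration_tools.

Section integration_probability.
Context {d : measure_display} {T : measurableType d} {R : realType}.
Variable P : probability T R.
Implicit Types f g : T -> R.

Lemma prob_integrable f (B : R) : measurable_fun setT f -> (forall x, `|f x| <= B) ->
  P.-integrable setT (EFin \o f).
Proof. by apply: bounded_integrable; rewrite -ge0_fin_numE // fin_num_measure. Qed.

Lemma prob_Rintegral_cst (r : R) : \int[P]_x r = r.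
Proof.
rewrite Rintegral_cst// -[RHS]mulr1; congr (_ * _).
exact: (congr1 fine (probability_setT P)).
Qed.

Lemma prob_Rintegral_le f (B : R) : measurable_fun setT f ->
  (forall x, `|f x| <= B) -> `|\int[P]_x f x| <= B.
Proof.
move=> mf fB; have i1 := prob_integrable mf fB.
apply: le_trans (le_normr_Rintegral measurableT i1) _.
rewrite -[leRHS]prob_Rintegral_cst; apply: le_Rintegral => //.
- exact: integrable_norm i1.
- by apply: (@prob_integrable _ `|B|) => //; exact: measurable_cst.
Qed.

Lemma prob_Rintegral_dist f g (e B : R) :
  measurable_fun setT f -> measurable_fun setT g ->
  (forall x, `|f x| <= B) -> (forall x, `|g x| <= B) ->
  (forall x, `|f x - g x| <= e) -> `|\int[P]_x f x - \int[P]_x g x| <= e.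
Proof.
move=> mf mg fB gB fge; rewrite -RintegralB//; last 2 first.
- exact: prob_integrable fB.
- exact: prob_integrable gB.
by apply: prob_Rintegral_le => //; exact: measurable_funB.
Qed.
End integration_probability.

(** * Bounds for sine and cosine *)

Section trig_bounds.
Context {R : realType}.
Implicit Types x y u s : R.

Lemma le_of_derive_ge0 (f f' : R -> R) x : 0 <= x ->
  (forall y, is_derive y 1 f (f' y)) -> (forall y, 0 < y < x -> 0 <= f' y) ->
  f 0 <= f x.
Proof.
move=> x0 df f'0.
have df1 y : derivable f y 1 by case: (df y).
apply: (@ger0_derive1_ndecr R f 0 x) => //.
- move=> y; rewrite in_itv /= => y0x.
  by rewrite derive1E (@derive_val _ _ _ _ _ _ _ (df y)); apply: f'0.
- by apply: derivable_within_continuous => y _.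
Qed.

Lemma sin_le_id x : 0 <= x -> sin x <= x.
Proof.
move=> x0.
have := @le_of_derive_ge0 (fun y => y - sin y) (fun y => 1 - cos y) x x0.
rewrite sin0 subr0 subr_ge0; apply=> y _.
by rewrite subr_ge0 cos_le1.
Qed.

Lemma normr_sin_le x : `|sin x| <= `|x|.
Proof.
wlog x0 : x / 0 <= x.
  move=> H; case: (leP 0 x) => [/H//|x0].
  by rewrite -normrN -sinN -[leRHS]normrN; apply: H; rewrite oppr_ge0 ltW.
rewrite (ger0_norm x0) ler_norml sin_le_id// andbT.
case: (leP x 1) => [x1|x1].
  suff : 0 <= sin x by move: x0; lra.
  have [->|xn0] := eqVneq x 0; first by rewrite sin0.
  by apply/ltW/sin2_gt0; rewrite lt_neqAle eq_sym xn0 x0/=; move: x1; lra.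
by have := sin_geN1 x; move: x1; lra.
Qed.

Lemma one_subcos x : 1 - cos x = (sin (x / 2) ^+ 2) *+ 2.
Proof.
have {1}-> : x = (x / 2) *+ 2 by rewrite -mulr_natr divfK.
by rewrite cos_mulr2n cos2sin2; lra.
Qed.

Lemma one_subcos_le x : 1 - cos x <= x ^+ 2 / 2.
Proof.
rewrite one_subcos; have := normr_sin_le (x / 2).
rewrite -ler_sqr ?nnegrE// !real_normK ?num_real//; lra.
Qed.

Lemma one_subcos_ge x : `|x| <= 2 -> x ^+ 2 / 8 <= 1 - cos x.
Proof.
wlog x0 : x / 0 <= x.
  move=> H; case: (leP 0 x) => [/H//|x0].
  by rewrite -normrN -cosN -sqrrN; apply: H; rewrite oppr_ge0 ltW.
rewrite ger0_norm// => x2.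
have x2' : 0 <= x / 2 by move: x0; lra.
have := @le_of_derive_ge0 (fun y => sin y - 2^-1 * y) (fun y => cos y - 2^-1)
   (x / 2) x2'.
rewrite sin0 mulr0 subrr => /(_ _ _)/wrap[].
- move=> y; have -> : cos y - 2^-1 = cos y - 2^-1 *: 1 by rewrite /GRing.scale /= mulr1.
  apply: is_deriveB; apply: is_deriveZ.
- move=> y /andP[y0 yx]; have := one_subcos_le y.
  have : y ^+ 2 <= 1 by rewrite expr_le1// ?(ltW y0)//; move: yx x2; lra.
  lra.
- move=> h; rewrite one_subcos.
  have : (2^-1 * (x/2)) ^+ 2 <= sin (x / 2) ^+ 2.
    rewrite ler_sqr ?nnegrE//; move: h x0; lra.
  lra.
Qed.

Lemma sin_sub_id_ge x : 0 <= x -> x - sin x <= x ^+ 2 / 2.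
Proof.
move=> x0; have := @le_of_derive_ge0 (fun y => 2^-1 * y ^+ 2 - (y - sin y))
  (fun y => y - (1 - cos y)) x x0.
rewrite sin0 expr0n /= !(mulr0,subr0) => /(_ _ _)/wrap[].
- move=> y; apply: is_derive_eq; rewrite /GRing.scale /=; lra.
- move=> y /andP[y0 _]; have := one_subcos_le y; have := cos_geN1 y => h1 h2.
  case: (leP y 2) => y2; last by move: y2 h1; lra.
  have : y ^+ 2 <= 2 * y by rewrite expr2 ler_wpM2r// ltW.
  move: h2; lra.
- lra.
Qed.

Lemma normr_sin_sub_id x : `|sin x - x| <= x ^+ 2 / 2.
Proof.
wlog x0 : x / 0 <= x.
  move=> H; case: (leP 0 x) => [/H//|x0].
  by rewrite -normrN -sqrrN opprD -sinN; apply: H; rewrite oppr_ge0 ltW.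
rewrite distrC ger0_norm ?sin_sub_id_ge// subr_ge0; exact: sin_le_id.
Qed.

Lemma id_sub_sin_ge x : 0 <= x <= 2 -> x ^+ 3 / 24 <= x - sin x.
Proof.
move=> /andP[x0 x2]; have := @le_of_derive_ge0 (fun y => (y - sin y) - 24^-1 * y ^+ 3)
  (fun y => (1 - cos y) - y ^+ 2 / 8) x x0.
rewrite sin0 expr0n /= !(mulr0,subr0) => /(_ _ _)/wrap[].
- move=> y; apply: is_derive_eq; rewrite /GRing.scale /=; lra.
- move=> y /andP[y0 yx]; rewrite subr_ge0; apply: one_subcos_ge.
  by rewrite ger0_norm ?(ltW y0)//; move: yx x2; lra.
- lra.
Qed.

Lemma integral_one_subcos u : u != 0 ->
  (\int[lebesgue_measure]_(s in `[0%R, 1%R]) (1 - cos (s * u))%:E)%E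
  = (1 - sin u / u)%:E.
Proof.
move=> u0.
have dF (s : R) : is_derive s 1 (fun s => s - u^-1 * sin (s * u)) (1 - cos (s * u)).
  apply: is_derive_eq; rewrite /GRing.scale /=.
  by field.
rewrite (@continuous_FTC2 _ _ (fun s => s - u^-1 * sin (s * u)))//.
- by rewrite mul1r mul0r sin0 mulr0 subr0 sube0 mulrC.
- apply: continuous_subspaceT => s.
  apply: differentiable_continuous; apply/derivable1_diffP.
  exact: ex_derive.
- have cF : continuous (fun s => s - u^-1 * sin (s * u)).
    by move=> s; apply: differentiable_continuous; apply/derivable1_diffP; case: (dF s).
  split.
  + by move=> s _; case: (dF s).
  + exact: cvg_at_right_filter (cF 0).
  + exact: cvg_at_left_filter (cF 1).
- by move=> s _; rewrite derive1E; rewrite (@derive_val _ _ _ _ _ _ _ (dF s)).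
Qed.

(** Averaging over [s] makes a lower bound possible: for a fixed frequency the
    function [1 - cos] vanishes at arbitrarily large arguments. *)
Lemma integral_one_subcos_ge u :
  ((Num.min 1 (u ^+ 2) / 24)%:E <=
   \int[lebesgue_measure]_(s in `[0%R, 1%R]) (1 - cos (s * u))%:E)%E.
Proof.
have [->|u0] := eqVneq u 0.
  rewrite expr0n /= (min_idPr _) ?ler01// mul0r.
  by apply: integral_ge0 => s _; rewrite lee_fin subr_ge0 cos_le1.
rewrite integral_one_subcos// lee_fin.
have -> : sin u / u = sin `|u| / `|u|.
  case: (leP 0 u) => [/ger0_norm->//|/ltr0_norm->].
  by rewrite sinN invrN mulrNN.
have -> : u ^+ 2 = `|u| ^+ 2 by rewrite real_normK ?num_real.
have v0 : 0 < `|u| by rewrite normr_gt0.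
suff H (v : R) : 0 < v -> Num.min 1 (v ^+ 2) / 24 <= 1 - sin v / v by exact: H.
clear; move=> v0; rewrite lerBrDr -lerBrDl ler_pdivrMr//.
case: (leP v 2) => v2.
  have := @id_sub_sin_ge v; rewrite (ltW v0) v2 => /(_ isT) h.
  have : Num.min 1 (v ^+ 2) <= v ^+ 2 by rewrite ge_min lexx orbT.
  move=> /(@ler_wpM2r _ v (ltW v0)); rewrite -exprSr; lra.
have : Num.min 1 (v ^+ 2) <= 1 by rewrite ge_min lexx.
move=> /(@ler_wpM2r _ v (ltW v0)).
have := sin_le1 v; lra.
Qed.
End trig_bounds.

(** * Loeb measures *)

Record freeUltra := FreeUltra {
  fu : set_system nat;
  fu_ultra : UltraFilter fu;
  fu_free : \oo `<=` fu }.

Section free_ultrafilter.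
Variable U : freeUltra.

Lemma fu_proper : ProperFilter (fu U).
Proof. exact: (@ultra_proper _ _ (fu_ultra U)). Qed.

#[local] Existing Instance fu_proper.
Lemma fu_filter : Filter (fu U).
Proof. exact: filter_filter. Qed.
#[local] Existing Instance fu_filter.

Lemma fu_setC (A : set nat) : fu U (~` A) <-> ~ fu U A.
Proof.
split=> [UCA UA|].
  have : fu U (A `&` ~` A) by exact: filterI.
rewrite setICr; exact: filter_not_empty.
by case: (in_ultra_setVsetC A (fu_ultra U)).
Qed.

Context {R : realType}.
Implicit Types x : nat -> R.

Lemma fu_fmap_ultra T (f : nat -> T) : UltraFilter (f @ fu U).
Proof.
split=> [|G GG sG]; first exact: fmap_proper_filter.
rewrite eqEsubset; split=> // A GA.
apply: contrapT => /fu_setC /(sG (~` A)) GCA.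
have : G (A `&` ~` A) by exact: filterI.
rewrite setICr; exact: filter_not_empty.
Qed.

Lemma ucvg x (B : R) : (forall n, `|x n| <= B) -> cvg (x @ fu U).
Proof.
move=> xB; have uU := fu_fmap_ultra x.
have : `[- B, B]%classic `&` [set p | x @ fu U --> p] !=set0.
  have := @segment_compact R (- B) B; rewrite compact_ultra; apply => //.
  have : fu U [set n | `[- B, B]%classic (x n)].
    by apply: filterE => n /=; rewrite in_itv /= -ler_norml; exact: xB.
  by [].
by move=> [l [_ xl]]; apply/cvg_ex; exists l.
Qed.

Lemma ulim_oo x (l : R) : x n @[n --> \oo] --> l -> x @ fu U --> l.
Proof. by move=> xl A /xl; exact: fu_free. Qed.

End free_ultrafilter.

Lemma free_ultra : exists U : freeUltra, True.
Proof.
have [G [GU sG]] := @ultraFilterLemma nat \oo eventually_filter.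
by exists (FreeUltra GU sG).
Qed.

#[global] Existing Instance fu_proper.
#[global] Existing Instance fu_filter.

(** The points of the nonstandard extension of [T], before identification
    modulo the ultrafilter. *)
Definition useq (U : freeUltra) (T : Type) := nat -> T.

Definition internal (U : freeUltra) T (A : nat -> set T) : set (useq U T) :=
  [set w | fu U [set n | A n (w n)]].

Section internal_sets.
Variables (U : freeUltra) (T : pointedType).
Implicit Types A B : nat -> set T.
Local Notation int := (@internal U T).

Lemma internalU A B : int (fun n => A n `|` B n) = int A `|` int B.
Proof.
rewrite eqEsubset; split=> w; last first.
  by case; apply: filterS => n; [left|right].
rewrite /internal /= => UAB.
have [?|UA] := pselect (fu U [set n | A n (w n)]); [by left|right].
move/fu_setC : UA => UA; apply: filterS (filterI UAB UA) => n [[]]//.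
Qed.

Lemma internalC A : int (fun n => ~` A n) = ~` int A.
Proof. by rewrite eqEsubset; split=> w /= /fu_setC. Qed.

Lemma internalI A B : int (fun n => A n `&` B n) = int A `&` int B.
Proof.
rewrite eqEsubset; split=> w.
  by move=> UAB; split; apply: filterS UAB => n [].
by move=> [UA UB]; apply: filterS (filterI UA UB) => n [].
Qed.

(** At every index where the inclusion fails pick a witness; if these indices were large,
    the witnesses would form a point of the first internal set outside the second. *)
Lemma internal_sub A B : int A `<=` int B -> fu U [set n | A n `<=` B n].
Proof.
move=> AB; apply: contrapT => /fu_setC UN.
have [w wP] : {w : nat -> T & forall n, ~ (A n `<=` B n) ->
    A n (w n) /\ ~ B n (w n)}.
  apply: (@choice _ _ (fun n t => ~ (A n `<=` B n) -> A n t /\ ~ B n t)) => n.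
  have [AB'|/existsNP[t /not_implyP tP]] := pselect (A n `<=` B n).
    by exists point => /(_ AB').
  by exists t.
have /AB wB : int A w by apply: filterS UN => n /= /wP[].
have : fu U set0 by apply: filterS (filterI UN wB) => n /= -[/wP[]].
exact: (@filter_not_empty _ _ (fu_proper U)).
Qed.

(** Countable saturation: [w n] is taken in as many of the sets
    [A 0 n, ..., A n n] as can be met simultaneously. *)
Lemma saturation (A : nat -> nat -> set T) :
  (forall k, exists w, forall i, (i <= k)%N -> int (A i) w) ->
  exists w, forall i, int (A i) w.
Proof.
move=> satA; pose Q n k t := forall i, (i <= k)%N -> A i n t.
have [w wP] : {w : nat -> T & forall n k, (k <= n)%N ->
    (exists t, Q n k t) -> Q n k (w n)}.
  apply: (@choice _ _ (fun n t => forall k, (k <= n)%N ->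
    (exists t, Q n k t) -> Q n k t)) => n.
  suff H K : exists t, forall k, (k <= K)%N -> (exists t, Q n k t) -> Q n k t.
    exact: H.
  elim: K => [|K [t tP]].
    have [[t tQ]|nQ] := pselect (exists t, Q n 0 t).
      by exists t => k; rewrite leqn0 => /eqP ->.
    by exists point => k; rewrite leqn0 => /eqP ->.
  have [[t' tQ]|nQ] := pselect (exists t, Q n K.+1 t).
    by exists t' => k kK _ i ik; apply: tQ; apply: leq_trans kK.
  by exists t => k; rewrite leq_eqVlt => /predU1P[->//|kK]; exact: tP.
exists w => i; have [v vP] := satA i.
have Uv : fu U [set n | Q n i (v n)].
  suff H k : (k <= i)%N -> fu U [set n | Q n k (v n)] by exact: H.
  elim: k => [_|k ih ki].
    by apply: filterS (vP 0 isT) => n ? j; rewrite leqn0 => /eqP ->.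
  apply: filterS (filterI (ih (ltnW ki)) (vP k.+1 ki)) => n [Qk Ak] j.
  by rewrite leq_eqVlt => /predU1P[->//|]; exact: Qk.
have Ui : fu U [set n | (i <= n)%N] by apply: fu_free; exact: nbhs_infty_ge.
apply: filterS (filterI Uv Ui) => n [Qv ni].
by apply: (wP n i ni) => //; exists (v n).
Qed.

End internal_sets.

Definition useq_display (d : measure_display) : measure_display.
Proof. exact. Qed.

Section internal_algebra.
Variables (U : freeUltra) (d : measure_display) (T : measurableType d).
Local Notation int := (@internal U T).

HB.instance Definition _ := gen_eqMixin (useq U T).
HB.instance Definition _ := gen_choiceMixin (useq U T).
HB.instance Definition _ := isPointed.Build (useq U T) (fun=> point).

Definition internal_measurable : set (set (useq U T)) :=
  [set int A | A in [set A : nat -> set T | forall n, measurable (A n)]].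

Let im0 : internal_measurable set0.
Proof.
exists (fun=> set0) => //; rewrite -subset0 => w /=.
exact: filter_not_empty.
Qed.

Let imU : setU_closed internal_measurable.
Proof.
move=> _ _ [A mA <-] [B mB <-]; rewrite -internalU.
by exists (fun n => A n `|` B n) => // n; exact: measurableU.
Qed.

Let imC : setC_closed internal_measurable.
Proof.
move=> _ [A mA <-]; rewrite -internalC.
by exists (fun n => ~` A n) => // n; exact: measurableC.
Qed.

HB.instance Definition _ := @isAlgebraOfSets.Build (useq_display d)
  (useq U T) internal_measurable im0 imU imC.

End internal_algebra.

Section loeb.
Variables (U : freeUltra) (R : realType) (d : measure_display)
  (T : measurableType d) (mu : nat -> probability T R).
Local Notation int := (@internal U T).
Implicit Types A B : nat -> set T.

Let ulim (x : nat -> R) : R := lim (x @ fu U).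

Let p A n : R := fine (mu n (A n)).

Let mA_fin A n : (forall n, measurable (A n)) -> mu n (A n) = (p A n)%:E.
Proof. by move=> mA; rewrite fineK// fin_num_measure. Qed.

Let p01 A n : (forall n, measurable (A n)) -> 0 <= p A n <= 1.
Proof.
move=> mA; rewrite -!lee_fin -mA_fin// measure_ge0 /=; exact: probability_le1.
Qed.

Lemma loeb_cvg A : (forall n, measurable (A n)) ->
  (fun n => fine (mu n (A n))) @ fu U --> lim ((fun n => fine (mu n (A n))) @ fu U).
Proof.
move=> mA; apply: (@ucvg U R _ 1) => n; have /andP[h0 h1] := p01 n mA.
by rewrite ger0_norm.
Qed.

Let loeb_mono A B : (forall n, measurable (A n)) -> (forall n, measurable (B n)) ->
  int A `<=` int B -> ulim (p A) <= ulim (p B).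
Proof.
move=> mA mB /internal_sub AB.
apply: (ler_cvg_to (loeb_cvg mA) (loeb_cvg mB)).
apply: filterS AB => n AB; rewrite -lee_fin -!mA_fin//.
by apply: le_measure; rewrite ?inE.
Qed.

(** Internal sets have many representing sequences; the limit is the same for all, so any
    choice will do. *)
Definition loeb_content (X : set (useq U T)) : \bar R :=
  let A := xget (fun=> set0) [set A | (forall n, measurable (A n)) /\ int A = X] in
  (ulim (p A))%:E.

Lemma loeb_contentE A : (forall n, measurable (A n)) ->
  loeb_content (int A) = (lim ((fun n => fine (mu n (A n))) @ fu U))%:E.
Proof.
move=> mA; rewrite /loeb_content.
case: xgetP => [B _ [mB BA]|]; last by move/(_ A); case.
by congr EFin; apply/eqP; rewrite eq_le !loeb_mono// BA.
Qed.

Let content0 : loeb_content set0 = 0%E.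
Proof.
have -> : set0 = int (fun=> set0).
  rewrite eqEsubset; split=> // w; exact: filter_not_empty.
rewrite loeb_contentE//; congr EFin.
by under eq_fun do rewrite measure0; exact: lim_cst.
Qed.

Let content_ge0 X : (0 <= loeb_content X)%E.
Proof.
rewrite lee_fin; set A := xget _ _.
have mA n : measurable (A n) by rewrite /A; case: xgetP => // B _ [].
apply: (ler_cvg_to (cvg_cst 0) (loeb_cvg mA)).
by apply: nearW => n; have /andP[] := p01 n mA.
Qed.

Let contentU A B : (forall n, measurable (A n)) -> (forall n, measurable (B n)) ->
  int A `&` int B = set0 ->
  loeb_content (int A `|` int B) = (loeb_content (int A) + loeb_content (int B))%E.
Proof.
move=> mA mB AB0; rewrite -internalU !loeb_contentE//; last first.
  by move=> n; exact: measurableU.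
rewrite -EFinD; congr EFin.
apply: cvg_lim => //; apply: (cvg_trans _ (cvgD (loeb_cvg mA) (loeb_cvg mB))).
apply: near_eq_cvg.
have : int (fun n => A n `&` B n) `<=` int (fun=> set0).
  by rewrite internalI AB0.
move=> /internal_sub; apply: filterS => n ABn /=.
by rewrite measureU ?fineD ?fin_num_measure//; rewrite -subset0.
Qed.

Let content_bigU (F : nat -> set (useq U T)) n :
  (forall i, measurable (F i)) -> trivIset setT F ->
  measurable (\big[setU/set0]_(i < n) F i) /\
  loeb_content (\big[setU/set0]_(i < n) F i) = (\sum_(i < n) loeb_content (F i))%E.
Proof.
move=> mF tF; elim: n => [|n [mn ih]]; first by rewrite !big_ord0.
rewrite !big_ord_recr /=; split; first exact: measurableU.
rewrite -ih; case: mn (mF n) => A mA AE [B mB BE].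
rewrite -AE -BE contentU// AE BE.
rewrite -bigcup_mkord -subset0 => w [[i /= ilt Fi] Fn].
have ij : i = n by apply: (tF i n) => //; exists w.
by move: ilt; rewrite ij ltnn.
Qed.

(** A countable disjoint union of internal sets that is internal has only
    finitely many nonempty terms, by saturation. *)
Let content_sigma_additive : semi_sigma_additive loeb_content.
Proof.
move=> F mF tF [B mB BE].
have [A AP] : {A : nat -> nat -> set T & forall i,
    (forall n, measurable (A i n)) /\ int (A i) = F i}.
  apply: (@choice _ _ (fun i A => (forall n, measurable (A n)) /\ int A = F i)) => i.
  by have [A mA AE] := mF i; exists A.
have [K KP] : exists K, forall w, int B w -> exists2 i, (i < K)%N & F i w.
  apply: contrapT => nK.
  have [w wP] : exists w, forall i, int (fun n => B n `&` ~` A i n) w.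
    apply: saturation => k; apply: contrapT => nw; apply: nK; exists k.+1 => w Bw.
    apply: contrapT => nF; apply: nw; exists w => i ik.
    rewrite internalI internalC (AP i).2; split=> // Fi.
    by apply: nF; exists i.
  have : (\bigcup_n F n) w.
    by rewrite -BE; have := wP 0; rewrite internalI => -[].
  by move=> [i _]; have := wP i; rewrite internalI internalC (AP i).2 => -[].
have UE : \bigcup_n F n = \big[setU/set0]_(i < K) F i.
  rewrite -BE -bigcup_mkord eqEsubset; split=> w; first by move=> /KP[i iK Fi]; exists i.
  by move=> [i iK Fi]; rewrite BE; exists i.
have F0 i : (K <= i)%N -> F i = set0.
  move=> Ki; rewrite -subset0 => w Fw.
  have [j jK Fj] : exists2 j, (j < K)%N & F j w by apply: KP; rewrite BE; exists i.
  have ji : j = i by apply: (tF j i) => //; exists w.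
  by move: jK; rewrite ji ltnNge Ki.
rewrite UE (content_bigU K mF tF).2.
apply: cvg_near_cst; near=> n.
have Kn : (K <= n)%N by near: n; exact: nbhs_infty_ge.
rewrite (@big_cat_nat _ _ _ K)//= [X in (_ + X)%E]big_nat_cond [X in (_ + X)%E]big1 ?adde0 ?big_mkord//.
by move=> i /andP[/andP[Ki _] _]; rewrite F0.
Unshelve. all: by end_near. Qed.

HB.instance Definition _ := isMeasure.Build (useq_display d) (useq U T) R
  loeb_content content0 content_ge0 content_sigma_additive.

(** The Loeb measure: the Caratheodory extension of the ultrafilter limit of the [mu n]. *)
Definition loeb := measure_extension loeb_content.

HB.instance Definition _ := Measure.on loeb.

Lemma loebE A : (forall n, measurable (A n)) ->
  loeb (int A) = (lim ((fun n => fine (mu n (A n))) @ fu U))%:E.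
Proof.
move=> mA; rewrite -loeb_contentE// /loeb /measure_extension.
by rewrite measurable_mu_extE//; exists A.
Qed.

End loeb.

(** * Integrals against a Loeb measure *)

Section staircase.
Context {R : realType}.

(** The multiple of [1 / (k + 1)] just below [v], written through the level sets of [v]:
    finitely many sets at a time pass to the ultrafilter limit. *)
Definition stair (k : nat) (v : R) : R :=
  k.+1%:R^-1 * \sum_(j < k.+1) ((j.+1%:R <= k.+1%:R * v)%R)%:R.

Lemma stair_dist k (v : R) : 0 <= v <= 1 -> `|stair k v - v| <= k.+1%:R^-1.
Proof.
move=> /andP[v0 v1]; have k0 : 0 < k.+1%:R :> R by rewrite ltr0n.
have kv0 : 0 <= k.+1%:R * v by rewrite mulr_ge0// ltW.
have [N [N1 N2]] : exists N : nat, N%:R <= k.+1%:R * v /\ k.+1%:R * v < N.+1%:R.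
  by have /andP[h1 h2] := truncn_itv kv0; exists (Num.truncn (k.+1%:R * v)).
have Nk : (N <= k.+1)%N.
  rewrite -(ler_nat R); apply: le_trans N1 _; rewrite -[leRHS]mulr1.
  by rewrite ler_wpM2l// ltW.
have sE : \sum_(j < k.+1) ((j.+1%:R <= k.+1%:R * v)%R)%:R = N%:R :> R.
  rewrite -(big_mkord xpredT (fun j => ((j.+1%:R <= k.+1%:R * v)%R)%:R)).
  rewrite (@big_cat_nat _ _ _ N)//= [X in _ + X]big_nat_cond [X in _ + X]big1 ?addr0.
    rewrite big_nat_cond (eq_bigr (fun=> 1)) -?big_nat_cond.
      by rewrite sumr_const_nat subn0.
    move=> j /andP[/andP[_ jN] _].
    by rewrite (_ : _ <= _ = true)//; apply: le_trans N1; rewrite ler_nat.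
  move=> j /andP[/andP[Nj _] _].
  rewrite (_ : _ <= _ = false)//; apply/negbTE; rewrite -ltNge.
  by apply: lt_le_trans N2 _; rewrite ler_nat.
rewrite /stair sE.
have -> : k.+1%:R^-1 * N%:R - v = k.+1%:R^-1 * (N%:R - k.+1%:R * v).
  by rewrite mulrBr mulKf// gt_eqF.
rewrite normrM gtr0_norm ?invr_gt0// ler_piMr ?invr_ge0 ?(ltW k0)//.
by rewrite distrC ger0_norm ?subr_ge0// lerBlDl natr1 ltW.
Qed.

Lemma stair01 k (v : R) : 0 <= stair k v <= 1.
Proof.
have s0 : 0 <= \sum_(j < k.+1) ((j.+1%:R <= k.+1%:R * v)%R)%:R :> R.
  by apply: sumr_ge0 => j _; rewrite ler0n.
rewrite /stair mulr_ge0 ?invr_ge0//= mulrC ler_pdivrMr// mul1r.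
apply: (@le_trans _ _ (\sum_(j < k.+1) 1)); last by rewrite sumr_const card_ord.
by apply: ler_sum => j _; rewrite lern1 leq_b1.
Qed.
End staircase.

Section loeb_integral.
Variables (U : freeUltra) (R : realType) (d : measure_display)
  (T : measurableType d) (mu : nat -> probability T R).
Local Notation int := (@internal U T).
Local Notation Om := (g_sigma_algebraType (@measurable _ (useq U T))).
Local Notation P := (@loeb U R d T mu).

Lemma measurable_internal (A : nat -> set T) : (forall n, measurable (A n)) ->
  measurable (int A : set Om).
Proof. by move=> mA; apply: sub_sigma_algebra; exists A. Qed.

Let loebT : P setT = 1%E.
Proof.
have -> : setT = int (fun=> setT) by rewrite eqEsubset; split=> // w _; exact: filterT.
rewrite loebE//; congr EFin.
have -> : (fun n => fine (mu n [set: T])) = fun=> 1.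
  by apply/funext => n; exact: (congr1 fine (probability_setT (mu n))).
exact: lim_cst.
Qed.

HB.instance Definition _ := Measure_isProbability.Build _ _ _ P loebT.

Section integrand.
Variables (g : T -> R).
Hypotheses (mg : measurable_fun setT g) (g01 : forall x, 0 <= g x <= 1).

Let gh (w : Om) : R := lim (g (w n) @[n --> fu U]).

Let gcvg (w : Om) : g (w n) @[n --> fu U] --> gh w.
Proof.
apply: (@ucvg U R (g \o w) 1) => n /=; have /andP[h0 h1] := g01 (w n).
by rewrite ger0_norm.
Qed.

Let A k j : set T := [set x | j.+1%:R <= k.+1%:R * g x].

Let mA k j : measurable (A k j).
Proof.
rewrite -[A k j]setTI; apply: (@measurable_fun_ler _ _ _ _ (fun=> j.+1%:R)) => //.
exact: measurable_funM.
Qed.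

Let G k (w : Om) : R := k.+1%:R^-1 * \sum_(j < k.+1) \1_(int (fun=> A k j)) w.

Let mAint k j : measurable (int (fun=> A k j) : set Om).
Proof. exact: measurable_internal. Qed.

Let mG k : measurable_fun setT (G k).
Proof.
apply: measurable_funM => //; apply: measurable_sum => j.
exact: measurable_indic.
Qed.

Let GE k w : fu U [set n | G k w = stair k (g (w n))].
Proof.
suff H m : (m <= k.+1)%N -> fu U [set n | forall j, (j < m)%N ->
    (\1_(int (fun=> A k j)) w = ((j.+1%:R <= k.+1%:R * g (w n))%R)%:R :> R)].
  apply: filterS (H k.+1 (leqnn _)) => n /= Hn; rewrite /G /stair.
  by congr (_ * _); apply: eq_bigr => j _; exact: Hn.
elim: m => [_|m ih mk]; first by apply: filterE => n j; rewrite ltn0.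
have Um : fu U [set n | (\1_(int (fun=> A k m)) w
    = ((m.+1%:R <= k.+1%:R * g (w n))%R)%:R :> R)].
  have [wA|/fu_setC wA] := pselect (int (fun=> A k m) w).
    by apply: filterS (wA) => n /= h; rewrite indicE mem_set// h.
  apply: filterS (wA) => n /= /negP/negbTE ->.
  by rewrite indicE memNset//; apply/fu_setC.
apply: filterS (filterI (ih (ltnW mk)) Um) => n [h1 h2] j.
by rewrite ltnS leq_eqVlt => /predU1P[->//|]; exact: h1.
Qed.

Let G_dist k w : `|G k w - gh w| <= k.+1%:R^-1.
Proof.
apply: (ler_cvg_to (cvg_norm (cvgB (cvg_cst (G k w)) (gcvg (w := w)))) (cvg_cst _)).
by apply: filterS (GE k w) => n /= ->; exact: stair_dist.
Qed.

Lemma measurable_ulim : measurable_fun setT gh.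
Proof.
apply: (measurable_fun_cvg mG) => w _.
apply/cvgrPdist_le => /= e e0.
near=> k; rewrite distrC; apply: le_trans (G_dist k w) _.
near: k; have := near_infty_natSinv_lt (PosNum e0).
by apply: filterS => k /ltW.
Unshelve. all: by end_near. Qed.

Let gbnd x : `|g x| <= 1.
Proof. by have /andP[h0 h1] := g01 x; rewrite ger0_norm. Qed.

Let ghbnd w : `|gh w| <= 1.
Proof.
apply: (ler_cvg_to (cvg_norm (gcvg (w := w))) (cvg_cst _)).
by apply: nearW => n; exact: gbnd.
Qed.

Let st k x : R := stair k (g x).

Let stE k x : st k x = k.+1%:R^-1 * \sum_(j < k.+1) \1_(A k j) x.
Proof.
rewrite /st /stair; congr (_ * _); apply: eq_bigr => j _.
rewrite indicE; congr (_%:R); congr nat_of_bool.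
by apply/idP/idP; rewrite inE.
Qed.

Let mst k : measurable_fun setT (st k).
Proof.
rewrite (_ : st k = fun x => k.+1%:R^-1 * \sum_(j < k.+1) \1_(A k j) x).
  apply: measurable_funM => //; apply: measurable_sum => j; exact: measurable_indic.
by apply/funext => x; exact: stE.
Qed.

Let stbnd k x : `|st k x| <= 1.
Proof. by have /andP[h0 h1] := stair01 k (g x); rewrite ger0_norm. Qed.

Let indic_int (d' : measure_display) (T' : measurableType d') (Q : probability T' R)
  (B : set T') : measurable B -> Q.-integrable setT (EFin \o \1_B).
Proof.
move=> mB; apply: (@prob_integrable _ _ _ _ _ 1) => [|x]; first exact: measurable_indic.
by rewrite indicE; case: (_ \in _); rewrite ?normr1 ?normr0.
Qed.

Let combine (d' : measure_display) (T' : measurableType d') (Q : probability T' R)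
  k (B : nat -> set T') : (forall j, measurable (B j)) ->
  \int[Q]_x (k.+1%:R^-1 * \sum_(j < k.+1) \1_(B j) x)
  = k.+1%:R^-1 * \sum_(j < k.+1) fine (Q (B j)).
Proof.
move=> mB; rewrite RintegralZl//.
  rewrite Rintegral_sum => [|i]; last exact: indic_int.
  by congr (_ * _); apply: eq_bigr => j _; rewrite Rintegral_indic.
apply: (@prob_integrable _ _ _ _ _ k.+1%:R) => [|x].
  by apply: measurable_sum => j; exact: measurable_indic.
rewrite ger0_norm ?sumr_ge0//.
apply: (@le_trans _ _ (\sum_(j < k.+1) 1)); last by rewrite sumr_const card_ord.
by apply: ler_sum => j _; rewrite indicE lern1 leq_b1.
Qed.

Let intG k : \int[mu n]_x st k x @[n --> fu U] --> \int[P]_w G k w.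
Proof.
rewrite [X in _ --> X](@combine _ _ P k (fun j => int (fun=> A k j)) (mAint k)).
have -> : (fun n => \int[mu n]_x st k x)
    = fun n => k.+1%:R^-1 * \sum_(j < k.+1) fine (mu n (A k j)).
  apply/funext => n; rewrite -combine; last exact: mA.
  by apply: eq_Rintegral => x _; exact: stE.
apply: cvgMr; apply: cvg_big => [|j _]; first exact: add_continuous.
have := @loeb_cvg U R _ _ mu (fun=> A k j) (fun=> mA k j).
by rewrite -[lim _]/(fine (lim _)%:E) -(@loebE U R _ _ mu (fun=> A k j) (fun=> mA k j)).
Qed.

(** Within [1 / (k + 1)] both integrals are combinations of the measures of finitely many
    level sets of [g], for which convergence defines the Loeb measure. *)
Lemma cvg_ulim_integral : \int[mu n]_x g x @[n --> fu U] --> \int[P]_w gh w.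
Proof.
have icvg : cvg (\int[mu n]_x g x @[n --> fu U]).
  by apply: (@ucvg U R _ 1) => n; exact: prob_Rintegral_le.
pose l : R := lim (\int[mu n]_x g x @[n --> fu U]).
suff H (e : R) : 0 < e -> `|l - \int[P]_w gh w| <= e.
  suff <- : l = \int[P]_w gh w by [].
  apply/eqP; rewrite -subr_eq0 -normr_le0; apply/ler_addgt0Pl => e e0.
  by rewrite addr0; exact: H.
move=> e0.
have [k ke] : exists k : nat, k.+1%:R^-1 <= e / 2.
  have e20 : 0 < e / 2 by rewrite divr_gt0.
  have [k _ kP] := near_infty_natSinv_lt (PosNum e20).
  by exists k; apply/ltW; apply: (kP k) => /=.
have h1 : `|l - \int[P]_w G k w| <= e / 2.
  apply: (ler_cvg_to (cvg_norm (cvgB icvg (@intG k))) (cvg_cst _)).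
  apply: nearW => n /=; apply: le_trans ke.
  apply: (@prob_Rintegral_dist _ _ _ (mu n) _ _ _ 1 mg (@mst k) gbnd (stbnd k)) => x.
  by rewrite distrC; exact: stair_dist.
have h2 : `|\int[P]_w G k w - \int[P]_w gh w| <= e / 2.
  apply: le_trans ke.
  apply: (@prob_Rintegral_dist _ _ _ _ _ _ _ 2%:R (mG k) measurable_ulim) => w.
  - rewrite -[G k w](subrK (gh w)) -[2%:R]/(1 + 1).
    apply: le_trans (ler_normD _ _) (lerD _ (ghbnd w)).
    by apply: le_trans (G_dist k w) _; rewrite invf_le1 ?ltr0n// ler1n.
  - by apply: le_trans (ghbnd w) _; rewrite ler1n.
  - exact: G_dist.
have -> : l - \int[P]_w gh w = (l - \int[P]_w G k w) + (\int[P]_w G k w - \int[P]_w gh w).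
  by rewrite addrA subrK.
by apply: le_trans (ler_normD _ _) _; rewrite [leRHS]splitr lerD.
Qed.

End integrand.
End loeb_integral.

(** * Weak limits of tight sequences *)

Section weak_limits.
Variables (U : freeUltra) (R : realType) (d : nat).
Local Notation V := (d.-tuple R).

Lemma ucvg_near (x : nat -> R) (B : R) :
  fu U [set n | `|x n| <= B] -> cvg (x @ fu U).
Proof.
move=> xB; pose x' n := if `|x n| <= B then x n else 0.
have : cvg (x' @ fu U).
  apply: (@ucvg U R _ `|B|) => n; rewrite /x'; case: ifPn => [h|_].
    by apply: le_trans h _; rewrite ler_norm.
  by rewrite normr0.
move=> /cvg_ex[l xl]; apply/cvg_ex; exists l; apply: cvg_trans xl.
by apply: near_eq_cvg; apply: filterS xB => n /=; rewrite /x' => ->.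
Qed.

Definition ucontinuous (g : V -> R) := forall (w : nat -> V) (v : V),
  (forall j, tnth (w n) j @[n --> fu U] --> tnth v j) ->
  g (w n) @[n --> fu U] --> g v.

Variable mu : nat -> probability V R.
Local Notation Om := (g_sigma_algebraType (@measurable _ (useq U V))).
Local Notation P := (@loeb U R _ V mu).

(** The truncated exponentials of [x] and [- x] are bounded, so that they always have
    ultrafilter limits, and the difference of their logarithms recovers [x]. *)
Let cut (s : bool) j (x : V) : R := Num.min 1 (expR ((-1) ^+ s * tnth x j)).

Let mcut s j : measurable_fun setT (cut s j).
Proof.
apply: measurable_minr => //; apply: measurableT_comp => //.
by apply: measurable_funM => //; exact: measurable_tnth.
Qed.

Let cut01 s j x : 0 <= cut s j x <= 1.
Proof. by rewrite /cut le_min ler01 expR_ge0 ge_min lexx. Qed.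

(** The standard part, written so that it is measurable on all of [Om]. *)
Let st (w : Om) : V :=
  [tuple ln (lim (cut false j (w n) @[n --> fu U]))
         - ln (lim (cut true j (w n) @[n --> fu U])) | j < d].

Let mst : measurable_fun setT st.
Proof.
apply/measurable_fun_tnthP => j.
rewrite (_ : _ \o _ = fun w => ln (lim (cut false j (w n) @[n --> fu U]))
         - ln (lim (cut true j (w n) @[n --> fu U]))); last first.
  by apply/funext => w /=; rewrite tnth_mktuple.
apply: measurable_funB.
- apply: measurableT_comp; first exact: measurable_ln.
  exact: (measurable_ulim (@mcut false j) (@cut01 false j)).
- apply: measurableT_comp; first exact: measurable_ln.
  exact: (measurable_ulim (@mcut true j) (@cut01 true j)).
Qed.

Let stP (w : Om) j (B : R) : fu U [set n | `|tnth (w n) j| <= B] ->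
  tnth (w n) j @[n --> fu U] --> tnth (st w) j.
Proof.
move=> /ucvg_near /cvg_ex[v wv]; rewrite /st tnth_mktuple.
suff cv s : lim (cut s j (w n) @[n --> fu U]) = Num.min 1 (expR ((-1) ^+ s * v)).
  rewrite !cv expr0 expr1 mul1r mulN1r.
  suff -> : ln (Num.min 1 (expR v)) - ln (Num.min 1 (expR (- v))) = v by [].
  case: (leP 0 v) => v0.
    rewrite (min_idPl _) -?expR0 ?ler_expR// (min_idPr _) ?ler_expR ?oppr_le0//.
    by rewrite !expRK sub0r opprK.
  rewrite (min_idPr _) -?expR0 ?ler_expR ?(ltW v0)// (min_idPl _) ?ler_expR ?oppr_ge0 ?(ltW v0)//.
  by rewrite !expRK subr0.
apply: cvg_lim => //.
have cmin : {for (-1) ^+ s * v, continuous (fun t => Num.min 1 (expR t))}.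
  apply: (@continuous_min R R (cst 1) expR); first exact: cvg_cst.
  exact: continuous_expR.
apply: (continuous_cvg _ cmin).
by apply: cvgMr.
Qed.

(** A form of the Prokhorov theorem: under the Loeb measure almost every sequence of points
    is bounded along the ultrafilter, by tightness, and the law of its standard part is the
    limit. *)
Theorem weak_limit :
  (forall e : R, 0 < e -> exists B : R, forall j : 'I_d,
     \forall n \near \oo, (mu n [set x : V | (B < `|tnth x j|)%R] <= e%:E)%E) ->
  exists nu : probability V R, forall g : V -> R, measurable_fun setT g ->
    (forall x, 0 <= g x <= 1) -> ucontinuous g ->
    \int[mu n]_x g x @[n --> fu U] --> \int[nu]_x g x.
Proof.
move=> tight.
pose X : {mfun Om >-> V} := HB.pack st (isMeasurableFun.Build _ _ _ _ st mst).
exists (distribution P X) => g mg g01 cg.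
pose gh (w : Om) := lim (g (w n) @[n --> fu U]).
have mgh : measurable_fun setT gh := @measurable_ulim U R _ V g mg g01.
have h := @cvg_ulim_integral U R _ V mu g mg g01.
suff -> : \int[distribution P X]_x g x = \int[P]_w gh w by [].
pose big (B : nat) j : set V := [set x | B%:R < `|tnth x j|].
have mbig B j : measurable (big B j).
  rewrite -[big B j]setTI; apply: (@measurable_fun_ltr _ _ _ _ (fun=> B%:R)) => //.
  by apply: measurableT_comp => //; exact: measurable_tnth.
have mbi B j : measurable (@internal U V (fun=> big B j) : set Om).
  exact: measurable_internal.
have bnd j : \forall w \ae P, exists B : nat, fu U [set n | `|tnth (w n) j| <= B%:R].
  exists (\bigcap_(B : nat) (@internal U V (fun=> big B j) : set Om)); split.
  - exact: bigcapT_measurable.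
  - apply/eqP; rewrite eq_le measure_ge0 andbT; apply/lee_addgt0Pr => e e0.
    rewrite add0e; have [B BP] := tight e e0.
    pose K := (Num.truncn `|B|).+1.
    have BK : B <= K%:R by apply: le_trans (ler_norm B) (ltW _); exact: truncnS_gt.
    apply: (@le_trans _ _ (P (@internal U V (fun=> big K j)))).
      apply: le_measure; rewrite ?inE//; first exact: bigcapT_measurable.
      exact: bigcap_inf.
    rewrite loebE// lee_fin.
    apply: (ler_cvg_to (@loeb_cvg U R _ V mu (fun=> big K j) (fun=> mbig K j)) (cvg_cst _)).
    have := BP j; move=> /(@fu_free U); apply: filterS => n hn.
    rewrite -lee_fin fineK ?fin_num_measure//; apply: le_trans hn.
    apply: le_measure; rewrite ?inE//; last by move=> x /=; apply: le_lt_trans.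
    rewrite -[X in measurable X]setTI.
    apply: (@measurable_fun_ltr _ _ _ _ (fun=> B)) => //.
    by apply: measurableT_comp => //; exact: measurable_tnth.
  - move=> w /= nw B _; apply: contrapT => /fu_setC hB; apply: nw; exists B.
    by apply: filterS hB => n /= /negP; rewrite -leNgt.
have aeP : \forall w \ae P, gh w = g (st w).
  have aeB : \forall w \ae P, forall j, exists B : nat,
      fu U [set n | `|tnth (w n) j| <= B%:R] by exact: filter_forall.
  apply: (@filterS _ _ (ae_filter_ringOfSetsType P) _ _ _ aeB) => w wB; apply: cvg_lim => //; apply: cg => j.
  by have [B] := wB j; exact: stP.
rewrite /Rintegral; congr fine.
rewrite [LHS]ge0_integral_distribution//; last first.
- by move=> x; rewrite lee_fin; have /andP[] := g01 x.
- exact/measurable_EFinP.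
apply: ae_eq_integral => //.
- by apply/measurable_EFinP; exact: measurableT_comp.
- exact/measurable_EFinP.
- by apply: (@filterS _ _ (ae_filter_ringOfSetsType P) _ _ _ aeP) => w /= ->.
Qed.
End weak_limits.

(** * Characteristic functions and the Levy continuity theorem *)

Section expC_theory.
Context {R : realType}.
Implicit Types z w : R[i].

Lemma expCD z w : expC (z + w) = expC z * expC w.
Proof.
case: z w => [a b] [a' b']; rewrite /expC /= expRD cosD sinD.
by apply/eqP; rewrite eq_complex /=; apply/andP; split; apply/eqP; ring.
Qed.

Lemma expC0 : expC (0 : R[i]) = 1.
Proof. by rewrite /expC /= expR0 cos0 sin0 mulr1 mulr0. Qed.

Lemma expC_imag (u : R) : expC (0 +i* u)%C = (cos u +i* sin u)%C.
Proof. by rewrite /expC /= expR0 !mul1r. Qed.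

Lemma expCMn z n : expC (z *+ n) = expC z ^+ n.
Proof. by elim: n => [|n ih]; rewrite ?mulr0n ?expC0// mulrS expCD ih exprS. Qed.

End expC_theory.

Section euclid.
Context {R : realType} {d : nat}.
Local Notation V := (d.-tuple R).
Implicit Types x y z : V.

Lemma measurable_inner y : measurable_fun setT (inner y).
Proof.
rewrite /inner; apply: measurable_sum => i.
by apply: measurable_funM => //; exact: measurable_tnth.
Qed.

Lemma inner_vadd y (p : V * V) : inner y (vadd p) = inner y p.1 + inner y p.2.
Proof.
rewrite /inner -big_split /=; apply: eq_bigr => i _.
by rewrite tnth_mktuple mulrDr.
Qed.

Lemma inner_vaddl y (p : V * V) : inner (vadd p) y = inner p.1 y + inner p.2 y.
Proof.
rewrite /inner -big_split /=; apply: eq_bigr => i _.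
by rewrite tnth_mktuple mulrDl.
Qed.

Lemma inner0 y : inner y zerov = 0.
Proof. by rewrite /inner big1// => i _; rewrite tnth_mktuple mulr0. Qed.

Lemma inner_scalel (c : R) x y : inner (scalev c y) x = c * inner y x.
Proof.
by rewrite /inner mulr_sumr; apply: eq_bigr => i _; rewrite tnth_mktuple mulrA.
Qed.

Lemma inner_scaler (c : R) x y : inner y (scalev c x) = c * inner y x.
Proof.
by rewrite /inner mulr_sumr; apply: eq_bigr => i _; rewrite tnth_mktuple mulrCA.
Qed.

Definition ebasis (j : 'I_d) : V := [tuple (i == j)%:R | i < d].

Lemma inner_ebasis j x : inner (ebasis j) x = tnth x j.
Proof.
rewrite /inner (bigD1 j)//= big1 => [|i ij].
  by rewrite tnth_mktuple eqxx mul1r addr0.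
by rewrite tnth_mktuple (negbTE ij) mul0r.
Qed.

Lemma scalev1 y : scalev 1 y = y.
Proof. by apply: eq_from_tnth => i; rewrite tnth_mktuple mul1r. Qed.

Lemma scalevA (a b : R) y : scalev a (scalev b y) = scalev (a * b) y.
Proof. by apply: eq_from_tnth => i; rewrite !tnth_mktuple mulrA. Qed.

Lemma measurable_cosy y : measurable_fun setT (fun x => cos (inner y x)).
Proof.
apply: measurableT_comp; last exact: measurable_inner.
by apply: continuous_measurable_fun; exact: continuous_cos.
Qed.

Lemma measurable_siny y : measurable_fun setT (fun x => sin (inner y x)).
Proof.
apply: measurableT_comp; last exact: measurable_inner.
by apply: continuous_measurable_fun; exact: continuous_sin.
Qed.

End euclid.

Section charfun_theory.
Context {R : realType} {d : nat}.
Local Notation V := (d.-tuple R).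
Implicit Types (mu nu : probability V R) (y : V).

Lemma charfunE mu y : charfun mu y
  = (\int[mu]_x cos (inner y x) +i* \int[mu]_x sin (inner y x))%C.
Proof.
rewrite /charfun /Cintegral /Rintegral; congr (fine _ +i* fine _)%C;
  by apply: eq_integral => x _; rewrite expC_imag.
Qed.

Lemma integrable_cosy mu y : mu.-integrable setT (EFin \o (fun x => cos (inner y x))).
Proof.
by apply: (@prob_integrable _ _ _ _ _ 1); [exact: measurable_cosy|move=> x; exact: cos_max].
Qed.

Lemma integrable_siny mu y : mu.-integrable setT (EFin \o (fun x => sin (inner y x))).
Proof.
by apply: (@prob_integrable _ _ _ _ _ 1); [exact: measurable_siny|move=> x; exact: sin_max].
Qed.

Lemma Rintegral_distribution d' (T : measurableType d') (P : probability T R)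
    (X : {mfun T >-> V}) (f : V -> R) (B : R) :
  measurable_fun setT f -> (forall x, `|f x| <= B) ->
  \int[distribution P X]_x f x = \int[P]_t f (X t).
Proof.
move=> mf fB; rewrite /Rintegral; congr fine.
rewrite [LHS]integral_distribution//; first exact/measurable_EFinP.
by apply: (@prob_integrable _ _ _ _ _ B) => //; exact: measurableT_comp.
Qed.

Lemma Rintegral_prod_mul d1 d2 (T1 : measurableType d1) (T2 : measurableType d2)
    (P : probability T1 R) (Q : probability T2 R) (f : T1 -> R) (g : T2 -> R) (B : R) :
  measurable_fun setT f -> measurable_fun setT g ->
  (forall x, `|f x| <= B) -> (forall x, `|g x| <= B) ->
  \int[(P \x Q)%E]_p (f p.1 * g p.2) = \int[P]_x f x * \int[Q]_x g x.
Proof.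
move=> mf mg fB gB.
have ifg : (P \x Q)%E.-integrable setT (EFin \o (fun p => f p.1 * g p.2)).
  apply: (@prob_integrable _ _ _ (P \x Q)%E _ (B * B)).
    by apply: measurable_funM; apply: measurableT_comp.
  by move=> x; rewrite normrM ler_pM.
have ig := prob_integrable Q mg gB; have i_f := prob_integrable P mf fB.
rewrite -RintegralZr// /Rintegral; congr fine.
rewrite -[LHS]/(\int[P \x Q]_p (EFin \o (fun p => (f p.1 * g p.2)%R)) p)%E.
rewrite -integral12_prod_meas1//; apply: eq_integral => x _.
rewrite /fubini_F /= EFinM fineK.
  by rewrite -integralZl//; apply: eq_integral.
exact: integrable_fin_num.
Qed.

Lemma charfun_convolution mu nu y :
  charfun (convolution mu nu) y = charfun mu y * charfun nu y.
Proof.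
rewrite !charfunE /convolution.
rewrite (@Rintegral_distribution _ _ _ _ _ 1) ?(@Rintegral_distribution _ _ _ _ (fun x => sin (inner y x)) 1).
- have b1 := @cos_max R; have b2 := @sin_max R.
  have m1 := measurable_cosy y; have m2 := measurable_siny y.
  have I (f g : V -> R) : measurable_fun setT f -> measurable_fun setT g ->
      (forall x, `|f x| <= 1) -> (forall x, `|g x| <= 1) ->
      (mu \x nu)%E.-integrable setT (EFin \o (fun p : V * V => f p.1 * g p.2)).
    move=> mf mg f1 g1; apply: (@prob_integrable _ _ _ (mu \x nu)%E _ 1).
      by apply: measurable_funM; apply: measurableT_comp.
    by move=> x; rewrite normrM mulr_ile1.
  under eq_Rintegral do rewrite inner_vadd cosD.
  under [in X in (_ +i* X)%C = _]eq_Rintegral do rewrite inner_vadd sinD.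
  have c1 x := b1 (inner y x); have s1 x := b2 (inner y x).
  apply/eqP; rewrite eq_complex /=; apply/andP; split; apply/eqP.
    apply: etrans (RintegralB measurableT (I _ _ m1 m1 c1 c1) (I _ _ m2 m2 s1 s1)) _.
    by congr (_ - _); apply: Rintegral_prod_mul; eassumption.
  apply: etrans (RintegralD measurableT (I _ _ m2 m1 s1 c1) (I _ _ m1 m2 c1 s1)) _.
  rewrite addrC; congr (_ + _); apply: Rintegral_prod_mul; eassumption.
- exact: measurable_siny.
- by move=> x; exact: sin_max.
- exact: measurable_cosy.
- by move=> x; exact: cos_max.
Qed.

Lemma charfun_dirac (z : V) y : charfun (\d_z : probability V R) y = expC (0 +i* inner y z)%C.
Proof.
rewrite charfunE expC_imag /Rintegral; congr (_ +i* _)%C;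
  rewrite integral_dirac// ?diracT ?mul1e//; apply/measurable_EFinP.
  exact: measurable_cosy.
exact: measurable_siny.
Qed.

Lemma charfun_power mu n y : charfun (convolution_power mu n) y = charfun mu y ^+ n.
Proof.
elim: n => [|n ih] /=; last by rewrite charfun_convolution ih exprS.
by rewrite charfun_dirac inner0 expC0 expr0.
Qed.

End charfun_theory.

Section averaging.
Context {R : realType}.
Definition unit_law := uniform_prob (@ltr01 R).

Lemma measurable_one_subcos d (T : measurableType d) (F : T -> R) :
  measurable_fun setT F ->
  measurable_fun setT (fun p : R * T => (1 - cos (p.1 * F p.2))%:E).
Proof.
move=> mF; apply/measurable_EFinP; apply: measurable_funB => //.
apply: measurableT_comp; first by apply: continuous_measurable_fun; exact: continuous_cos.
by apply: measurable_funM => //; exact: measurableT_comp.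
Qed.

Lemma unit_law_one_subcos (u : R) :
  ((Num.min 1 (u ^+ 2) / 24)%:E <= \int[unit_law]_s (1 - cos (s * u))%:E)%E.
Proof.
rewrite integral_uniform//.
- by rewrite subr0 invr1 mul1e; exact: integral_one_subcos_ge.
- apply/measurable_EFinP; apply: measurable_funB => //.
  apply: measurableT_comp; first by apply: continuous_measurable_fun; exact: continuous_cos.
  exact: measurable_funM.
Qed.

(** Truncated second moments are controlled by [1 - cos] alone, that is, by real parts of
    characteristic functions or of exponents. *)
Lemma averaged_one_subcos d (T : measurableType d)
    (pi : {sigma_finite_measure set T -> \bar R}) (F : T -> R) :
  measurable_fun setT F ->
  (\int[pi]_x (Num.min 1 (F x ^+ 2) / 24)%:E
   <= \int[unit_law]_s \int[pi]_x (1 - cos (s * F x))%:E)%E.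
Proof.
move=> mF; have mc := measurable_one_subcos mF.
have c0 (p : R * T) : (0 <= (1 - cos (p.1 * F p.2))%:E)%E.
  by rewrite lee_fin subr_ge0 cos_le1.
have := fubini_tonelli (m1 := unit_law) (m2 := pi) _ mc c0 => /= ->.
apply: ge0_le_integral => //.
- move=> x _; rewrite lee_fin divr_ge0// le_min ler01; exact: sqr_ge0.
- apply/measurable_EFinP; apply: measurable_funM => //.
  apply: measurable_minr => //; exact: measurable_funX.
- exact: (measurable_fun_fubini_tonelli_G (m1 := unit_law) _ mc c0).
- by move=> x _; exact: unit_law_one_subcos.
Qed.

Lemma unit_law_integral_le (g : R -> \bar R) (e : R) : measurable_fun setT g ->
  (forall s, (0 <= g s)%E) -> (forall s, 0 <= s <= 1 -> (g s <= e%:E)%E) ->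
  (\int[unit_law]_s g s <= e%:E)%E.
Proof.
move=> mg g0 ge; rewrite integral_uniform// subr0 invr1 mul1e.
apply: (@le_trans _ _ (\int[lebesgue_measure]_(x in `[0%R, 1%R]) e%:E)%E).
  apply: ge0_le_integral => //.
  by apply: measurable_funTS.
by rewrite integral_cst//= lebesgue_measure_itv /= lte_fin ltr01 sube0 mule1.
Qed.

End averaging.

Section continuity_theorem.
Context {R : realType} {d : nat}.
Local Notation V := (d.-tuple R).
Implicit Types (y : V).

Let one_sub_ReE (P : probability V R) j (s t : R) :
  1 - complex.Re (charfun P (scalev (s * t) (ebasis j)))
  = \int[P]_x (1 - cos (s * (t * tnth x j))).
Proof.
rewrite charfunE /= RintegralB//; last 2 first.
- by apply: (@prob_integrable _ _ _ _ _ 1) => // x; rewrite normr1.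
- apply: (@prob_integrable _ _ _ _ _ 1) => [|x]; last exact: cos_max.
  apply: measurableT_comp; first by apply: continuous_measurable_fun; exact: continuous_cos.
  by do 2 apply: measurable_funM => //; exact: measurable_tnth.
rewrite prob_Rintegral_cst; congr (_ - _); apply: eq_Rintegral => x _.
by rewrite inner_scalel inner_ebasis mulrA.
Qed.

Lemma tail_charfun (P : probability V R) j (t : R) : 0 < t ->
  ((24^-1)%:E * P [set x : V | (t^-1 < `|tnth x j|)%R] <=
   \int[unit_law]_s (1 - complex.Re (charfun P (scalev (s * t) (ebasis j))))%:E)%E.
Proof.
move=> t0; pose F (x : V) := t * tnth x j.
have mF : measurable_fun setT F by apply: measurable_funM => //; exact: measurable_tnth.
have mA : measurable [set x : V | (t^-1 < `|tnth x j|)%R].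
  rewrite -[X in measurable X]setTI.
  apply: (@measurable_fun_ltr _ _ _ _ (fun=> t^-1)) => //.
  by apply: measurableT_comp => //; exact: measurable_tnth.
apply: (@le_trans _ _ (\int[P]_x (Num.min 1 (F x ^+ 2) / 24)%:E)%E).
  rewrite -[X in (_ * P X)%E]setIT -integral_indic// -ge0_integralZl//; last first.
    by apply/measurable_EFinP; exact: measurable_indic.
  apply: ge0_le_integral => //.
  - by apply: measurable_funeM; apply/measurable_EFinP; exact: measurable_indic.
  - apply/measurable_EFinP; apply: measurable_funM => //.
    by apply: measurable_minr => //; exact: measurable_funX.
  - move=> x _; rewrite -EFinM lee_fin indicE.
    case: (boolP (x \in _)) => [|_]; last first.
      by rewrite mulr0 divr_ge0// le_min ler01 sqr_ge0.
    rewrite inE /= mulr1 => xt.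
    rewrite (min_idPl _) ?mul1r// /F -real_normK ?num_real// normrM gtr0_norm//.
    rewrite expr_ge1 ?mulr_ge0 ?(ltW t0)// -ler_pdivrMl// mulr1; exact: ltW.
apply: le_trans (averaged_one_subcos P mF) _.
rewrite le_eqVlt; apply/orP; left; apply/eqP.
apply: eq_integral => s _; rewrite one_sub_ReE /Rintegral fineK//.
apply: integrable_fin_num => //.
apply: (@prob_integrable _ _ _ _ (fun x => 1 - cos (s * F x)) 2%:R) => [|x].
  have mc := measurable_one_subcos mF; apply: measurable_funB => //.
  apply: measurableT_comp; first by apply: continuous_measurable_fun; exact: continuous_cos.
  exact: measurable_funM.
rewrite ger0_norm ?subr_ge0 ?cos_le1//; have := cos_geN1 (s * F x); lra.
Qed.

(** The last hypothesis is continuity of [f] at the origin along the axes. It bounds the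
    averages in [tail_charfun], which makes the laws tight; every weak limit then has
    characteristic function [f]. *)
Theorem levy_continuity (mu : nat -> probability V R) (f : V -> R[i]) :
  (forall y, complex.Re (charfun (mu n) y) @[n --> \oo] --> complex.Re (f y)) ->
  (forall y, complex.Im (charfun (mu n) y) @[n --> \oo] --> complex.Im (f y)) ->
  (forall j e, 0 < e -> exists2 t : R, 0 < t & forall s, 0 <= s <= 1 ->
     1 - complex.Re (f (scalev (s * t) (ebasis j))) <= e) ->
  exists nu : probability V R, forall y, charfun nu y = f y.
Proof.
move=> cRe cIm cf.
have mRe (P : probability V R) j t : measurable_fun setT (fun s : R => 1 -
    complex.Re (charfun P (scalev (s * t) (ebasis j)))).
  have mF : measurable_fun setT (fun x : V => t * tnth x j).
    by apply: measurable_funM => //; exact: measurable_tnth.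
  have mc := measurable_one_subcos mF.
  under eq_fun do rewrite one_sub_ReE.
  have c0 (p : R * V) : (0 <= (1 - cos (p.1 * (t * tnth p.2 j)))%:E)%E.
    by rewrite lee_fin subr_ge0 cos_le1.
  exact: (measurableT_comp (@fine_measurable R setT measurableT)
    (measurable_fun_fubini_tonelli_F (m2 := P) _ mc c0)).
have Re1 (P : probability V R) (y : V) : `|complex.Re (charfun P y)| <= 1.
  rewrite charfunE /=; apply: prob_Rintegral_le; first exact: measurable_cosy.
  by move=> x; exact: cos_max.
have Re2 (P : probability V R) (y : V) : `|1 - complex.Re (charfun P y)| <= 2.
  by have := Re1 P y; rewrite ler_norml => /andP[h1 h2]; rewrite ler_norml; lra.
have Re0 (P : probability V R) (y : V) : 0 <= 1 - complex.Re (charfun P y).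
  by have := Re1 P y; rewrite ler_norml => /andP[h1 h2]; lra.
have [U _] := free_ultra.
have tight (e : R) : 0 < e -> exists B : R, forall j : 'I_d,
    \forall n \near \oo, (mu n [set x : V | (B < `|tnth x j|)%R] <= e%:E)%E.
  move=> e0; have e48 : 0 < e / 48 by rewrite divr_gt0.
  have /choice[t tP] : forall j, exists t : R, 0 < t /\ forall s, 0 <= s <= 1 ->
     1 - complex.Re (f (scalev (s * t) (ebasis j))) <= e / 48.
    by move=> j; have [t t0 tP] := cf j _ e48; exists t.
  exists (\sum_j (t j)^-1) => j; have [t0 tj] := tP j.
  pose a n := \int[unit_law]_s (1 - complex.Re (charfun (mu n) (scalev (s * t j) (ebasis j)))).
  pose al := \int[unit_law]_s (1 - complex.Re (f (scalev (s * t j) (ebasis j)))).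
  have ca : a n @[n --> \oo] --> al.
    apply: (@cvg_Rintegral _ _ _ unit_law _ _ (fun=> 2)).
    - by move=> n; exact: mRe.
    - by move=> s; apply: cvgB; [exact: cvg_cst|exact: cRe].
    - by apply: (@prob_integrable _ _ _ _ _ 2) => // s; rewrite ger0_norm.
    - by move=> n s; exact: Re2.
  have mfl : measurable_fun setT (fun s : R => 1 - complex.Re (f (scalev (s * t j) (ebasis j)))).
    apply: (measurable_fun_cvg (fun n => @mRe (mu n) j (t j))) => s _.
    by apply: cvgB; [exact: cvg_cst|exact: cRe].
  have c1 y : 1 - complex.Re (charfun (mu n) y) @[n --> \oo] --> 1 - complex.Re (f y).
    by apply: cvgB; [exact: cvg_cst|exact: cRe].
  have f0 y : 0 <= 1 - complex.Re (f y).
    apply: (ler_cvg_to (cvg_cst 0) (c1 y)).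
    by apply: nearW => n; exact: Re0.
  have f2 y : `|1 - complex.Re (f y)| <= 2.
    apply: (ler_cvg_to (cvg_norm (c1 y)) (cvg_cst _)).
    by apply: nearW => n; exact: Re2.
  have alE : al <= e / 48.
    rewrite -lee_fin /al /Rintegral fineK.
      apply: unit_law_integral_le => [|s|s s01]; first exact/measurable_EFinP.
        by rewrite lee_fin.
      by rewrite lee_fin tj.
    apply: integrable_fin_num => //.
    exact: (@prob_integrable _ _ _ _ _ 2).
  have ae : \forall n \near \oo, a n <= e / 24.
    have ale : al < e / 24 by apply: le_lt_trans alE _; lra.
    by apply: cvgr_le ca _ ale.
  apply: filterS ae => n an.
  apply: (@le_trans _ _ (mu n [set x : V | ((t j)^-1 < `|tnth x j|)%R])).
    have mA (B : R) : measurable [set x : V | (B < `|tnth x j|)%R].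
      rewrite -[X in measurable X]setTI.
      apply: (@measurable_fun_ltr _ _ _ _ (fun=> B)) => //.
      by apply: measurableT_comp => //; exact: measurable_tnth.
    apply: le_measure; rewrite ?inE// => x /=; apply: le_lt_trans.
    rewrite (bigD1 j)//= lerDl; apply: sumr_ge0 => i _.
    by rewrite invr_ge0 ltW//; case: (tP i).
  have finA : mu n [set x : V | ((t j)^-1 < `|tnth x j|)%R] \is a fin_num.
    apply: fin_num_measure; rewrite -[X in measurable X]setTI.
    apply: (@measurable_fun_ltr _ _ _ _ (fun=> (t j)^-1)) => //.
    by apply: measurableT_comp => //; exact: measurable_tnth.
  have aE : (\int[unit_law]_s
      (1 - complex.Re (charfun (mu n) (scalev (s * t j) (ebasis j))))%:E)%E = (a n)%:E.
    rewrite /a /Rintegral fineK//; apply: integrable_fin_num => //.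
    exact: (@prob_integrable _ _ _ unit_law _ 2 (@mRe (mu n) j (t j)) (fun s => Re2 _ _)).
  have : ((24^-1 * fine (mu n [set x : V | ((t j)^-1 < `|tnth x j|)%R]))%:E <= (a n)%:E)%E.
    by rewrite -aE EFinM fineK//; exact: tail_charfun.
  rewrite lee_fin -[X in (X <= _)%E](fineK finA) lee_fin.
  by move: an; lra.
have [nu nuP] := @weak_limit U R d mu tight.
exists nu => y.
(* [weak_limit] concerns functions into [0, 1], hence the passage from [h] to [(1 + h) / 2]. *)
have lim_of (h : R -> R) : continuous h -> (forall u, `|h u| <= 1) ->
    forall l : R, \int[mu n]_x h (inner y x) @[n --> \oo] --> l ->
    \int[nu]_x h (inner y x) = l.
  move=> ch h1 l cl; pose g (x : V) := 2^-1 * (1 + h (inner y x)).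
  have mh : measurable_fun setT (fun x : V => h (inner y x)).
    apply: measurableT_comp; last exact: measurable_inner.
    exact: continuous_measurable_fun.
  have mg : measurable_fun setT g by apply: measurable_funM => //; exact: measurable_funD.
  have g01 x : 0 <= g x <= 1.
    by have := h1 (inner y x); rewrite ler_norml /g => /andP[k1 k2]; lra.
  have cg : ucontinuous U g.
    move=> w v wv; apply: cvgMr; apply: cvgD; first exact: cvg_cst.
    apply: continuous_cvg; first exact: ch.
    apply: cvg_big => [|j _]; first exact: add_continuous.
    exact: cvgMr (wv j).
  have gE (P : probability V R) : \int[P]_x g x = 2^-1 * (1 + \int[P]_x h (inner y x)).
    have ih : P.-integrable setT (EFin \o (fun x : V => h (inner y x))).
      exact: (@prob_integrable _ _ _ _ _ 1).
    have i1 : P.-integrable setT (EFin \o (fun x : V => 1)).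
      by apply: (@prob_integrable _ _ _ _ _ 1) => // x; rewrite normr1.
    rewrite RintegralZl//; last by apply: (integrableD measurableT i1 ih).
    by rewrite RintegralD// prob_Rintegral_cst.
  have c1 := nuP g mg g01 cg.
  have c2 : \int[mu n]_x g x @[n --> fu U] --> 2^-1 * (1 + l).
    under eq_fun do rewrite gE.
    by apply: cvgMr; apply: cvgD; [exact: cvg_cst|exact: ulim_oo].
  have E : \int[nu]_x g x = 2^-1 * (1 + l).
    exact: (cvg_unique (@norm_hausdorff _ _) c1 c2).
  by move: E; rewrite gE; lra.
rewrite charfunE; apply/eqP; rewrite eq_complex /=; apply/andP; split; apply/eqP.
- apply: lim_of; [exact: continuous_cos|exact: cos_max|].
  by have := cRe y; under eq_fun do rewrite charfunE.
- apply: lim_of; [exact: continuous_sin|exact: sin_max|].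
  by have := cIm y; under eq_fun do rewrite charfunE.
Qed.

End continuity_theorem.

(** * Uniqueness of the characteristic function *)

Section step_approximation.
Context {R : realType}.
Implicit Types s q x : R.

Lemma bernoulli_ge x n : 0 <= x <= 1 -> 1 - n%:R * x <= (1 - x) ^+ n.
Proof.
move=> /andP[x0 x1]; elim: n => [|n ih]; first by rewrite mul0r subr0 expr0.
rewrite exprS; have h := ler_wpM2l (_ : 0 <= 1 - x) ih.
apply: le_trans (h _); last by rewrite subr_ge0.
have : 0 <= n%:R * x * x by rewrite !mulr_ge0.
rewrite -natr1; lra.
Qed.

Lemma bernoulli_ge_add x n : 0 <= x -> 1 + n%:R * x <= (1 + x) ^+ n.
Proof.
move=> x0; elim: n => [|n ih]; first by rewrite mul0r addr0 expr0.
rewrite exprS; have h := ler_wpM2l (_ : 0 <= 1 + x) ih.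
apply: le_trans (h _); last by rewrite addr_ge0.
have : 0 <= n%:R * x * x by rewrite !mulr_ge0.
rewrite -natr1; lra.
Qed.

(** Polynomials in [s] that tend boundedly on [[-1, 1]] to the indicator of the
    positive numbers: the first factor only corrects the value at [0]. *)
Definition step_poly (n : nat) s : R :=
  (1 - (1 - s ^+ 2) ^+ n) * (1 - (1 - ((1 + s) / 2) ^+ n) ^+ (2 ^ n)).

Lemma sub1X01 x n : 0 <= x <= 1 -> 0 <= 1 - x ^+ n <= 1.
Proof.
move=> /andP[x0 x1]; rewrite subr_ge0 exprn_ile1//= lerBlDr lerDl exprn_ge0//.
Qed.

Lemma step_poly01 n s : -1 <= s <= 1 -> 0 <= step_poly n s <= 1.
Proof.
move=> /andP[s1 s2].
have s21 : 0 <= 1 - s ^+ 2 <= 1.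
  by rewrite subr_ge0 -real_normK ?num_real// expr_le1// ler_norml s1 s2/= lerBlDr lerDl sqr_ge0.
have q01 : 0 <= (1 + s) / 2 <= 1 by lra.
have /andP[a0 a1] := sub1X01 n s21.
have /andP[b0 b1] := sub1X01 (2 ^ n) (sub1X01 n q01).
by rewrite /step_poly mulr_ge0//= mulr_ile1.
Qed.

Lemma cvg_step_poly s : -1 <= s <= 1 ->
  step_poly n s @[n --> \oo] --> ((0 < s)%R%:R : R).
Proof.
move=> /andP[s1 s2].
have first_factor : s != 0 -> 1 - (1 - s ^+ 2) ^+ n @[n --> \oo] --> (1 : R).
  move=> s0; rewrite -[X in _ --> X]subr0; apply: cvgB; first exact: cvg_cst.
  apply: cvg_expr; rewrite ltr_norml.
  have : 0 < s ^+ 2 by rewrite exprn_even_gt0.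
  have : s ^+ 2 <= 1 by rewrite -real_normK ?num_real// expr_le1// ler_norml s1 s2.
  lra.
set q := (1 + s) / 2.
have q01 : 0 <= q <= 1 by rewrite /q; lra.
have qn01 n : 0 <= q ^+ n <= 1.
  by case/andP: q01 => q0 q1; rewrite exprn_ge0//= exprn_ile1.
have [s0|s0|<-] := ltgtP 0 s.
- have h : (1 - q ^+ n) ^+ (2 ^ n) @[n --> \oo] --> (0 : R).
    have q2 : 0 < 2 * q by rewrite /q; lra.
    apply: (@squeeze_cvgr _ _ _ _ (fun=> 0) (fun n => ((2 * q)^-1) ^+ n)).
    + apply: nearW => n; have /andP[h0 h1] := qn01 n.
      rewrite exprn_ge0 ?subr_ge0//=.
      have e0 : 0 < (2 * q) ^+ n by rewrite exprn_gt0.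
      rewrite exprVn -[leRHS]mul1r ler_pdivlMr//.
      apply: (@le_trans _ _ ((1 - q ^+ n) ^+ (2 ^ n) * (1 + q ^+ n) ^+ (2 ^ n))).
        rewrite ler_wpM2l ?exprn_ge0 ?subr_ge0//.
        apply: le_trans (bernoulli_ge_add (2 ^ n) h0).
        by rewrite exprMn natrX lerDr.
      rewrite -exprMn exprn_ile1//.
        by rewrite mulr_ge0 ?subr_ge0// addr_ge0.
      have -> : (1 - q ^+ n) * (1 + q ^+ n) = 1 - (q ^+ n) ^+ 2 by ring.
      by rewrite lerBlDr lerDl sqr_ge0.
    + exact: cvg_cst.
    + apply: cvg_expr; rewrite normfV gtr0_norm// invf_lt1//.
      by rewrite /q; lra.
  have -> : true%:R = 1 * (1 - 0) :> R by rewrite subr0 mulr1.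
  apply: cvgM; first by apply: first_factor; rewrite gt_eqF.
  by apply: cvgB => //; exact: cvg_cst.
- have h : 1 - (1 - q ^+ n) ^+ (2 ^ n) @[n --> \oo] --> (0 : R).
    apply: (@squeeze_cvgr _ _ _ _ (fun=> 0) (fun n => (2 * q) ^+ n)).
    + apply: nearW => n.
      have /andP[-> _] := sub1X01 (2 ^ n) (sub1X01 n q01).
      have := bernoulli_ge (2 ^ n) (qn01 n).
      by rewrite natrX -exprMn => h; rewrite lerBlDr -lerBlDl.
    + exact: cvg_cst.
    + by apply: cvg_expr; rewrite ger0_norm /q; lra.
  have -> : false%:R = 1 * 0 :> R by rewrite mulr0.
  apply: cvgM => //.
  by apply: first_factor; rewrite lt_eqF.
- have -> : (fun n => step_poly n 0) = fun=> 0.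
    by apply/funext => n; rewrite /step_poly expr0n subr0 expr1n subrr mul0r.
  exact: cvg_cst.
Qed.

Lemma sin_pos_cvg x : ((0 < sin (n.+1%:R^-1 * x))%R%:R : R) @[n --> \oo] --> ((0 < x)%R%:R : R).
Proof.
apply: cvg_near_cst; near=> n.
have n0 : 0 < n.+1%:R :> R by rewrite ltr0n.
have xn : `|x| < n.+1%:R.
  have : (Num.truncn `|x| <= n)%N by near: n; exact: nbhs_infty_ge.
  rewrite -ltnS -(ler_nat R) => h; apply: lt_le_trans h; exact: truncnS_gt.
congr (nat_of_bool _)%:R.
have [x0|x0|<-] := ltgtP 0 x.
- apply: sin2_gt0; rewrite mulr_gt0 ?invr_gt0//= mulrC ltr_pdivrMr//.
  by move: xn; rewrite gtr0_norm// => xn; move: xn n0; lra.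
- apply/negbTE; rewrite -leNgt -oppr_ge0 -sinN -mulrN ltW//.
  apply: sin2_gt0; rewrite mulr_gt0 ?invr_gt0 ?oppr_gt0//= mulrC ltr_pdivrMr//.
  by move: xn; rewrite ltr0_norm// => xn; move: xn n0; lra.
- by rewrite mulr0 sin0 ltxx.
Unshelve. all: by end_near. Qed.

End step_approximation.

Section uniqueness.
Context {R : realType} {d : nat}.
Local Notation V := (d.-tuple R).

(** Real trigonometric polynomials, as lists of (coefficient, frequency, phase). *)
Definition trigpoly (f : V -> R) := exists l : seq (R * V * R),
  forall x, f x = \sum_(p <- l) p.1.1 * cos (inner p.1.2 x + p.2).

Lemma trigpoly_cos (c : R) (y : V) (t : R) :
  trigpoly (fun x => c * cos (inner y x + t)).
Proof. by exists [:: (c, y, t)] => x; rewrite big_seq1. Qed.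

Lemma trigpoly_cst (c : R) : trigpoly (fun=> c).
Proof.
exists [:: (c, zerov, 0)] => x; rewrite big_seq1 /= addr0.
rewrite /inner big1 ?cos0 ?mulr1// => i _; by rewrite tnth_mktuple mul0r.
Qed.

Lemma trigpolyD f g : trigpoly f -> trigpoly g -> trigpoly (fun x => f x + g x).
Proof. by move=> [l lE] [k kE]; exists (l ++ k) => x; rewrite big_cat lE kE. Qed.

Lemma trigpolyM f g : trigpoly f -> trigpoly g -> trigpoly (fun x => f x * g x).
Proof.
move=> [l lE] [k kE].
suff H : forall p : R * V * R, trigpoly (fun x => p.1.1 * cos (inner p.1.2 x + p.2) * g x).
  have {H} : forall l' : seq (R * V * R), trigpoly (fun x =>
      (\sum_(p <- l') p.1.1 * cos (inner p.1.2 x + p.2)) * g x).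
    elim=> [|p l' IH].
      by have [z zE] := trigpoly_cst 0; exists z => x; rewrite big_nil mul0r -zE.
    have [z zE] := trigpolyD (H p) IH.
    by exists z => x; rewrite big_cons mulrDl -zE.
  by move=> /(_ l)[z zE]; exists z => x; rewrite lE -zE.
move=> [[c y] t] /=.
suff {kE} : forall k', trigpoly (fun x => c * cos (inner y x + t) *
    (\sum_(p <- k') p.1.1 * cos (inner p.1.2 x + p.2))).
  by move=> /(_ k)[z zE]; exists z => x; rewrite kE -zE.
elim=> [|[[c' y'] t'] k' IH].
  by have [z zE] := trigpoly_cst 0; exists z => x; rewrite big_nil mulr0 -zE.
suff h : trigpoly (fun x => c * cos (inner y x + t) * (c' * cos (inner y' x + t'))).
  have [z zE] := trigpolyD h IH.
  by exists z => x; rewrite big_cons mulrDr -zE.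
exists [:: (c * c' / 2, vadd (y, y'), t + t');
           (c * c' / 2, vadd (y, scalev (-1) y'), t - t')] => x.
rewrite big_cons big_seq1 /= !inner_vaddl /= inner_scalel mulN1r.
have -> : inner y x + inner y' x + (t + t') = (inner y x + t) + (inner y' x + t') by ring.
have -> : inner y x - inner y' x + (t - t') = (inner y x + t) - (inner y' x + t') by ring.
move: (inner y x + t) (inner y' x + t') => u u'.
by rewrite cosD cosB; field.
Qed.

Lemma trigpolyX f n : trigpoly f -> trigpoly (fun x => f x ^+ n).
Proof.
move=> tf; elim: n => [|n ih].
  by have [z zE] := trigpoly_cst 1; exists z => x; rewrite expr0 -zE.
by have [z zE] := trigpolyM tf ih; exists z => x; rewrite exprS -zE.
Qed.

Lemma trigpoly_1sub f : trigpoly f -> trigpoly (fun x => 1 - f x).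
Proof.
move=> tf; have [z zE] := trigpolyD (trigpoly_cst 1) (trigpolyM (trigpoly_cst (-1)) tf).
by exists z => x; rewrite -zE mulN1r.
Qed.

Lemma trigpoly_step n f : trigpoly f -> trigpoly (fun x => step_poly n (f x)).
Proof.
move=> tf; apply: trigpolyM; apply: trigpoly_1sub; apply: trigpolyX; apply: trigpoly_1sub.
  exact: trigpolyX.
apply: trigpolyX; apply: trigpolyM; last exact: trigpoly_cst.
by apply: trigpolyD => //; exact: trigpoly_cst.
Qed.

Lemma trigpoly_sin (y : V) (t : R) : trigpoly (fun x => sin (inner y x + t)).
Proof.
have [z zE] := trigpoly_cos 1 y (t - pi / 2).
by exists z => x; rewrite -zE mul1r addrA cosBpihalf.
Qed.

Lemma trigpoly_prod (I : Type) (s : seq I) (f : I -> V -> R) :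
  (forall i, trigpoly (f i)) -> trigpoly (fun x => \prod_(i <- s) f i x).
Proof.
move=> tf; elim: s => [|i s ih].
  by have [z zE] := trigpoly_cst 1; exists z => x; rewrite big_nil -zE.
by have [z zE] := trigpolyM (tf i) ih; exists z => x; rewrite big_cons -zE.
Qed.

Lemma measurable_trigpoly f : trigpoly f -> measurable_fun setT f.
Proof.
move=> [l lE]; rewrite (_ : f = fun x => \sum_(p <- l) p.1.1 * cos (inner p.1.2 x + p.2)).
  apply: measurable_sum => p; apply: measurable_funM => //.
  apply: measurableT_comp; first by apply: continuous_measurable_fun; exact: continuous_cos.
  by apply: measurable_funD => //; exact: measurable_inner.
exact/funext.
Qed.

Variables (mu nu : probability V R).
Hypothesis munu : forall y, charfun mu y = charfun nu y.

Lemma trigpoly_integral f : trigpoly f -> \int[mu]_x f x = \int[nu]_x f x.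
Proof.
move=> [l lE].
have int1 (P : probability V R) (p : R * V * R) :
    P.-integrable setT (EFin \o (fun x => p.1.1 * cos (inner p.1.2 x + p.2))).
  apply: (@prob_integrable _ _ _ _ _ `|p.1.1|) => [|x].
    by apply: measurable_trigpoly; exact: trigpoly_cos.
  by rewrite normrM ler_piMr// cos_max.
under eq_Rintegral do rewrite lE.
under [RHS]eq_Rintegral do rewrite lE.
apply: etrans (@Rintegral_sum _ _ _ mu _ l _ (int1 mu)) _.
apply: etrans _ (esym (@Rintegral_sum _ _ _ nu _ l _ (int1 nu))).
apply: eq_bigr => -[[c y] t] _ /=.
have E (P : probability V R) : \int[P]_x (c * cos (inner y x + t))
    = c * (cos t * \int[P]_x cos (inner y x) - sin t * \int[P]_x sin (inner y x)).
  rewrite -!RintegralZl//; [|exact: integrable_siny|exact: integrable_cosy].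
  have i1 : P.-integrable setT (EFin \o (fun x : V => cos t * cos (inner y x))).
    apply: (@prob_integrable _ _ _ _ _ 1) => [|x].
      by apply: measurable_funM => //; exact: measurable_cosy.
    by rewrite normrM mulr_ile1// cos_max.
  have i2 : P.-integrable setT (EFin \o (fun x : V => sin t * sin (inner y x))).
    apply: (@prob_integrable _ _ _ _ _ 1) => [|x].
      by apply: measurable_funM => //; exact: measurable_siny.
    by rewrite normrM mulr_ile1// sin_max.
  rewrite -RintegralB// -RintegralZl//; last exact: (integrableB measurableT i1 i2).
  by apply: eq_Rintegral => x _; rewrite cosD; ring.
rewrite !E; have := munu y; rewrite !charfunE => -[-> ->]//.
Qed.

Definition orthant (a : 'I_d -> R) : set V := [set x | forall j, a j < tnth x j].

Let measurable_ray j (a : R) : measurable [set x : V | a < tnth x j].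
Proof.
rewrite -[X in measurable X]setTI.
by apply: (@measurable_fun_ltr _ _ _ _ (fun=> a)) => //; exact: measurable_tnth.
Qed.

Lemma measurable_orthant a : measurable (orthant a).
Proof.
have -> : orthant a = \bigcap_(j in [set: 'I_d]) [set x : V | a j < tnth x j].
  by rewrite eqEsubset; split=> x h j; [move=> _; exact: h|exact: h].
by apply: fin_bigcap_measurable => // j _; exact: measurable_ray.
Qed.

Let indic_orthant a x : \1_(orthant a) x = \prod_(j < d) (a j < tnth x j)%R%:R :> R.
Proof.
rewrite indicE; case: (boolP (x \in _)) => [|]; rewrite ?inE ?notin_setE => xa.
  by rewrite big1// => j _; rewrite xa.
have [j /negP aj] : exists j, ~ (a j < tnth x j) by apply/existsNP.
by rewrite (bigD1 j)//= (negbTE aj) mul0r.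
Qed.

Let prod01 (F : 'I_d -> R) : (forall j, 0 <= F j <= 1) -> `|\prod_(j < d) F j| <= 1.
Proof.
move=> F01; rewrite ger0_norm; last by apply: prodr_ge0 => j _; case/andP: (F01 j).
by apply: prodr_ile1 => j _; exact: F01.
Qed.

(** Two passages to the limit under the integral: sharpening the step at the zeros
    of the sine, then letting the period of the sine tend to infinity. *)
Lemma orthant_eq a : mu (orthant a) = nu (orthant a).
Proof.
pose S k j (x : V) := sin (k.+1%:R^-1 * (tnth x j - a j)).
have tS k j : trigpoly (S k j).
  have [z zE] := trigpoly_sin (scalev k.+1%:R^-1 (ebasis j)) (- (k.+1%:R^-1 * a j)).
  by exists z => x; rewrite -zE inner_scalel inner_ebasis -mulrBr.
have S1 k j x : -1 <= S k j x <= 1 by rewrite sin_geN1 sin_le1.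
pose F k x := \prod_(j < d) ((0 < S k j x)%R%:R : R).
have b01 (b : bool) : 0 <= (b%:R : R) <= 1 by rewrite ler0n lern1 leq_b1.
have mF k : measurable_fun setT (F k).
  apply: measurable_prod => j _.
  rewrite (_ : (fun x => _) = \1_[set x : V | 0 < S k j x]); last first.
    by apply/funext => x; rewrite indicE; congr (nat_of_bool _)%:R; apply/idP/idP; rewrite inE.
  apply: measurable_indic; rewrite -[X in measurable X]setTI.
  apply: (@measurable_fun_ltr _ _ _ _ (fun=> 0)) => //.
  exact: measurable_trigpoly.
have ione (P : probability V R) : P.-integrable setT (EFin \o (fun=> 1)).
  by apply: (@prob_integrable _ _ _ _ _ 1) => // x; rewrite normr1.
have FE k : \int[mu]_x F k x = \int[nu]_x F k x.
  pose G n x := \prod_(j < d) step_poly n (S k j x).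
  have tG n : trigpoly (G n) by apply: trigpoly_prod => j; exact: trigpoly_step.
  have cG (P : probability V R) : \int[P]_x G n x @[n --> \oo] --> \int[P]_x F k x.
    apply: (@cvg_Rintegral _ _ _ P _ _ (fun=> 1)) => //.
    - by move=> n; exact: measurable_trigpoly.
    - move=> x; apply: cvg_big => [|j _]; first exact: mul_continuous.
      exact: cvg_step_poly.
    - exact: ione.
    - by move=> n x; apply: prod01 => j; exact: step_poly01.
  have cGmu := cG mu; have cGnu := cG nu.
  have E : (fun n => \int[mu]_x G n x) = (fun n => \int[nu]_x G n x).
    by apply/funext => n; exact: trigpoly_integral.
  move: cGmu; rewrite E => cGmu.
  exact: (cvg_unique (@norm_hausdorff _ _) cGmu cGnu).
have cF (P : probability V R) : \int[P]_x F k x @[k --> \oo] --> \int[P]_x \1_(orthant a) x.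
  apply: (@cvg_Rintegral _ _ _ P _ _ (fun=> 1)) => //.
  - move=> x; rewrite indic_orthant.
    apply: cvg_big => [|j _]; first exact: mul_continuous.
    by rewrite -subr_gt0; exact: sin_pos_cvg.
  - exact: ione.
  - by move=> n x; exact: prod01.
have cFmu := cF mu; have cFnu := cF nu.
have E : (fun k => \int[mu]_x F k x) = (fun k => \int[nu]_x F k x) by exact/funext.
move: cFmu; rewrite E => cFmu.
have : \int[mu]_x \1_(orthant a) x = \int[nu]_x \1_(orthant a) x.
  exact: (cvg_unique (@norm_hausdorff _ _) cFmu cFnu).
have mo := measurable_orthant a.
rewrite !Rintegral_indic// => h.
have fm : mu (orthant a) \is a fin_num by exact: fin_num_measure.
have fn : nu (orthant a) \is a fin_num by exact: fin_num_measure.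
by rewrite -(fineK fm) -(fineK fn) h.
Qed.

Let orthants : set (set V) := [set orthant a | a in setT].

Let orthants_generate : measurable = <<s orthants >> :> set (set V).
Proof.
rewrite eqEsubset; split; last first.
  by apply: smallest_sub; [exact: sigma_algebra_measurable|move=> _ [a _ <-]; exact: measurable_orthant].
have mid : measurable_fun setT (id : g_sigma_algebraType orthants -> V).
  apply/measurable_fun_tnthP => j.
  apply: (measurability (@RGenOInfty.G R)); first exact: RGenOInfty.measurableE.
  move=> _ [_ [a ->] <-]; rewrite setTI.
  rewrite (_ : _ @^-1` _
      = \bigcup_k orthant (fun i => if i == j then a else - k%:R)); last first.
    rewrite eqEsubset; split=> x /=; rewrite in_itv /= andbT.
      move=> ax; pose k := (Num.truncn (\sum_(i < d) `|tnth x i|)).+1.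
      exists k => // i; case: eqVneq => [->//|_].
      have : \sum_(i < d) `|tnth x i| < k%:R by exact: truncnS_gt.
      have : `|tnth x i| <= \sum_(i < d) `|tnth x i|.
        by rewrite (bigD1 i)//= lerDl sumr_ge0.
      by have := ler_norm (- tnth x i); rewrite normrN; lra.
    by move=> [k _ /(_ j)]; rewrite eqxx.
  apply: bigcupT_measurable => k; apply: sub_sigma_algebra.
  by eexists.
by move=> A mA; have := mid measurableT A mA; rewrite setTI.
Qed.

(** Orthants are stable under intersection and generate the Borel sets. *)
Theorem charfun_inj : measure_eq mu nu.
Proof.
apply: (measure_unique orthants (fun k => orthant (fun=> - k%:R))).
- exact: orthants_generate.
- move=> _ _ [a _ <-] [b _ <-]; exists (fun j => Num.max (a j) (b j)) => //.
  rewrite eqEsubset; split=> x h; first by split=> j; have := h j; rewrite gt_max => /andP[].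
  by move=> j; case: h => ha hb; rewrite gt_max ha hb.
- by move=> k; eexists.
- rewrite -subTset => x _; exists (Num.truncn (\sum_(i < d) `|tnth x i|)).+1 => // i.
  set k := _.+1; have : \sum_(i < d) `|tnth x i| < k%:R by exact: truncnS_gt.
  have : `|tnth x i| <= \sum_(i < d) `|tnth x i| by rewrite (bigD1 i)//= lerDl sumr_ge0.
  by have := ler_norm (- tnth x i); rewrite normrN; lra.
- by move=> _ [a _ <-]; exact: orthant_eq.
- move=> k; rewrite -ge0_fin_numE//; apply: fin_num_measure; exact: measurable_orthant.
Qed.

End uniqueness.

(** * The Levy-Khintchine formula *)

Section measure_tools.
Context {d : measure_display} {T : measurableType d} {R : realType}.
Variable M : {measure set T -> \bar R}.

(** [M] itself, carrying the proof that it is sigma-finite. *)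
Definition sigma_finite_copy of sigma_finite setT M := (M : set T -> \bar R).

Section copy.
Variable sM : sigma_finite setT M.
HB.instance Definition _ := isMeasure.Build _ _ _ (sigma_finite_copy sM)
  (@measure0 _ _ _ M) (@measure_ge0 _ _ _ M) (@measure_semi_sigma_additive _ _ _ M).
HB.instance Definition _ := Measure_isSigmaFinite.Build _ _ _ (sigma_finite_copy sM) sM.
End copy.

Lemma ge0_integral_mrestr (A : set T) (mA : measurable A) (f : T -> \bar R) :
  measurable_fun setT f -> (forall x, (0 <= f x)%E) ->
  (\int[mrestr M mA]_x f x = \int[M]_(x in A) f x)%E.
Proof.
move=> mf f0.
rewrite (@ge0_negligible_integral _ _ _ (mrestr M mA) _ (~` A))//; last 2 first.
- exact: measurableC.
- by rewrite /= /mrestr setICl measure0.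
rewrite setTD setCK; apply: eq_measure_integral => B mB BA.
by rewrite /= /mrestr setIidl.
Qed.

Lemma integral_mrestr (A : set T) (mA : measurable A) (f : T -> \bar R) :
  measurable_fun setT f ->
  (\int[mrestr M mA]_x f x = \int[M]_(x in A) f x)%E.
Proof.
move=> mf; rewrite [LHS]integralE [RHS]integralE.
by rewrite !ge0_integral_mrestr//; [exact: measurable_funeneg|exact: measurable_funepos].
Qed.

Lemma integrable_mrestr (A : set T) (mA : measurable A) (f : T -> \bar R) :
  measurable_fun setT f -> (mrestr M mA).-integrable setT f <-> M.-integrable A f.
Proof.
move=> mf; split=> /integrableP[_ h]; apply/integrableP; split => //.
- exact: measurable_funTS.
- by move: h; rewrite ge0_integral_mrestr//; exact: measurableT_comp.
- by rewrite ge0_integral_mrestr//; exact: measurableT_comp.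
Qed.

Lemma integrable_mscale (k : {nonneg R}) (f : T -> \bar R) :
  M.-integrable setT f -> (mscale k M).-integrable setT f.
Proof.
move=> /integrableP[mf fi]; apply/integrableP; split => //.
rewrite ge0_integral_mscale//; last exact: measurableT_comp.
rewrite lte_mul_pinfty// lee_fin; exact: ge0.
Qed.

Lemma Rintegral_mscale (k : {nonneg R}) (f : T -> R) :
  M.-integrable setT (EFin \o f) ->
  \int[mscale k M]_x f x = k%:num * \int[M]_x f x.
Proof.
move=> fi; have mf : measurable_fun setT (EFin \o f) by case/integrableP: fi.
rewrite /Rintegral.
have -> : (\int[mscale k M]_x (f x)%:E = (k%:num)%:E * \int[M]_x (f x)%:E)%E.
  have pE := ge0_integral_mscale M measurableT k (measurable_funepos mf) (fun x _ => funepos_ge0 _ x).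
  have nE := ge0_integral_mscale M measurableT k (measurable_funeneg mf) (fun x _ => funeneg_ge0 _ x).
  rewrite [LHS]integralE [X in _ = (_ * X)%E]integralE.
  apply: etrans (congr2 (fun a b => (a - b)%E) pE nE) _.
  apply/esym/muleBr => //; apply: fin_num_adde_defl.
  by rewrite fin_numN; exact: integrable_neg_fin_num.
by rewrite fineM//; exact: integrable_fin_num.
Qed.

End measure_tools.

Lemma Rintegral_measure_add d (T : measurableType d) (R : realType)
    (M N : {measure set T -> \bar R}) (f : T -> R) :
  M.-integrable setT (EFin \o f) -> N.-integrable setT (EFin \o f) ->
  \int[measure_add M N]_x f x = \int[M]_x f x + \int[N]_x f x.
Proof.
move=> fM fN; rewrite /Rintegral integral_measure_add// fineD//;
  exact: integrable_fin_num.
Qed.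

Lemma Rintegral_dirac d (T : measurableType d) (R : realType) (a : T) (f : T -> R) :
  measurable_fun setT f -> \int[\d_a]_x f x = f a.
Proof.
move=> mf; rewrite /Rintegral integral_dirac// ?diracT ?mul1e//.
exact/measurable_EFinP.
Qed.

Section levy_kernel.
Context {R : realType} {d : nat}.
Local Notation V := (d.-tuple R).
Implicit Types (x y : V).

Lemma inner_ge0 x : 0 <= inner x x.
Proof. by rewrite /inner sumr_ge0// => i _; rewrite -expr2 sqr_ge0. Qed.

Lemma enorm_ge0 x : 0 <= enorm x.
Proof. exact: sqrtr_ge0. Qed.

Lemma enormE x : enorm x ^+ 2 = inner x x.
Proof. by rewrite /enorm sqr_sqrtr// inner_ge0. Qed.

Lemma tnth_le_enorm x i : `|tnth x i| <= enorm x.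
Proof.
rewrite -ler_sqr ?nnegrE ?enorm_ge0// enormE real_normK ?num_real//.
rewrite /inner (bigD1 i)//= expr2 lerDl sumr_ge0// => j _.
by rewrite -expr2 sqr_ge0.
Qed.

Lemma enorm_eq0 x : (enorm x == 0) = (x == zerov).
Proof.
apply/idP/eqP => [/eqP x0|->]; last by rewrite /enorm inner0 sqrtr0.
apply: eq_from_tnth => i; rewrite tnth_mktuple; apply/eqP; rewrite -normr_le0.
by rewrite -x0 tnth_le_enorm.
Qed.

Lemma enorm_scale (c : R) x : enorm (scalev c x) = `|c| * enorm x.
Proof.
rewrite /enorm inner_scalel inner_scaler mulrA -expr2 sqrtrM ?sqr_ge0//.
by rewrite sqrtr_sqr.
Qed.

(** The square truncated at 1, which controls every integrand below. *)
Definition sqtrunc x : R := Num.min 1 (enorm x ^+ 2).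

Lemma sqtrunc_ge0 x : 0 <= sqtrunc x.
Proof. by rewrite le_min ler01 sqr_ge0. Qed.

Definition l1norm y : R := \sum_(i < d) `|tnth y i|.

Lemma l1norm_ge0 y : 0 <= l1norm y.
Proof. exact: sumr_ge0. Qed.

Lemma inner_le y x : `|inner y x| <= l1norm y * enorm x.
Proof.
apply: le_trans (ler_norm_sum _ _ _) _; rewrite mulr_suml; apply: ler_sum => i _.
by rewrite normrM ler_wpM2l// tnth_le_enorm.
Qed.

Lemma inner_sq_le y x : inner y x ^+ 2 <= l1norm y ^+ 2 * enorm x ^+ 2.
Proof.
rewrite -exprMn -real_normK ?num_real// ler_sqr ?nnegrE ?mulr_ge0 ?l1norm_ge0 ?enorm_ge0//.
exact: inner_le.
Qed.

(** The real and imaginary parts of the kernel of the Levy-Khintchine formula. *)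
Definition kRe y x : R := cos (inner y x) - 1.

Definition kIm y x : R := sin (inner y x) - inner y x * (enorm x <= 1)%R%:R.

Definition kbound y : R := 2 + l1norm y ^+ 2.

Lemma kRe_bound y x : `|kRe y x| <= kbound y * sqtrunc x.
Proof.
rewrite /kRe distrC ger0_norm ?subr_ge0 ?cos_le1// /kbound /sqtrunc.
have h1 := one_subcos_le (inner y x); have h2 := inner_sq_le y x.
have h3 := cos_geN1 (inner y x); have := sqr_ge0 (l1norm y); have := sqr_ge0 (enorm x).
move: (enorm x ^+ 2) (l1norm y ^+ 2) h2 => e l h2 e0 l0.
have le0 : 0 <= l * e by rewrite mulr_ge0.
by case: (leP 1 e) => _; [rewrite mulr1|rewrite mulrDl]; lra.
Qed.

Lemma kIm_bound y x : `|kIm y x| <= kbound y * sqtrunc x.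
Proof.
rewrite /kIm /kbound /sqtrunc.
have h2 := inner_sq_le y x; have := sqr_ge0 (l1norm y); have := enorm_ge0 x.
move: (l1norm y ^+ 2) h2 => l h2 e0 l0.
case: (leP (enorm x) 1) => e1; last first.
  have e2 : 1 <= enorm x ^+ 2 by rewrite expr_ge1// ltW.
  rewrite mulr0 subr0 (min_idPl e2) mulr1.
  by have := sin_max (inner y x); lra.
have e2 : enorm x ^+ 2 <= 1 by rewrite expr_le1.
rewrite mulr1 (min_idPr e2).
apply: le_trans (normr_sin_sub_id _) _.
have := sqr_ge0 (enorm x); move: h2; move: (enorm x ^+ 2) => e h2 ee0.
have le0 : 0 <= l * e by rewrite mulr_ge0.
rewrite mulrDl; lra.
Qed.

Lemma measurable_inner_diag : measurable_fun setT (fun x : V => inner x x).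
Proof.
rewrite /inner; apply: measurable_sum => i.
by apply: measurable_funM => //; exact: measurable_tnth.
Qed.

Lemma measurable_enorm : measurable_fun setT (@enorm R d).
Proof.
apply: measurableT_comp; last exact: measurable_inner_diag.
by apply: continuous_measurable_fun; exact: sqrt_continuous.
Qed.

Lemma measurable_sqtrunc : measurable_fun setT sqtrunc.
Proof. by apply: measurable_minr => //; apply: measurable_funX; exact: measurable_enorm. Qed.

Lemma measurable_kRe y : measurable_fun setT (kRe y).
Proof. by apply: measurable_funB => //; exact: measurable_cosy. Qed.

Lemma measurable_unit_ball : measurable_fun setT (fun x : V => (enorm x <= 1)%R%:R : R).
Proof.
rewrite (_ : (fun x => _) = \1_[set x : V | enorm x <= 1]); last first.
  by apply/funext => x; rewrite indicE; congr (nat_of_bool _)%:R; apply/idP/idP; rewrite inE.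
apply: measurable_indic; rewrite -[X in measurable X]setTI.
by apply: (@measurable_fun_ler _ _ _ _ (@enorm R d) (fun=> 1)) => //; exact: measurable_enorm.
Qed.

Lemma measurable_kIm y : measurable_fun setT (kIm y).
Proof.
apply: measurable_funB; first exact: measurable_siny.
by apply: measurable_funM; [exact: measurable_inner|exact: measurable_unit_ball].
Qed.

Lemma l1norm_scale (s : R) y : l1norm (scalev s y) = `|s| * l1norm y.
Proof. by rewrite /l1norm mulr_sumr; apply: eq_bigr => i _; rewrite tnth_mktuple normrM. Qed.

Lemma kbound_scale (s B : R) y : `|s| <= B -> kbound (scalev s y) <= kbound (scalev B y).
Proof.
move=> sB; rewrite /kbound lerD2l !l1norm_scale !exprMn ler_wpM2r ?sqr_ge0//.
rewrite ler_sqr ?nnegrE//; apply: le_trans sB (ler_norm _).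
Qed.

Lemma measurable_zerov : measurable [set zerov : V].
Proof.
have -> : [set zerov : V] = [set x | enorm x <= 0].
  rewrite eqEsubset; split=> x /=; first by move=> ->; rewrite /enorm inner0 sqrtr0.
  by move=> x0; apply/eqP; rewrite -enorm_eq0 eq_le x0 enorm_ge0.
rewrite -[X in measurable X]setTI.
by apply: (@measurable_fun_ler _ _ _ _ (@enorm R d) (fun=> 0)) => //; exact: measurable_enorm.
Qed.

End levy_kernel.

Section levy_exponents.
Context {R : realType} {d : nat}.
Local Notation V := (d.-tuple R).
Implicit Types (x y z : V) (S : 'M[R]_d).

Section one_measure.
Variable M : {measure set V -> \bar R}.
Hypothesis lM : levy_measure M.

Lemma integrable_sqtrunc : M.-integrable setT (EFin \o sqtrunc).
Proof.
apply/integrableP; split; first by apply/measurable_EFinP; exact: measurable_sqtrunc.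
apply: le_lt_trans lM.2; rewrite le_eqVlt; apply/orP; left; apply/eqP.
by apply: eq_integral => x _ /=; rewrite ger0_norm// sqtrunc_ge0.
Qed.

Lemma integrable_sqtruncZ (c : R) : M.-integrable setT (EFin \o (fun x => c * sqtrunc x)).
Proof. exact: (integrableZl measurableT c integrable_sqtrunc). Qed.

Lemma integrable_kRe y : M.-integrable setT (EFin \o kRe y).
Proof.
apply: le_integrableR (integrable_sqtruncZ (kbound y)); first exact: measurable_kRe.
exact: kRe_bound.
Qed.

Lemma integrable_kIm y : M.-integrable setT (EFin \o kIm y).
Proof.
apply: le_integrableR (integrable_sqtruncZ (kbound y)); first exact: measurable_kIm.
exact: kIm_bound.
Qed.

(** The kernel is integrable and the origin carries no mass, so the formula becomes two real
    integrals over the whole space. *)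
Lemma levy_khintchineE z S y : levy_khintchine z S M y =
  ((- (2^-1 * inner y (mulmxv S y)) + \int[M]_x kRe y x)
   +i* (inner y z + \int[M]_x kIm y x))%C.
Proof.
rewrite /levy_khintchine /Cintegral.
have off0 (f : V -> R) : M.-integrable setT (EFin \o f) ->
    (\int[M]_(x in ~` [set zerov]) (f x)%:E = \int[M]_x (f x)%:E)%E.
  move=> fi; rewrite -setTD -[LHS](@negligible_integral _ _ _ M setT [set zerov])//.
    exact: measurable_zerov.
  exact: lM.1.
have -> : (\int[M]_(x in ~` [set zerov]) (complex.Re (expC (0 +i* inner y x)%C - 1
    - (0 +i* (inner y x * (enorm x <= 1)%R%:R))%C))%:E
    = \int[M]_x (kRe y x)%:E)%E.
  rewrite -off0; last exact: integrable_kRe.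
  by apply: eq_integral => x _; rewrite expC_imag /= subr0.
have -> : (\int[M]_(x in ~` [set zerov]) (complex.Im (expC (0 +i* inner y x)%C - 1
    - (0 +i* (inner y x * (enorm x <= 1)%R%:R))%C))%:E
    = \int[M]_x (kIm y x)%:E)%E.
  rewrite -off0; last exact: integrable_kIm.
  by apply: eq_integral => x _; rewrite expC_imag /= subr0.
by apply/eqP; rewrite eq_complex /=; apply/andP; split; apply/eqP; rewrite ?add0r ?oppr0 ?addr0.
Qed.

Let ray_bound (u : nat -> R) (s : R) : u n @[n --> \oo] --> s ->
  exists B : R, forall n, `|u n| <= B.
Proof.
move=> us; have /cvg_seq_bounded [B [_ BP]] : cvg (u @ \oo) by apply/cvg_ex; exists s.
by exists (B + 1) => n; apply: BP; rewrite ?ltrDl//.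
Qed.

Lemma cvg_inner_ray (u : nat -> R) (s : R) x y : u n @[n --> \oo] --> s ->
  inner (scalev (u n) y) x @[n --> \oo] --> inner (scalev s y) x.
Proof.
move=> us; under eq_fun do rewrite inner_scalel.
by rewrite inner_scalel; apply: cvgMl.
Qed.

Lemma cvg_kRe (u : nat -> R) (s : R) y : u n @[n --> \oo] --> s ->
  \int[M]_x kRe (scalev (u n) y) x @[n --> \oo] --> \int[M]_x kRe (scalev s y) x.
Proof.
move=> us; have [B uB] := ray_bound us.
apply: (@cvg_Rintegral _ _ _ M _ _ (fun x => kbound (scalev B y) * sqtrunc x)).
- by move=> n; exact: measurable_kRe.
- move=> x; apply: cvgB; last exact: cvg_cst.
  by apply: continuous_cvg; [exact: continuous_cos|exact: cvg_inner_ray].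
- exact: integrable_sqtruncZ.
- move=> n x; apply: le_trans (kRe_bound _ _) _.
  by rewrite ler_wpM2r ?sqtrunc_ge0// kbound_scale.
Qed.

Lemma cvg_kIm (u : nat -> R) (s : R) y : u n @[n --> \oo] --> s ->
  \int[M]_x kIm (scalev (u n) y) x @[n --> \oo] --> \int[M]_x kIm (scalev s y) x.
Proof.
move=> us; have [B uB] := ray_bound us.
apply: (@cvg_Rintegral _ _ _ M _ _ (fun x => kbound (scalev B y) * sqtrunc x)).
- by move=> n; exact: measurable_kIm.
- move=> x; apply: cvgB.
    by apply: continuous_cvg; [exact: continuous_sin|exact: cvg_inner_ray].
  by apply: cvgMl; exact: cvg_inner_ray.
- exact: integrable_sqtruncZ.
- move=> n x; apply: le_trans (kIm_bound _ _) _.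
  by rewrite ler_wpM2r ?sqtrunc_ge0// kbound_scale.
Qed.

End one_measure.

Lemma mulmxv_scale S (s : R) y : mulmxv S (scalev s y) = scalev s (mulmxv S y).
Proof.
apply: eq_from_tnth => i; rewrite !tnth_mktuple mulr_sumr; apply: eq_bigr => j _.
by rewrite tnth_mktuple mulrCA.
Qed.

Lemma levy_exponent_ray (Phi : V -> R[i]) (u : nat -> R) (s : R) y :
  levy_exponent Phi -> u n @[n --> \oo] --> s ->
  (complex.Re (Phi (scalev (u n) y)) @[n --> \oo] --> complex.Re (Phi (scalev s y))) /\
  (complex.Im (Phi (scalev (u n) y)) @[n --> \oo] --> complex.Im (Phi (scalev s y))).
Proof.
move=> [z [S [M [_ lM ->]]]] us; rewrite !(levy_khintchineE lM); split;
  under eq_fun do rewrite (levy_khintchineE lM); rewrite /=.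
- apply: cvgD; last exact: cvg_kRe.
  apply: cvgN; apply: cvgMr; under eq_fun do rewrite mulmxv_scale inner_scaler.
  by rewrite mulmxv_scale inner_scaler; apply: cvgM => //; exact: cvg_inner_ray.
- by apply: cvgD; [exact: cvg_inner_ray|exact: cvg_kIm].
Qed.

Lemma levy_exponent0 (Phi : V -> R[i]) : levy_exponent Phi -> Phi zerov = 0.
Proof.
move=> [z [S [M [_ lM ->]]]]; rewrite (levy_khintchineE lM).
have inner0l (x : V) : inner zerov x = 0.
  by rewrite /inner big1// => i _; rewrite tnth_mktuple mul0r.
rewrite !inner0l mulr0 oppr0 !add0r.
have -> : \int[M]_x kRe zerov x = 0.
  by under eq_Rintegral do rewrite /kRe inner0l cos0 subrr; rewrite Rintegral_cst// mul0r.
have -> : \int[M]_x kIm zerov x = 0.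
  by under eq_Rintegral do rewrite /kIm inner0l sin0 mul0r subrr; rewrite Rintegral_cst// mul0r.
by [].
Qed.

Lemma scale0v y : scalev 0 y = zerov.
Proof. by apply: eq_from_tnth => i; rewrite !tnth_mktuple mul0r. Qed.

Lemma expC_inj_mod (z w : R[i]) : expC z = expC w ->
  complex.Re z = complex.Re w /\ cos (complex.Im z - complex.Im w) = 1.
Proof.
case: z w => [a b] [a' b']; rewrite /expC /= => -[h1 h2].
have sq (u v : R) : (expR u * cos v) ^+ 2 + (expR u * sin v) ^+ 2 = expR u ^+ 2.
  by rewrite !exprMn -mulrDr cos2Dsin2 mulr1.
have E : a = a'.
  apply: expR_inj; apply/eqP; rewrite -(@eqrXn2 _ 2) ?expR_ge0//.
  by rewrite -(sq a b) -(sq a' b') h1 h2.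
split => //; rewrite -E in h1 h2.
have e0 : expR a != 0 by rewrite gt_eqF// expR_gt0.
have /(mulfI e0) c := h1; have /(mulfI e0) s := h2.
by rewrite cosB c s -!expr2 cos2Dsin2.
Qed.

(** The exponent is determined by its exponential: along a ray the difference of
    two candidates is continuous, vanishes at 0 and takes values in [2 pi Z]. *)
Lemma levy_exponent_inj (Phi Psi : V -> R[i]) : levy_exponent Phi -> levy_exponent Psi ->
  (forall y, expC (Phi y) = expC (Psi y)) -> Phi = Psi.
Proof.
move=> lPhi lPsi E; apply/funext => y; have [hR hI] := expC_inj_mod (E y).
apply/eqP; rewrite eq_complex hR eqxx /= -subr_eq0; apply/negPn/negP => D0.
pose D s := complex.Im (Phi (scalev s y)) - complex.Im (Psi (scalev s y)).
have cD : continuous D.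
  move=> s; apply/continuous_withinNx/cvgr_dnbhsP => u [_ us]; apply: cvgB.
    by have [] := levy_exponent_ray y lPhi us.
  by have [] := levy_exponent_ray y lPsi us.
have D00 : D 0 = 0 by rewrite /D scale0v !levy_exponent0// subrr.
have D1 : D 1 = complex.Im (Phi y) - complex.Im (Psi y) by rewrite /D scalev1.
have cN : continuous (fun s => `|D s|).
  by move=> s; apply: continuous_comp; [exact: cD|exact: norm_continuous].
pose v := Num.min 1 `|D 1|.
have v0 : 0 < v by rewrite lt_min ltr01 normr_gt0 D1.
have [c c01 cv] : exists2 c, c \in `[0, 1] & `|D c| = v.
  apply: (@IVT _ (fun s => `|D s|)) => //; first exact: continuous_subspaceT.
  rewrite D00 normr0 (min_idPl _)// (max_idPr _)// (ltW v0)/=.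
  by rewrite ge_min lexx orbT.
have [_ cosD] := expC_inj_mod (E (scalev c y)).
have : cos v = 1.
  by rewrite -cv; case: (ger0P (D c)) => _; rewrite ?cosN.
have v1 : v <= 1 by rewrite ge_min lexx.
have := @one_subcos_ge _ v; rewrite gtr0_norm// => h c1.
have : v ^+ 2 / 8 <= 1 - cos v by apply: h; lra.
have : 0 < v ^+ 2 by rewrite exprn_gt0.
by rewrite c1; lra.
Qed.

End levy_exponents.

(** * Compound Poisson laws *)

Section charfun_closure.
Context {R : realType} {d : nat}.
Local Notation V := (d.-tuple R).
Implicit Types (x y z : V).

Definition is_charfun (f : V -> R[i]) :=
  exists mu : probability V R, forall y, charfun mu y = f y.

Lemma is_charfunM f g : is_charfun f -> is_charfun g -> is_charfun (fun y => f y * g y).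
Proof.
move=> [mu muf] [nu nug]; exists (convolution mu nu) => y.
by rewrite charfun_convolution muf nug.
Qed.

Lemma is_charfun_shift z : is_charfun (fun y => expC (0 +i* inner y z)%C).
Proof. by exists (\d_z : probability V R) => y; rewrite charfun_dirac. Qed.

Lemma eq_is_charfun f g : f =1 g -> is_charfun f -> is_charfun g.
Proof. by move=> fg [mu muf]; exists mu => y; rewrite muf fg. Qed.

Lemma is_charfun_prod (I : Type) (s : seq I) (f : I -> V -> R[i]) :
  (forall i, is_charfun (f i)) -> is_charfun (fun y => \prod_(i <- s) f i y).
Proof.
move=> fi; elim: s => [|i s ih].
  apply: eq_is_charfun (is_charfun_shift zerov) => y.
  by rewrite big_nil inner0 expC0.
by apply: eq_is_charfun (is_charfunM (fi i) ih) => y; rewrite big_cons.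
Qed.

(** The last hypothesis is continuity at the origin, along sequences; a failure of the
    uniform bound in [levy_continuity] would produce a sequence violating it. *)
Lemma is_charfun_lim (fn : nat -> V -> R[i]) (f : V -> R[i]) :
  (forall n, is_charfun (fn n)) ->
  (forall y, complex.Re (fn n y) @[n --> \oo] --> complex.Re (f y)) ->
  (forall y, complex.Im (fn n y) @[n --> \oo] --> complex.Im (f y)) ->
  (forall y (u : nat -> R), u n @[n --> \oo] --> (0 : R) ->
     complex.Re (f (scalev (u n) y)) @[n --> \oo] --> (1 : R)) ->
  is_charfun f.
Proof.
move=> /choice[mu muE] cRe cIm cf; apply: (levy_continuity (mu := mu)).
- by move=> y; under eq_fun do rewrite muE; exact: cRe.
- by move=> y; under eq_fun do rewrite muE; exact: cIm.
move=> j e e0; apply: contrapT => nt.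
have /choice[s sP] : forall n : nat, exists s : R, 0 <= s <= 1 /\
    e < 1 - complex.Re (f (scalev (s * n.+1%:R^-1) (ebasis j))).
  move=> n; apply: contrapT => ns; apply: nt; exists n.+1%:R^-1; first by rewrite invr_gt0.
  by move=> s s01; rewrite leNgt; apply/negP => h; apply: ns; exists s.
have u0 : s n * n.+1%:R^-1 @[n --> \oo] --> (0 : R).
  apply: (@squeeze_cvgr _ _ _ _ (fun=> 0) (fun n => n.+1%:R^-1)).
  - apply: nearW => n; have [/andP[s0 s1] _] := sP n.
    by rewrite mulr_ge0 ?invr_ge0//= ler_piMl// invr_ge0.
  - exact: cvg_cst.
  - exact: cvg_harmonic.
have c : 1 - complex.Re (f (scalev (s n * n.+1%:R^-1) (ebasis j))) @[n --> \oo]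
    --> (1 - 1 : R).
  by apply: cvgB; [exact: cvg_cst|exact: (cf (ebasis j) _ u0)].
have : e <= (1 - 1 : R).
  apply: (ler_cvg_to (cvg_cst e) c).
  by apply: nearW => n; have [_ /ltW] := sP n.
by rewrite subrr leNgt e0.
Qed.

Lemma cvg_expC (z_ : nat -> R[i]) (w : R[i]) :
  complex.Re (z_ n) @[n --> \oo] --> complex.Re w ->
  complex.Im (z_ n) @[n --> \oo] --> complex.Im w ->
  (complex.Re (expC (z_ n)) @[n --> \oo] --> complex.Re (expC w)) /\
  (complex.Im (expC (z_ n)) @[n --> \oo] --> complex.Im (expC w)).
Proof.
move=> cr ci; rewrite /expC /=.
have ce : expR (complex.Re (z_ n)) @[n --> \oo] --> expR (complex.Re w).
  by apply: continuous_cvg => //; exact: continuous_expR.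
split; apply: cvgM => //; apply: continuous_cvg => //.
  exact: continuous_cos.
exact: continuous_sin.
Qed.

Lemma is_charfun_expC_lim (Fn : nat -> V -> R[i]) (F : V -> R[i]) :
  (forall n, is_charfun (fun y => expC (Fn n y))) ->
  (forall y, complex.Re (Fn n y) @[n --> \oo] --> complex.Re (F y)) ->
  (forall y, complex.Im (Fn n y) @[n --> \oo] --> complex.Im (F y)) ->
  (forall y (u : nat -> R), u n @[n --> \oo] --> (0 : R) ->
     complex.Re (F (scalev (u n) y)) @[n --> \oo] --> (0 : R) /\
     complex.Im (F (scalev (u n) y)) @[n --> \oo] --> (0 : R)) ->
  is_charfun (fun y => expC (F y)).
Proof.
move=> hF cRe cIm c0; apply: (is_charfun_lim hF).
- by move=> y; have [] := cvg_expC (cRe y) (cIm y).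
- by move=> y; have [] := cvg_expC (cRe y) (cIm y).
- move=> y u u0; have [hr hi] := c0 y u u0.
  have [+ _] := @cvg_expC (fun n => F (scalev (u n) y)) 0 hr hi.
  by rewrite expC0.
Qed.

End charfun_closure.

Section exponential_limit.
Context {R : realType}.
Local Notation normc := (@Normc.normc R).
Implicit Types z w : R[i].

Lemma normc_le_parts z : normc z <= `|complex.Re z| + `|complex.Im z|.
Proof.
case: z => a b /=; rewrite -(@ler_sqr R) ?nnegrE ?addr_ge0 ?sqrtr_ge0//.
rewrite sqr_sqrtr ?addr_ge0 ?sqr_ge0// sqrrD !real_normK ?num_real//.
by rewrite addrAC lerDl mulrn_wge0// mulr_ge0.
Qed.

Lemma Re_le_normc z : `|complex.Re z| <= normc z.
Proof.
case: z => a b /=; rewrite -(@ler_sqr R) ?nnegrE ?sqrtr_ge0//.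
by rewrite sqr_sqrtr ?addr_ge0 ?sqr_ge0// real_normK ?num_real// lerDl sqr_ge0.
Qed.

Lemma Im_le_normc z : `|complex.Im z| <= normc z.
Proof.
case: z => a b /=; rewrite -(@ler_sqr R) ?nnegrE ?sqrtr_ge0//.
by rewrite sqr_sqrtr ?addr_ge0 ?sqr_ge0// real_normK ?num_real// lerDr sqr_ge0.
Qed.

Lemma normc_ge0 z : 0 <= normc z.
Proof. by case: z => a b; exact: sqrtr_ge0. Qed.

Lemma normcX_le1 z n : normc z <= 1 -> normc (z ^+ n) <= 1.
Proof.
move=> z1; elim: n => [|n ih]; first by rewrite expr0 Normc.normc1.
by rewrite exprS Normc.normcM mulr_ile1// normc_ge0.
Qed.

Lemma normc_subX z w n : normc z <= 1 -> normc w <= 1 ->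
  normc (z ^+ n - w ^+ n) <= n%:R * normc (z - w).
Proof.
move=> z1 w1; elim: n => [|n ih]; first by rewrite !expr0 subrr Normc.normc0 mul0r.
have -> : z ^+ n.+1 - w ^+ n.+1 = z * (z ^+ n - w ^+ n) + (z - w) * w ^+ n.
  by rewrite !exprS; ring.
apply: le_trans (le_normcD _ _) _; rewrite !Normc.normcM -natr1 mulrDl mul1r.
apply: lerD.
  by apply: le_trans ih; rewrite ler_piMl// normc_ge0.
by rewrite ler_piMr ?normc_ge0// normcX_le1.
Qed.

Lemma normc_expC z : normc (expC z) = expR (complex.Re z).
Proof.
rewrite /expC /= !exprMn -mulrDr cos2Dsin2 mulr1 sqrtr_sqr gtr0_norm//.
exact: expR_gt0.
Qed.

Lemma expC_taylor z : complex.Re z <= 0 ->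
  normc (expC z - (1 + z)) <= (`|complex.Re z| + `|complex.Im z|) ^+ 2.
Proof.
move=> z0; apply: le_trans (normc_le_parts _) _; case: z z0 => x y /= x0.
have e1 : expR x <= 1 by rewrite -expR0 ler_expR.
have e0 := expR_gt0 x.
have ex : 1 + x <= expR x := expR_ge1Dx x.
have ex2 : expR x - 1 - x <= x ^+ 2.
  have h := expR_ge1Dx (- x).
  have nx : 0 < 1 - x by lra.
  have : expR x * (1 - x) <= 1.
    apply: (@le_trans _ _ (expR x * expR (- x))); first by rewrite ler_wpM2l// ltW.
    by rewrite -expRD subrr expR0.
  have : 1 <= (1 + x + x ^+ 2) * (1 - x).
    have -> : (1 + x + x ^+ 2) * (1 - x) = 1 + (- x) * x ^+ 2 by ring.
    by rewrite lerDl mulr_ge0 ?sqr_ge0// oppr_ge0.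
  move=> h1 h2; have : expR x <= 1 + x + x ^+ 2 by rewrite -(ler_pM2r nx); exact: le_trans h1.
  lra.
have -> : expR x * cos y - (1 + x) = (expR x - 1 - x) - expR x * (1 - cos y) by ring.
have -> : expR x * sin y - (0 + y) = expR x * (sin y - y) + (expR x - 1) * y by ring.
have a1 : `|(expR x - 1 - x) - expR x * (1 - cos y)| <= x ^+ 2 + y ^+ 2 / 2.
  apply: le_trans (ler_normB _ _) (lerD _ _).
    by rewrite ger0_norm//; lra.
  rewrite ger0_norm; last by rewrite mulr_ge0 ?(ltW e0)// subr_ge0 cos_le1.
  apply: le_trans (one_subcos_le y); rewrite ler_piMl// subr_ge0; exact: cos_le1.
have a2 : `|expR x * (sin y - y) + (expR x - 1) * y| <= y ^+ 2 / 2 + `|x| * `|y|.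
  apply: le_trans (ler_normD _ _) (lerD _ _).
    rewrite normrM gtr0_norm//; apply: le_trans (normr_sin_sub_id y).
    by rewrite ler_piMl.
  rewrite normrM ler_wpM2r// distrC ger0_norm ?subr_ge0// (ler0_norm x0); lra.
apply: le_trans (lerD a1 a2) _.
rewrite sqrrD !real_normK ?num_real// -mulr_natr.
have : 0 <= `|x| * `|y| by rewrite mulr_ge0.
move: (`|x| * `|y|) => p p0; lra.
Qed.

(** Both sides are powers of numbers in the unit disc, so the error is at most [k + 1] times that
    of the linear approximation of the exponential at [w / (k + 1)]. *)
Lemma euler_limit w k : complex.Re w <= 0 -> normc (1 + w * (k.+1%:R^-1)%:C%C) <= 1 ->
  normc ((1 + w * (k.+1%:R^-1)%:C%C) ^+ k.+1 - expC w)
  <= (`|complex.Re w| + `|complex.Im w|) ^+ 2 / k.+1%:R.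
Proof.
move=> w0 n1; set v := w * (k.+1%:R^-1)%:C%C.
have k0 : 0 < k.+1%:R :> R by rewrite ltr0n.
have vR : complex.Re v = complex.Re w / k.+1%:R by rewrite /v; case: (w) => a b /=; rewrite mulr0 subr0.
have vI : complex.Im v = complex.Im w / k.+1%:R by rewrite /v; case: (w) => a b /=; rewrite mulr0 add0r.
have v0 : complex.Re v <= 0 by rewrite vR mulr_le0_ge0// invr_ge0 ltW.
have -> : expC w = expC v ^+ k.+1.
  rewrite -expCMn /v -mulrnAr -rmorphMn /=.
  have -> : k.+1%:R^-1 *+ k.+1 = 1 :> R by rewrite -[LHS]mulr_natr mulVf// gt_eqF.
  by rewrite mulr1.
apply: le_trans (normc_subX _ _ _) _ => //.
  by rewrite normc_expC -expR0 ler_expR.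
rewrite -opprB normcN.
apply: le_trans (ler_wpM2l (ltW k0) (expC_taylor v0)) _.
rewrite vR vI !normrM -mulrDl normfV (gtr0_norm k0) exprMn.
by rewrite mulrCA ler_wpM2l ?sqr_ge0// expr2 mulrA divff ?gt_eqF// mul1r.
Qed.

End exponential_limit.

Section probability_copy.
Context {d : measure_display} {T : measurableType d} {R : realType}.
Variable M : {measure set T -> \bar R}.

(** [M] itself, carrying the proof that its total mass is 1. *)
Definition probability_copy of M setT = 1%E := (M : set T -> \bar R).

Variable M1 : M setT = 1%E.
HB.instance Definition _ := isMeasure.Build _ _ _ (probability_copy M1)
  (@measure0 _ _ _ M) (@measure_ge0 _ _ _ M) (@measure_semi_sigma_additive _ _ _ M).
HB.instance Definition _ := Measure_isProbability.Build _ _ _ (probability_copy M1) M1.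
End probability_copy.

Section compound_poisson.
Context {R : realType} {d : nat}.
Local Notation V := (d.-tuple R).
Local Notation normc := (@Normc.normc R).

(** With [r] the modulus at [y], [r ^ 2] is the mean of [C cos + S sin], which is at most [r]
    by the Cauchy-Schwarz inequality. *)
Lemma charfun_le1 (P : probability V R) (y : V) : normc (charfun P y) <= 1.
Proof.
rewrite charfunE /=.
set C := \int[P]_x cos _; set S := \int[P]_x sin _; set r := Num.sqrt _.
have r0 : 0 <= r by exact: sqrtr_ge0.
have r2 : r ^+ 2 = C ^+ 2 + S ^+ 2 by rewrite sqr_sqrtr// addr_ge0// sqr_ge0.
suff : r ^+ 2 <= r.
  have [->|rn0] := eqVneq r 0; first by rewrite ler01.
  have rp : 0 < r by rewrite lt_neqAle eq_sym rn0.
  by rewrite expr2 -[leRHS]mul1r ler_pM2r.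
have ci : P.-integrable setT (EFin \o (fun x => C * cos (inner y x))).
  exact: (integrableZl measurableT C (integrable_cosy P y)).
have si : P.-integrable setT (EFin \o (fun x => S * sin (inner y x))).
  exact: (integrableZl measurableT S (integrable_siny P y)).
have -> : r ^+ 2 = \int[P]_x (C * cos (inner y x) + S * sin (inner y x)).
  rewrite RintegralD// !RintegralZl//; last 2 first.
  - exact: integrable_siny.
  - exact: integrable_cosy.
rewrite -[leRHS](prob_Rintegral_cst P r); apply: le_Rintegral => //.
- exact: (integrableD measurableT ci si).
- by apply: (@prob_integrable _ _ _ _ _ `|r|) => //; exact: measurable_cst.
- move=> x _; have h := cos2Dsin2 (inner y x).
  apply: le_trans (ler_norm _) _; rewrite -ler_sqr ?nnegrE// real_normK ?num_real// r2.
  move: h; move: (cos (inner y x)) (sin (inner y x)) => c s h.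
  have -> : C ^+ 2 + S ^+ 2 = (C ^+ 2 + S ^+ 2) * (c ^+ 2 + s ^+ 2) by rewrite h mulr1.
  have := sqr_ge0 (C * s - S * c); nra.
Qed.

Variable N : {measure set V -> \bar R}.
Hypothesis Nfin : (N setT < +oo)%E.

Let lam := fine (N setT).

Let NT : N setT = lam%:E.
Proof. by rewrite fineK// ge0_fin_numE. Qed.

Let icos y : N.-integrable setT (EFin \o (fun x => cos (inner y x))).
Proof.
by apply: (@bounded_integrable _ _ _ _ _ 1) => //; [exact: measurable_cosy|move=> x; exact: cos_max].
Qed.

Let isin y : N.-integrable setT (EFin \o (fun x => sin (inner y x))).
Proof.
by apply: (@bounded_integrable _ _ _ _ _ 1) => //; [exact: measurable_siny|move=> x; exact: sin_max].
Qed.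

Let psi (y : V) : R[i] := (\int[N]_x kRe y x +i* \int[N]_x sin (inner y x))%C.

Let kReE y : \int[N]_x kRe y x = \int[N]_x cos (inner y x) - lam.
Proof.
rewrite /kRe RintegralB//; last first.
  by apply: (@bounded_integrable _ _ _ _ _ 1) => // x; rewrite normr1.
by rewrite Rintegral_cst// mul1r.
Qed.

(** The law of at most one jump: mass [N / k] besides an atom at the origin. *)
Let is_charfun_mix k : lam <= k.+1%:R ->
  is_charfun (fun y => 1 + psi y * (k.+1%:R^-1)%:C%C).
Proof.
move=> lk; have k0 : 0 < k.+1%:R :> R by rewrite ltr0n.
have a0 : 0 <= 1 - lam / k.+1%:R by rewrite subr_ge0 ler_pdivrMr// mul1r.
have b0 : 0 <= k.+1%:R^-1 :> R by rewrite invr_ge0 ltW.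
pose Q : {measure set V -> \bar R} :=
  measure_add (mscale (NngNum a0) (\d_(zerov : V))) (mscale (NngNum b0) N).
have Q1 : Q setT = 1%E.
  apply: etrans (measure_addE _ _ _) _.
  rewrite /= /mscale /= diracT NT mule1 -EFinM -EFinD.
  by congr EFin; rewrite mulrC subrK.
exists (probability_copy Q1) => y; rewrite charfunE.
have QE (f : V -> R) : measurable_fun setT f -> N.-integrable setT (EFin \o f) ->
    (forall x, `|f x| <= 1) ->
    \int[probability_copy Q1]_x f x = (1 - lam / k.+1%:R) * f zerov + k.+1%:R^-1 * \int[N]_x f x.
  move=> mf fi f1; have di : (\d_(zerov : V) : {measure set V -> \bar R}).-integrable setT (EFin \o f).
    by apply: (@bounded_integrable _ _ _ _ _ 1) => //; rewrite /= diracT ltry.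
  rewrite -[LHS]/(\int[Q]_x f x) Rintegral_measure_add; [|exact: integrable_mscale..].
  by rewrite !Rintegral_mscale// Rintegral_dirac.
have Ec := QE _ (measurable_cosy y) (icos y) (fun x => cos_max _).
have Es := QE _ (measurable_siny y) (isin y) (fun x => sin_max _).
apply/eqP; rewrite eq_complex /=; apply/andP; split; apply/eqP.
  apply: etrans Ec _; rewrite inner0 cos0 kReE; field.
  by rewrite addrC natr1 gt_eqF.
apply: etrans Es _; rewrite inner0 sin0; field.
by rewrite addrC natr1 gt_eqF.
Qed.

(** Convolve [k] times the law with jump part [N / k] and let [k] tend to infinity, which is
    Euler's limit for the exponential. *)
Lemma is_charfun_compound_poisson :
  is_charfun (fun y => expC (\int[N]_x kRe y x +i* \int[N]_x sin (inner y x))%C).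
Proof.
pose K n := (n + Num.truncn lam)%N.
have lK n : lam <= (K n).+1%:R.
  apply: (le_trans (ltW (truncnS_gt lam))); rewrite ler_nat ltnS; exact: leq_addl.
have psi0 y : complex.Re (psi y) <= 0.
  rewrite /= -oppr_ge0 -mulN1r -RintegralZl//.
    by apply: Rintegral_ge0 => x _; rewrite mulN1r /kRe opprB subr_ge0 cos_le1.
  apply: (@bounded_integrable _ _ _ _ _ 2) => //; first exact: measurable_kRe.
  move=> x; rewrite /kRe distrC ger0_norm ?subr_ge0 ?cos_le1//.
  by have := cos_geN1 (inner y x); lra.
have dist n y : normc ((1 + psi y * ((K n).+1%:R^-1)%:C%C) ^+ (K n).+1 - expC (psi y))
    <= (`|complex.Re (psi y)| + `|complex.Im (psi y)|) ^+ 2 * n.+1%:R^-1.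
  apply: le_trans (euler_limit _ _) _ => //.
    by have [P PE] := is_charfun_mix (lK n); rewrite -PE charfun_le1.
  rewrite ler_wpM2l ?sqr_ge0// lef_pV2 ?posrE ?ltr0n// ler_nat ltnS; exact: leq_addr.
have rate y : (`|complex.Re (psi y)| + `|complex.Im (psi y)|) ^+ 2 * n.+1%:R^-1
    @[n --> \oo] --> (0 : R).
  by rewrite -[X in _ --> X](mulr0 ((`|complex.Re (psi y)| + `|complex.Im (psi y)|) ^+ 2));
    apply: cvgMr; exact: cvg_harmonic.
have cvg_part (u : nat -> R) (l : R) (e : nat -> R) :
    (forall n, `|u n - l| <= e n) -> e n @[n --> \oo] --> (0 : R) -> u n @[n --> \oo] --> l.
  move=> ue e0; apply/subr_cvg0; apply: norm_cvg0.
  apply: (@squeeze_cvgr _ _ _ _ (fun=> 0) e) => //; last exact: cvg_cst.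
  by apply: nearW => n; rewrite normr_ge0 ue.
apply: (is_charfun_lim (fn := fun n y => (1 + psi y * ((K n).+1%:R^-1)%:C%C) ^+ (K n).+1)).
- move=> n; have [P PE] := is_charfun_mix (lK n).
  by exists (convolution_power P (K n).+1) => y; rewrite charfun_power PE.
- move=> y; apply: (cvg_part _ _ _ _ (rate y)) => n.
  apply: le_trans (dist n y); apply: le_trans (Re_le_normc _).
  by rewrite raddfB.
- move=> y; apply: (cvg_part _ _ _ _ (rate y)) => n.
  apply: le_trans (dist n y); apply: le_trans (Im_le_normc _).
  by rewrite raddfB.
move=> y u u0.
have iN (B : R) : N.-integrable setT (EFin \o (fun=> B)).
  by apply: (@bounded_integrable _ _ _ _ _ `|B|) => //; exact: measurable_cst.
have hr : \int[N]_x kRe (scalev (u n) y) x @[n --> \oo] --> (0 : R).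
  have -> : (0 : R) = \int[N]_x 0 by rewrite Rintegral_cst// mul0r.
  apply: (@cvg_Rintegral _ _ _ N _ _ (fun=> 2)); [|move=> x|exact: iN|move=> n x].
  - by move=> n; exact: measurable_kRe.
  - rewrite -(subrr (1 : R)) -{1}(@cos0 R); apply: cvgB; last exact: cvg_cst.
    apply: continuous_cvg; first exact: continuous_cos.
    by under eq_fun do rewrite inner_scalel; rewrite -(mul0r (inner y x)); apply: cvgMl.
  - rewrite /kRe distrC ger0_norm ?subr_ge0 ?cos_le1//.
    by have := cos_geN1 (inner (scalev (u n) y) x); lra.
have hi : \int[N]_x sin (inner (scalev (u n) y) x) @[n --> \oo] --> (0 : R).
  have -> : (0 : R) = \int[N]_x 0 by rewrite Rintegral_cst// mul0r.
  apply: (@cvg_Rintegral _ _ _ N _ _ (fun=> 1)); [|move=> x|exact: iN|move=> n x].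
  - by move=> n; exact: measurable_siny.
  - rewrite -{1}(@sin0 R).
    apply: continuous_cvg; first exact: continuous_sin.
    by under eq_fun do rewrite inner_scalel; rewrite -(mul0r (inner y x)); apply: cvgMl.
  - exact: sin_max.
have [+ _] := @cvg_expC R (fun n => psi (scalev (u n) y)) 0 hr hi.
by rewrite expC0.
Qed.

End compound_poisson.

(** * Existence of infinitely divisible laws *)

Section quadratic_forms.
Context {R : realType} {d : nat}.
Local Notation V := (d.-tuple R).
Implicit Types (x y z : V) (S : 'M[R]_d).

Lemma mulmxv_ebasis S k i : tnth (mulmxv S (ebasis k)) i = S i k.
Proof.
rewrite tnth_mktuple (bigD1 k)//= big1 => [|j jk].
  by rewrite tnth_mktuple eqxx mulr1 addr0.
by rewrite tnth_mktuple (negbTE jk) mulr0.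
Qed.

Lemma mulmxv_scalemx (c : R) S y : mulmxv (c *: S) y = scalev c (mulmxv S y).
Proof.
apply: eq_from_tnth => i; rewrite !tnth_mktuple mulr_sumr; apply: eq_bigr => j _.
by rewrite mxE mulrA.
Qed.

Lemma inner_mulmxvD S x y z :
  inner x (mulmxv S (vadd (y, z))) = inner x (mulmxv S y) + inner x (mulmxv S z).
Proof.
rewrite -(inner_vadd x (mulmxv S y, mulmxv S z)); congr inner.
apply: eq_from_tnth => i; rewrite !tnth_mktuple -big_split /=; apply: eq_bigr => j _.
by rewrite tnth_mktuple mulrDr.
Qed.

Lemma inner_mulmxv_sym S x y : S^T = S -> inner x (mulmxv S y) = inner y (mulmxv S x).
Proof.
move=> St; rewrite /inner.
under eq_bigr do rewrite tnth_mktuple mulr_sumr.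
under [RHS]eq_bigr do rewrite tnth_mktuple mulr_sumr.
rewrite exchange_big /=; apply: eq_bigr => i _; apply: eq_bigr => j _.
by rewrite -{1}St mxE; ring.
Qed.

Lemma quad_shift S y k (t : R) : S^T = S ->
  let y' := vadd (y, scalev t (ebasis k)) in
  inner y' (mulmxv S y') = inner y (mulmxv S y)
    + 2 * t * inner y (mulmxv S (ebasis k)) + t ^+ 2 * S k k.
Proof.
move=> St y'; rewrite /y' inner_mulmxvD !inner_vaddl /= !mulmxv_scale !inner_scaler !inner_scalel.
rewrite (inner_mulmxv_sym (ebasis k) y)// inner_ebasis mulmxv_ebasis; ring.
Qed.

Lemma covariance_diag_ge0 S k : covariance_mx S -> 0 <= S k k.
Proof. by move=> [_ /(_ (ebasis k))]; rewrite inner_ebasis mulmxv_ebasis. Qed.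

Lemma covariance_diag0 S k j : covariance_mx S -> S k k = 0 -> S k j = 0.
Proof.
move=> [St Sp] Skk; apply/eqP/negPn/negP => Skj.
pose t := - (S j j + 1) / (2 * S k j).
have := Sp (vadd (ebasis j, scalev t (ebasis k))).
rewrite quad_shift// !inner_ebasis !mulmxv_ebasis Skk mulr0 addr0.
have Sjk : S j k = S k j by rewrite -[in LHS]St mxE.
have -> : 2 * t * S j k = - (S j j + 1) by rewrite Sjk /t; field.
by rewrite leNgt; apply/negP/negPn; lra.
Qed.

(** A positive semidefinite form is a sum of squares of linear forms: subtract the
    square that cancels one nonzero diagonal entry, and iterate. *)
Lemma psd_sum_squares S : covariance_mx S ->
  exists vs : seq V, forall y, inner y (mulmxv S y) = \sum_(v <- vs) inner y v ^+ 2.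
Proof.
have [n] := ubnP #|[pred k | S k k != 0]|.
elim: n => // n IH in S * => Sn cS; have [St Sp] := cS.
have [/forallP Sd|] := boolP [forall k, S k k == 0].
  exists [::] => y; rewrite big_nil /inner big1// => i _.
  rewrite tnth_mktuple big1 ?mulr0// => j _.
  by rewrite (covariance_diag0 _ cS) ?mul0r//; apply/eqP.
rewrite negb_forall => /existsP[k Sk].
have Skp : 0 < S k k by rewrite lt_neqAle eq_sym Sk covariance_diag_ge0.
pose w := mulmxv S (ebasis k).
pose S' : 'M[R]_d := \matrix_(i, j) (S i j - tnth w i * tnth w j / S k k).
have S'y y i : tnth (mulmxv S' y) i = tnth (mulmxv S y) i - tnth w i * (inner y w / S k k).
  rewrite [LHS]tnth_mktuple [X in X - _]tnth_mktuple /inner mulr_suml mulr_sumr -sumrB.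
  by apply: eq_bigr => j _; rewrite mxE; field.
have S'E y : inner y (mulmxv S' y) = inner y (mulmxv S y) - inner y w ^+ 2 / S k k.
  rewrite [LHS](_ : _ = \sum_(i < d) (tnth y i * tnth (mulmxv S y) i
      - tnth y i * tnth w i * (inner y w / S k k))).
    by rewrite sumrB -mulr_suml expr2 mulrA.
  by apply: eq_bigr => i _; rewrite S'y; ring.
have cS' : covariance_mx S'.
  split=> [|y].
    apply/matrixP => i j; rewrite !mxE (mulrC (tnth w j)).
    by rewrite -{1}St mxE.
  rewrite S'E; have := Sp (vadd (y, scalev (- (inner y w / S k k)) (ebasis k))).
  rewrite quad_shift// -/w.
  suff -> : inner y (mulmxv S y) + 2 * - (inner y w / S k k) * inner y w
    + (- (inner y w / S k k)) ^+ 2 * S k k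
    = inner y (mulmxv S y) - inner y w ^+ 2 / S k k by [].
  by field.
have [|vs vsE] := IH S' _ cS'.
  rewrite -ltnS; apply: leq_trans Sn; rewrite ltnS; apply: proper_card.
  apply/properP; split; last first.
    exists k; rewrite inE// mxE /w !mulmxv_ebasis negbK.
    by rewrite mulfK// subrr.
  apply/fintype.subsetP => j; rewrite !inE mxE; apply: contra => /eqP Sjj.
  by rewrite Sjj /w mulmxv_ebasis (covariance_diag0 k cS Sjj) !mul0r subrr.
exists (scalev (Num.sqrt (S k k))^-1 w :: vs) => y.
rewrite big_cons -vsE S'E inner_scaler exprMn exprVn sqr_sqrtr ?(ltW Skp)//.
by rewrite mulrC addrC subrK.
Qed.

End quadratic_forms.

Section gaussian.
Context {R : realType} {d : nat}.
Local Notation V := (d.-tuple R).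

Lemma one_subcos_sq (x : R) : `|1 - cos x - x ^+ 2 / 2| <= `|x| ^+ 3.
Proof.
rewrite one_subcos; set w := x / 2.
have -> : x ^+ 2 / 2 = 2 * w ^+ 2 by rewrite /w; field.
have -> : (sin w ^+ 2) *+ 2 - 2 * w ^+ 2 = 2 * ((sin w - w) * (sin w + w)) by rewrite -mulr_natr; ring.
have wx : `|x| = 2 * `|w| by rewrite /w normrM normfV (ger0_norm (_ : 0 <= 2 :> R))//; field.
rewrite normrM (ger0_norm (_ : 0 <= 2 :> R))// normrM wx.
have h1 := normr_sin_sub_id w.
have h2 : `|sin w + w| <= 2 * `|w|.
  by apply: le_trans (ler_normD _ _) _; have := normr_sin_le w; lra.
apply: (@le_trans _ _ (2 * (w ^+ 2 / 2 * (2 * `|w|)))).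
  by rewrite ler_wpM2l// ler_pM.
rewrite -[w ^+ 2]real_normK ?num_real//.
have -> : 2 * (`|w| ^+ 2 / 2 * (2 * `|w|)) = 2 * `|w| ^+ 3 by field.
have -> : (2 * `|w|) ^+ 3 = 8 * `|w| ^+ 3 by ring.
by rewrite ler_wpM2r// ?exprn_ge0//; lra.
Qed.

Lemma cvg_gaussian_exponent (u : R) :
  n.+1%:R ^+ 2 * (cos (n.+1%:R^-1 * u) - 1) @[n --> \oo] --> - (2^-1 * u ^+ 2).
Proof.
apply/subr_cvg0; apply: norm_cvg0.
apply: (@squeeze_cvgr _ _ _ _ (fun=> 0) (fun n => `|u| ^+ 3 * n.+1%:R^-1)).
- apply: nearW => n; rewrite normr_ge0/=.
  have n0 : 0 < n.+1%:R :> R by rewrite ltr0n.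
  have h := one_subcos_sq (n.+1%:R^-1 * u).
  have -> : n.+1%:R ^+ 2 * (cos (n.+1%:R^-1 * u) - 1) - - (2^-1 * u ^+ 2)
    = - n.+1%:R ^+ 2 * (1 - cos (n.+1%:R^-1 * u) - (n.+1%:R^-1 * u) ^+ 2 / 2).
    by field; rewrite addrC natr1 gt_eqF.
  rewrite normrM normrN (ger0_norm (sqr_ge0 _)).
  apply: le_trans (ler_wpM2l (sqr_ge0 _) h) _.
  rewrite normrM normfV (gtr0_norm n0) exprMn.
  rewrite le_eqVlt; apply/orP; left; apply/eqP; field.
  by rewrite addrC natr1 gt_eqF.
- exact: cvg_cst.
- by rewrite -[X in _ --> X](mulr0 (`|u| ^+ 3)); apply: cvgMr; exact: cvg_harmonic.
Qed.

(** A centred Gaussian is the limit of compound Poisson laws with the two jumps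
    [+- v / n] at rate [n ^ 2 / 2] each. *)
Lemma is_charfun_gaussian1 (v : V) :
  is_charfun (fun y => expC (- (2^-1 * inner y v ^+ 2) +i* 0)%C).
Proof.
pose r n : R := n.+1%:R ^+ 2 / 2.
have r0 n : 0 <= r n by rewrite divr_ge0// sqr_ge0.
pose N n : {measure set V -> \bar R} := mscale (NngNum (r0 n))
  (measure_add (\d_(scalev n.+1%:R^-1 v)) (\d_(scalev (- n.+1%:R^-1) v))).
have Nfin n : (N n setT < +oo)%E.
  rewrite /N /= /mscale; apply: lte_mul_pinfty => //.
  apply: (@le_lt_trans _ _ (1 + 1)%E); last by rewrite -EFinD ltry.
  by apply: (@le_trans _ _ (\d_(scalev n.+1%:R^-1 v) setT + \d_(scalev (- n.+1%:R^-1) v) setT)%E);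
    [rewrite -measure_addE|rewrite !diracT].
have NE n (f : V -> R) (B : R) : measurable_fun setT f -> (forall x, `|f x| <= B) ->
    \int[N n]_x f x = r n * (f (scalev n.+1%:R^-1 v) + f (scalev (- n.+1%:R^-1) v)).
  move=> mf fB.
  have di a : (\d_(a : V) : {measure set V -> \bar R}).-integrable setT (EFin \o f).
    by apply: (@bounded_integrable _ _ _ _ _ B) => //; rewrite /= diracT ltry.
  have si : (measure_add (\d_(scalev n.+1%:R^-1 v) : {measure set V -> \bar R})
      (\d_(scalev (- n.+1%:R^-1) v) : {measure set V -> \bar R})).-integrable setT (EFin \o f).
    apply: (@bounded_integrable _ _ _ _ _ B) => //.
    apply: (@le_lt_trans _ _ (1 + 1)%E); last by rewrite -EFinD ltry.
    by apply: (@le_trans _ _ (\d_(scalev n.+1%:R^-1 v) setT + \d_(scalev (- n.+1%:R^-1) v) setT)%E);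
      [rewrite -measure_addE|rewrite !diracT].
  by rewrite Rintegral_mscale// Rintegral_measure_add// !Rintegral_dirac.
have NRe n y : \int[N n]_x kRe y x = n.+1%:R ^+ 2 * (cos (n.+1%:R^-1 * inner y v) - 1).
  rewrite (NE _ _ 2); last 2 first.
  - exact: measurable_kRe.
  - move=> x; rewrite /kRe distrC ger0_norm ?subr_ge0 ?cos_le1//.
    by have := cos_geN1 (inner y x); lra.
  by rewrite /kRe !inner_scaler mulNr cosN /r; field.
have NIm n y : \int[N n]_x sin (inner y x) = 0.
  rewrite (NE _ _ 1); last 2 first.
  - exact: measurable_siny.
  - by move=> x; exact: sin_max.
  by rewrite !inner_scaler mulNr sinN subrr mulr0.
apply: (is_charfun_expC_lim (Fn := fun n y =>
  (\int[N n]_x kRe y x +i* \int[N n]_x sin (inner y x))%C)).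
- by move=> n; exact: is_charfun_compound_poisson.
- by move=> y /=; under eq_fun do rewrite NRe; exact: cvg_gaussian_exponent.
- by move=> y /=; under eq_fun do rewrite NIm; exact: cvg_cst.
- move=> y u u0 /=; split; last exact: cvg_cst.
  have -> : (0 : R) = - (2^-1 * (0 * inner y v) ^+ 2) by rewrite mul0r expr0n mulr0 oppr0.
  apply: cvgN; apply: cvgMr.
  under eq_fun do rewrite inner_scalel expr2; rewrite expr2.
  by apply: cvgM; apply: cvgMl.
Qed.

Lemma is_charfun_gaussian (S : 'M[R]_d) : covariance_mx S ->
  is_charfun (fun y => expC (- (2^-1 * inner y (mulmxv S y)) +i* 0)%C).
Proof.
move=> /psd_sum_squares[vs vsE].
apply: eq_is_charfun (is_charfun_prod vs is_charfun_gaussian1) => y; rewrite vsE.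
elim: vs {vsE} => [|v vs IH].
  by rewrite !big_nil mulr0 oppr0 -[(0 +i* 0)%C]/(0 : R[i]) expC0.
rewrite !big_cons IH -expCD; congr expC.
by apply/eqP; rewrite eq_complex /= addr0 eqxx andbT; apply/eqP; ring.
Qed.

End gaussian.

Section jumps.
Context {R : realType} {d : nat}.
Local Notation V := (d.-tuple R).
Variable M : {measure set V -> \bar R}.
Hypothesis lM : levy_measure M.

Definition far n : set V := [set x | n.+1%:R^-1 < enorm x].

Lemma measurable_far n : measurable (far n).
Proof.
rewrite -[X in measurable X]setTI.
by apply: (@measurable_fun_ltr _ _ _ _ (fun=> n.+1%:R^-1)) => //; exact: measurable_enorm.
Qed.

Lemma far_lty n : (M (far n) < +oo)%E.
Proof.
have mA := measurable_far n.
pose c : R := n.+1%:R^-1 ^+ 2.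
have c0 : 0 < c by rewrite exprn_gt0// invr_gt0.
have : (c%:E * M (far n) < +oo)%E.
  apply: le_lt_trans lM.2.
  rewrite -[X in (_ * M X)%E]setIT -integral_indic// -ge0_integralZl//; last 2 first.
  - by apply/measurable_EFinP; exact: measurable_indic.
  - by rewrite lee_fin ltW.
  apply: ge0_le_integral => //.
  - by move=> x _; rewrite mule_ge0// lee_fin ltW.
  - by apply: measurable_funeM; apply/measurable_EFinP; exact: measurable_indic.
  - by apply/measurable_EFinP; exact: measurable_sqtrunc.
  - move=> x _; rewrite -EFinM lee_fin indicE.
    case: (boolP (x \in _)) => [|_]; last by rewrite mulr0 sqtrunc_ge0.
    rewrite inE /= mulr1 => xn; rewrite le_min; apply/andP; split.
      by rewrite /c exprn_ile1// invf_le1// ler1n.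
    by rewrite /c ler_sqr ?nnegrE ?enorm_ge0// ltW.
have := measure_ge0 M (far n); case: (M (far n)) => [r| |] //.
  by move=> _ _; exact: ltry.
by move=> _; rewrite gt0_muley// lte_fin.
Qed.

Lemma bigcup_far : [set zerov : V] `|` \bigcup_n far n = setT.
Proof.
rewrite -subTset => x _; have [->|x0] := eqVneq x zerov; [by left|right].
have e0 : 0 < enorm x by rewrite lt_neqAle enorm_ge0 eq_sym enorm_eq0 x0.
by have [n _ nP] := near_infty_natSinv_lt (PosNum e0); exists n => //; exact: (nP n (leqnn n)).
Qed.

Lemma levy_measure_sigma_finite : sigma_finite setT M.
Proof.
exists (fun n => if n is k.+1 then far k else [set zerov]).
  rewrite -bigcup_far eqEsubset; split=> x.
    by case=> [x0|[n _ nx]]; [exists 0|exists n.+1].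
  by case=> -[|n] _ h; [left|right; exists n].
case=> [|n]; split; [exact: measurable_zerov| |exact: measurable_far|exact: far_lty].
by rewrite lM.1 ltry.
Qed.

Let Mn n : {measure set V -> \bar R} := mrestr M (measurable_far n).

Let Mn_lty n : (Mn n setT < +oo)%E.
Proof. by rewrite /Mn /= /mrestr setTI far_lty. Qed.

Let MnE n (f : V -> R) : measurable_fun setT f ->
  \int[Mn n]_x f x = \int[M]_x (f \_ (far n)) x.
Proof.
move=> mf; rewrite -Rintegral_mkcond /Rintegral integral_mrestr//.
exact/measurable_EFinP.
Qed.

Lemma cvg_far (f : V -> R) (c : R) : measurable_fun setT f ->
  f zerov = 0 -> (forall x, `|f x| <= c * sqtrunc x) ->
  \int[Mn n]_x f x @[n --> \oo] --> \int[M]_x f x.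
Proof.
move=> mf f0 fb; under eq_fun do rewrite MnE//.
apply: (@cvg_Rintegral _ _ _ M _ _ (fun x => c * sqtrunc x)).
- move=> n; apply/(measurable_restrictT _ (measurable_far n)).
  exact: measurable_funTS.
- move=> x; have [->|x0] := eqVneq x zerov.
    rewrite f0 (_ : (fun n => _) = fun=> 0); first exact: cvg_cst.
    by apply/funext => n; rewrite patchE; case: ifP.
  have e0 : 0 < enorm x by rewrite lt_neqAle enorm_ge0 eq_sym enorm_eq0 x0.
  apply: cvg_near_cst; apply: filterS (near_infty_natSinv_lt (PosNum e0)) => n nx.
  by rewrite patchE mem_set.
- exact: integrable_sqtruncZ.
- move=> n x; rewrite patchE; case: ifP => // _.
  by rewrite normr0; exact: le_trans (normr_ge0 _) (fb x).
Qed.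

(** Off a neighbourhood of the origin the jump measure is finite: a compound Poisson law,
    shifted to compensate its jumps of size at most 1. Let the neighbourhood shrink. *)
Lemma is_charfun_jumps : is_charfun (fun y =>
  expC (\int[M]_x kRe y x +i* \int[M]_x kIm y x)%C).
Proof.
pose b j (x : V) : R := tnth x j * (enorm x <= 1)%R%:R.
have mb j : measurable_fun setT (b j).
  by apply: measurable_funM; [exact: measurable_tnth|exact: measurable_unit_ball].
have b1 j x : `|b j x| <= 1.
  rewrite /b normrM; case: (leP (enorm x) 1) => x1; last by rewrite normr0 mulr0.
  by rewrite normr1 mulr1; exact: le_trans (tnth_le_enorm x j) x1.
pose zn n : V := [tuple \int[Mn n]_x b j x | j < d].
have ib n j : (Mn n).-integrable setT (EFin \o b j).
  exact: (bounded_integrable (Mn_lty n) (@mb j) (b1 j)).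
have iC n y : (Mn n).-integrable setT (EFin \o (fun x : V => inner y x * (enorm x <= 1)%R%:R)).
  apply: (@bounded_integrable _ _ _ _ _ (l1norm y)) => //.
    by apply: measurable_funM; [exact: measurable_inner|exact: measurable_unit_ball].
  move=> x; rewrite normrM; case: (leP (enorm x) 1) => x1; last by rewrite normr0 mulr0 l1norm_ge0.
  rewrite normr1 mulr1; apply: le_trans (inner_le _ _) _.
  by rewrite ler_piMr ?l1norm_ge0.
have iS n y : (Mn n).-integrable setT (EFin \o (fun x : V => sin (inner y x))).
  by apply: (@bounded_integrable _ _ _ _ _ 1) => //; [exact: measurable_siny|move=> x; exact: sin_max].
have znE n y : inner y (zn n) = \int[Mn n]_x (inner y x * (enorm x <= 1)%R%:R).
  rewrite /inner.
  have -> : \int[Mn n]_x ((\sum_(i < d) tnth y i * tnth x i) * (enorm x <= 1)%R%:R)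
      = \int[Mn n]_x (\sum_(i < d) tnth y i * b i x).
    apply: eq_Rintegral => x _; rewrite mulr_suml; apply: eq_bigr => i _.
    by rewrite mulrA.
  rewrite Rintegral_sum => [|i]; last exact: (integrableZl measurableT (tnth y i) (ib n i)).
  by apply: eq_bigr => i _; rewrite tnth_mktuple RintegralZl.
have kImE n y : \int[Mn n]_x sin (inner y x) + inner y (scalev (-1) (zn n))
    = \int[Mn n]_x kIm y x.
  by rewrite inner_scaler mulN1r znE -RintegralB.
apply: (is_charfun_expC_lim (Fn := fun n y =>
  (\int[Mn n]_x kRe y x +i* \int[Mn n]_x sin (inner y x))%C
  + (0 +i* inner y (scalev (-1) (zn n)))%C)).
- move=> n.
  apply: (eq_is_charfun _ (is_charfunM (is_charfun_compound_poisson (Mn_lty n))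
    (is_charfun_shift (scalev (-1) (zn n))))) => y.
  by rewrite -expCD.
- move=> y /=; under eq_fun do rewrite addr0.
  apply: (@cvg_far _ (kbound y)); first exact: measurable_kRe.
    by rewrite /kRe inner0 cos0 subrr.
  exact: kRe_bound.
- move=> y /=; under eq_fun do rewrite kImE.
  apply: (@cvg_far _ (kbound y)); first exact: measurable_kIm.
    by rewrite /kIm inner0 sin0 mul0r subrr.
  exact: kIm_bound.
- move=> y u u0 /=.
  have z0 (x : V) : inner (scalev 0 y) x = 0 by rewrite inner_scalel mul0r.
  have c1 := @cvg_kRe _ _ M lM u 0 y u0; have c2 := @cvg_kIm _ _ M lM u 0 y u0.
  split; [move: c1|move: c2].
    rewrite (_ : \int[M]_x kRe (scalev 0 y) x = 0)//.
    by under eq_Rintegral do rewrite /kRe z0 cos0 subrr; rewrite Rintegral_cst// mul0r.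
  rewrite (_ : \int[M]_x kIm (scalev 0 y) x = 0)//.
  by under eq_Rintegral do rewrite /kIm z0 sin0 mul0r subrr; rewrite Rintegral_cst// mul0r.
Qed.

End jumps.

Section levy_laws.
Context {R : realType} {d : nat}.
Local Notation V := (d.-tuple R).

Lemma is_charfun_levy (Phi : V -> R[i]) : levy_exponent Phi ->
  is_charfun (fun y => expC (Phi y)).
Proof.
move=> [z [S [M [cS lM ->]]]].
apply: eq_is_charfun (is_charfunM (is_charfun_shift z)
  (is_charfunM (is_charfun_gaussian cS) (is_charfun_jumps lM))) => y.
rewrite -!expCD (levy_khintchineE lM); congr expC.
by apply/eqP; rewrite eq_complex /= !add0r !eqxx.
Qed.

Lemma levy_exponent_root (Phi : V -> R[i]) (n : nat) : levy_exponent Phi ->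
  exists2 Psi, levy_exponent Psi & forall y, Phi y = Psi y *+ n.+1.
Proof.
move=> [z [S [M [[St Sp] lM ->]]]].
pose c : R := n.+1%:R^-1; have c0 : 0 <= c by rewrite invr_ge0.
have cn (a : R) : a = (c * a) *+ n.+1.
  by rewrite -mulr_natr mulrC mulrA /c divff ?mul1r// pnatr_eq0.
pose Mc : {measure set V -> \bar R} := mscale (NngNum c0) M.
have lMc : levy_measure Mc.
  split; first by rewrite /Mc /= /mscale lM.1 mule0.
  rewrite ge0_integral_mscale//; last 2 first.
  - by apply/measurable_EFinP; exact: measurable_sqtrunc.
  - by move=> x _; rewrite lee_fin sqtrunc_ge0.
  apply: lte_mul_pinfty => //; exact: lM.2.
exists (levy_khintchine (scalev c z) (c *: S) Mc).
  exists (scalev c z), (c *: S), Mc; split => //; split.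
    by rewrite linearZ /= St.
  by move=> y; rewrite mulmxv_scalemx inner_scaler mulr_ge0.
move=> y; rewrite !levy_khintchineE//.
rewrite mulmxv_scalemx !Rintegral_mscale; [|exact: integrable_kIm|exact: integrable_kRe].
rewrite !inner_scaler /=.
apply/eqP; rewrite eq_complex; apply/andP; split; apply/eqP.
  by rewrite raddfMn /= [LHS]cn; congr (_ *+ _); ring.
by rewrite raddfMn /= [LHS]cn; congr (_ *+ _); ring.
Qed.

(** Infinite divisibility holds because [Phi / n] is again a Levy exponent, and laws with the
    same characteristic function coincide. *)
Theorem levy_law (Phi : V -> R[i]) : levy_exponent Phi ->
  exists nu : probability V R, infinitely_divisible nu /\ levy_exponent_of nu Phi.
Proof.
move=> lPhi; have [nu nuE] := is_charfun_levy lPhi; exists nu; split=> // -[//|n] _.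
have [Psi lPsi PsiE] := levy_exponent_root n lPhi.
have [mu muE] := is_charfun_levy lPsi; exists mu; apply: charfun_inj => y.
by rewrite nuE charfun_power muE -expCMn PsiE.
Qed.

End levy_laws.

(** * Random integrals, image measures and Fubini *)

Section random_integral_law.
Context {R : realType} {d : nat}.
Local Notation V := (d.-tuple R).

(** A law has at most one Levy exponent, so whichever law is chosen among the [ri_laws], its
    exponent is the one computed from [Phi]. *)
Lemma random_integralP (a : R) (b : \bar R) (h : R -> R) (rho : set R -> \bar R)
    (nu : probability V R) (Phi : V -> R[i]) :
  levy_exponent_of nu Phi -> levy_exponent (ri_exponent a b h rho Phi) ->
  infinitely_divisible (random_integral a b h rho nu) /\
  levy_exponent_of (random_integral a b h rho nu) (ri_exponent a b h rho Phi).
Proof.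
move=> nuPhi lI; rewrite /random_integral; case: xgetP => [mu _ [idmu [Psi nuPsi muPsi]]|none].
  split=> //; have -> // : Phi = Psi.
  apply: (levy_exponent_inj nuPhi.1 nuPsi.1) => y.
  by rewrite -nuPhi.2 nuPsi.2.
by have [mu [idmu muI]] := levy_law lI; have := none mu; case; split=> //; exists Phi.
Qed.

End random_integral_law.

Section image_measure.
Context {d1 d2 : measure_display} {T1 : measurableType d1} {T2 : measurableType d2}
  {R : realType} (m : {measure set T1 -> \bar R}) (f : T1 -> T2).

(** The pushforward, carrying the measurability that makes it a measure. *)
Definition image_measure of measurable_fun setT f : set T2 -> \bar R := pushforward m f.

Variable mf : measurable_fun setT f.

Let image0 : image_measure mf set0 = 0%E.
Proof. by rewrite /image_measure /pushforward preimage_set0 measure0. Qed.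

Let image_ge0 A : (0 <= image_measure mf A)%E.
Proof. exact: measure_ge0. Qed.

Let image_sigma_additive : semi_sigma_additive (image_measure mf).
Proof.
have mpre A : measurable A -> measurable (f @^-1` A).
  by move=> mA; rewrite -[X in measurable X]setTI; exact: mf.
move=> F mF tF mUF; rewrite /image_measure /pushforward preimage_bigcup.
apply: measure_semi_sigma_additive.
- by move=> n; exact: mpre.
- apply/trivIsetP => /= i j _ _ ij; rewrite -preimage_setI.
  by move/trivIsetP : tF => /(_ _ _ _ _ ij) ->//; rewrite preimage_set0.
- by rewrite -preimage_bigcup; exact: mpre.
Qed.

HB.instance Definition _ := isMeasure.Build _ _ _ (image_measure mf)
  image0 image_ge0 image_sigma_additive.

Lemma Rintegral_image (g : T2 -> R) : measurable_fun setT g ->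
  m.-integrable setT (EFin \o (g \o f)) ->
  \int[image_measure mf]_x g x = \int[m]_x g (f x).
Proof.
move=> mg ig; have mg' : measurable_fun setT (EFin \o g) by exact/measurable_EFinP.
rewrite /Rintegral; congr fine.
exact: (@integral_pushforward _ _ _ _ _ f mf m setT (EFin \o g) mg' ig measurableT).
Qed.

Lemma ge0_integral_image (g : T2 -> \bar R) : measurable_fun setT g ->
  (forall x, (0 <= g x)%E) ->
  (\int[image_measure mf]_x g x = \int[m]_x g (f x))%E.
Proof. by move=> mg g0; apply: (ge0_integral_pushforward mf). Qed.

Lemma integrable_image_inv (g : T2 -> R) : measurable_fun setT g ->
  (image_measure mf).-integrable setT (EFin \o g) -> m.-integrable setT (EFin \o (g \o f)).
Proof.
move=> mg /integrableP[_ ig]; apply/integrableP; split.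
  by apply/measurable_EFinP; exact: measurableT_comp.
by move: ig; rewrite ge0_integral_image//; apply: measurableT_comp => //; exact/measurable_EFinP.
Qed.

End image_measure.

Section fubini_real.
Context {d1 d2 : measure_display} {T1 : measurableType d1} {T2 : measurableType d2}
  {R : realType} (m1 : {sigma_finite_measure set T1 -> \bar R})
  (m2 : {sigma_finite_measure set T2 -> \bar R}) (f : T1 * T2 -> R).
Hypothesis fi : (m1 \x m2)%E.-integrable setT (EFin \o f).

Let mf : measurable_fun setT (EFin \o f). Proof. by case/integrableP: fi. Qed.

Lemma ae_integrable_section :
  \forall x \ae m1, m2.-integrable setT (EFin \o (fun y => f (x, y))).
Proof. exact: (ae_integrable1 fi). Qed.

Lemma integrable_Rfubini : m1.-integrable setT (EFin \o (fun x => \int[m2]_y f (x, y))).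
Proof.
have mF := measurable_fubini_F fi.
have iF := integrable_fubini_F fi.
apply: le_integrable iF => //.
  apply/measurable_EFinP.
  exact: (measurableT_comp (@fine_measurable R setT measurableT) mF).
have fine_le (z : \bar R) : (`|(fine z)%:E| <= `|z|)%E.
  by case: z => [r| |] //=; rewrite normr0 leey.
by move=> x _; exact: fine_le.
Qed.

Lemma Rfubini : \int[m1]_x (\int[m2]_y f (x, y)) = \int[(m1 \x m2)%E]_p f p.
Proof.
have E : (\int[m1]_x (\int[m2]_y f (x, y))%:E = \int[(m1 \x m2)%E]_p (f p)%:E)%E.
  rewrite -[RHS](integral12_prod_meas1 fi).
  have mF := measurable_fubini_F fi.
  apply: ae_eq_integral => //.
    apply/measurable_EFinP.
    exact: (measurableT_comp (@fine_measurable R setT measurableT) mF).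
  apply: (@filterS _ _ (ae_filter_ringOfSetsType m1) _ _ _ ae_integrable_section) => x ix _.
  rewrite /fubini_F /= /Rintegral fineK//; exact: integrable_fin_num.
by rewrite [LHS]/Rintegral E.
Qed.

End fubini_real.

(** * Mixtures of a Levy exponent *)

Section product_sigma_finite.
Context {d1 d2 : measure_display} {T1 : measurableType d1} {T2 : measurableType d2} {R : realType}.
Variables (m1 : {sigma_finite_measure set T1 -> \bar R})
  (m2 : {sigma_finite_measure set T2 -> \bar R}).

Lemma product_measure_sigma_finite : sigma_finite setT (m1 \x m2)%E.
Proof.
have [F FT Ffin] := sigma_finiteT m1; have [G GT Gfin] := sigma_finiteT m2.
exists (fun k => if @unpickle (nat * nat)%type k is Some (i, j) then F i `*` G j else set0).
  apply/esym; rewrite -subTset => -[x y] _.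
  have [i _ Fx] : (\bigcup_i F i) x by rewrite -FT.
  have [j _ Gy] : (\bigcup_j G j) y by rewrite -GT.
  by exists (pickle (i, j)) => //; rewrite pickleK.
move=> k; case: unpickle => [[i j]|]; last by rewrite measure0.
have [mF Fi] := Ffin i; have [mG Gj] := Gfin j; split; first exact: measurableX.
by rewrite product_measure1E// lte_mul_pinfty// ge0_fin_numE.
Qed.

Definition sfprod : {sigma_finite_measure set (T1 * T2)%type -> \bar R} :=
  sigma_finite_copy product_measure_sigma_finite.

End product_sigma_finite.

Section scaled_kernel.
Context {R : realType} {d : nat}.
Local Notation V := (d.-tuple R).
Implicit Types (x y z : V) (s : R).

Lemma inner_scale_swap s x y : inner y (scalev s x) = inner (scalev s y) x.
Proof. by rewrite inner_scaler inner_scalel. Qed.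

Lemma measurable_scalev d' (T : measurableType d') (f : T -> R) (g : T -> V) :
  measurable_fun setT f -> measurable_fun setT g ->
  measurable_fun setT (fun t => scalev (f t) (g t)).
Proof.
move=> mf mg; apply/measurable_fun_tnthP => j.
rewrite (_ : _ \o _ = fun t => f t * tnth (g t) j); last first.
  by apply/funext => t /=; rewrite tnth_mktuple.
by apply: measurable_funM => //; exact: (measurableT_comp (measurable_tnth j)).
Qed.

Lemma kRe_scale s x y : kRe y (scalev s x) = kRe (scalev s y) x.
Proof. by rewrite /kRe inner_scale_swap. Qed.

Lemma sqtrunc_scale s x : sqtrunc (scalev s x) <= (1 + s ^+ 2) * sqtrunc x.
Proof.
rewrite /sqtrunc enorm_scale exprMn real_normK ?num_real//.
have := sqr_ge0 s; have := sqr_ge0 (enorm x); move: (enorm x ^+ 2) (s ^+ 2) => e r e0 r0.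
have re0 : 0 <= r * e by rewrite mulr_ge0.
case: (leP 1 e) => e1; first by rewrite ge_min mulr1 lerDl r0.
by rewrite ge_min; apply/orP; right; rewrite mulrDl mul1r; lra.
Qed.

Lemma sqtrunc_le_sum x : sqtrunc x <= \sum_(j < d) Num.min 1 (tnth x j ^+ 2).
Proof.
rewrite /sqtrunc enormE.
have [/existsP[j xj]|] := boolP [exists j : 'I_d, 1 <= tnth x j ^+ 2].
  rewrite ge_min; apply/orP; left.
  rewrite (bigD1 j)//= (min_idPl xj) lerDl sumr_ge0// => i _.
  by rewrite le_min ler01 sqr_ge0.
rewrite negb_exists => /forallP xlt; rewrite ge_min; apply/orP; right.
rewrite /inner; apply: ler_sum => j _; have := xlt j; rewrite -ltNge => /ltW xj.
by rewrite (min_idPr xj) expr2.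
Qed.

(** The truncation function is not homogeneous; the defect is linear in [y]. *)
Lemma kIm_defect s x y : kIm (scalev s y) x - kIm y (scalev s x)
  = \sum_(j < d) tnth y j * (kIm (scalev s (ebasis j)) x - kIm (ebasis j) (scalev s x)).
Proof.
have E w : kIm (scalev s w) x - kIm w (scalev s x)
    = inner w x * (s * ((enorm (scalev s x) <= 1)%R%:R - (enorm x <= 1)%R%:R)).
  by rewrite /kIm inner_scale_swap inner_scalel; ring.
rewrite E {1}/inner mulr_suml; apply: eq_bigr => j _.
by rewrite E inner_ebasis; ring.
Qed.

Lemma quad_bound (S : 'M[R]_d) y : covariance_mx S ->
  inner y (mulmxv S y) <= l1norm y ^+ 2 * \sum_(j < d) S j j.
Proof.
move=> cS; have [vs vsE] := psd_sum_squares cS.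
have SE j : S j j = \sum_(v <- vs) tnth v j ^+ 2.
  rewrite -mulmxv_ebasis -inner_ebasis vsE; apply: eq_bigr => v _.
  by rewrite inner_ebasis.
rewrite vsE; under [in leRHS]eq_bigr do rewrite SE.
rewrite exchange_big /= mulr_sumr; apply: ler_sum => v _.
have -> : \sum_(i < d) tnth v i ^+ 2 = enorm v ^+ 2.
  by rewrite enormE /inner; apply: eq_bigr => i _; rewrite expr2.
exact: inner_sq_le.
Qed.

End scaled_kernel.

Section mixing.
Context {R : realType} {d : nat}.
Local Notation V := (d.-tuple R).
Variables (z : V) (S : 'M[R]_d) (M : {measure set V -> \bar R}).
Hypotheses (cS : covariance_mx S) (lM : levy_measure M).
Let Ms : {sigma_finite_measure set V -> \bar R} :=
  sigma_finite_copy (levy_measure_sigma_finite lM).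
Let Phi := levy_khintchine z S M.

Context {d' : measure_display} {T : measurableType d'}.
Variables (tau : {sigma_finite_measure set T -> \bar R}) (H : T -> R).
Hypothesis mH : measurable_fun setT H.

Definition mix_exponent (F : V -> R[i]) (y : V) : R[i] :=
  Cintegral tau setT (fun t => F (scalev (H t) y)).

Definition mix_integrable (F : V -> R[i]) :=
  forall y, Cintegrable tau setT (fun t => F (scalev (H t) y)).

(** The scaled jumps [H t x] form a Levy measure, up to an atom at the origin. *)
Definition jumps_integrable :=
  (tau \x Ms)%E.-integrable setT (EFin \o (fun p => sqtrunc (scalev (H p.1) p.2))).

Definition variance_integrable :=
  forall j, tau.-integrable setT (EFin \o (fun t => H t ^+ 2 * S j j)).

Let PhiRe s y : complex.Re (Phi (scalev s y))
  = - (2^-1 * (s ^+ 2 * inner y (mulmxv S y))) + \int[M]_x kRe y (scalev s x).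
Proof.
rewrite /Phi (levy_khintchineE lM) /= mulmxv_scale inner_scalel inner_scaler mulrA -expr2.
by congr (_ + _); apply: eq_Rintegral => x _; rewrite kRe_scale.
Qed.

Let PhiIm s y : complex.Im (Phi (scalev s y)) = s * inner y z + \int[M]_x kIm (scalev s y) x.
Proof. by rewrite /Phi (levy_khintchineE lM) /= inner_scalel. Qed.

Let mscale_prod : measurable_fun setT (fun p : T * V => scalev (H p.1) p.2).
Proof. by apply: measurable_scalev => //; exact: measurableT_comp. Qed.

Let G (p : T * V) := sqtrunc (scalev (H p.1) p.2).

Let mG : measurable_fun setT G.
Proof. exact: (measurableT_comp measurable_sqtrunc). Qed.

Let mscalex s : measurable_fun setT (fun x : V => scalev s x).
Proof. exact: measurable_scalev. Qed.

(** All terms of the real part have the same sign, so its integrability controls the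
    variance. For the jumps, the real part at [s e_j] of the mixed exponent, averaged over [s]
    in [[0, 1]], dominates the truncated second moment of their [j]-th coordinate. The average
    is finite because a Levy exponent is bounded on a segment. *)
Lemma mix_levy_integrable : mix_integrable Phi -> levy_exponent (mix_exponent Phi) ->
  jumps_integrable /\ variance_integrable.
Proof.
move=> ii [z' [S' [M' [[S't S'p] lM' mixE]]]].
have kRe_le0 y x : kRe y x <= 0 by rewrite /kRe subr_le0 cos_le1.
have ikRe s y : M.-integrable setT (EFin \o (fun x => kRe y (scalev s x))).
  by under eq_fun do rewrite kRe_scale; exact: integrable_kRe.
have int_le0 s y : \int[M]_x kRe y (scalev s x) <= 0.
  rewrite -oppr_ge0 -mulN1r -RintegralZl//.
  by apply: Rintegral_ge0 => x _; rewrite mulN1r oppr_ge0 kRe_le0.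
have quad_ge0 s y : 0 <= s ^+ 2 * inner y (mulmxv S y).
  by rewrite mulr_ge0 ?sqr_ge0//; exact: cS.2.
split; last first.
  move=> j; have [iRe _] := ii (ebasis j).
  have i2 := integrableZl measurableT (2 : R) (integrable_norm iRe).
  apply: le_integrableR i2.
    by apply: measurable_funM => //; exact: measurable_funX.
  move=> t; rewrite -[leRHS]/(2 * `|complex.Re (Phi (scalev (H t) (ebasis j)))|).
  rewrite PhiRe inner_ebasis mulmxv_ebasis.
  have h1 := quad_ge0 (H t) (ebasis j); rewrite inner_ebasis mulmxv_ebasis in h1.
  have h2 := int_le0 (H t) (ebasis j).
  rewrite (ger0_norm h1) ler0_norm; last by move: h1 h2; lra.
  by move: h1 h2; lra.
pose F j (p : T * V) := H p.1 * tnth p.2 j.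
have mF j : measurable_fun setT (F j).
  apply: measurable_funM; first exact: measurableT_comp.
  by apply: (measurableT_comp (measurable_tnth j)).
have bound j : exists C : R, (\int[(tau \x Ms)%E]_p (Num.min 1 (F j p ^+ 2) / 24)%:E <= C%:E)%E.
  exists (2^-1 * S' j j + kbound (ebasis j) * \int[M']_x sqtrunc x).
  apply: le_trans (averaged_one_subcos (sfprod tau Ms) (mF j)) _.
  have mc := measurable_one_subcos (mF j).
  have c0 (p : R * (T * V)) : (0 <= (1 - cos (p.1 * F j p.2))%:E)%E.
    by rewrite lee_fin subr_ge0 cos_le1.
  apply: unit_law_integral_le.
  - apply: (@measurable_fun_fubini_tonelli_F _ _ _ _ _ (sfprod tau Ms) _ mc c0).
  - by move=> s; apply: integral_ge0 => p _; rewrite lee_fin subr_ge0 cos_le1.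
  move=> s s01; pose y : V := scalev s (ebasis j).
  have msc : measurable_fun setT (fun p : T * V => (1 - cos (s * F j p))%:E).
    apply/measurable_EFinP; apply: measurable_funB => //.
    apply: measurableT_comp; first by apply: continuous_measurable_fun; exact: continuous_cos.
    exact: measurable_funM.
  have sc0 (p : T * V) : (0 <= (1 - cos (s * F j p))%:E)%E.
    by rewrite lee_fin subr_ge0 cos_le1.
  rewrite (fubini_tonelli1 (m1 := tau) (m2 := Ms) _ msc sc0).
  have [iRe _] := ii y.
  have iN : tau.-integrable setT (EFin \o (fun t => - complex.Re (Phi (scalev (H t) y)))).
    exact: (integrableN iRe).
  apply: (@le_trans _ _ (\int[tau]_t (- complex.Re (Phi (scalev (H t) y)))%:E)%E).
    apply: ge0_le_integral => //.
    - by move=> t _; apply: integral_ge0 => x _.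
    - exact: (measurable_fun_fubini_tonelli_F (m2 := Ms) _ msc sc0).
    - by case/integrableP: iN.
    move=> t _; rewrite /fubini_F /=.
    have -> : (\int[Ms]_x (1 - cos (s * F j (t, x)))%:E = (- \int[M]_x kRe y (scalev (H t) x))%:E)%E.
      rewrite -mulN1r -RintegralZl// /Rintegral fineK.
        apply: eq_integral => x _; rewrite mulN1r /kRe opprB /F /y.
        by rewrite inner_scalel inner_ebasis tnth_mktuple.
      apply: integrable_fin_num => //.
      exact: (integrableZl measurableT (-1) (ikRe (H t) y)).
    rewrite -[leRHS]/((- complex.Re (Phi (scalev (H t) y)))%:E) lee_fin PhiRe opprD opprK.
    by rewrite lerDr mulr_ge0.
  have -> : (\int[tau]_t (- complex.Re (Phi (scalev (H t) y)))%:E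
      = (- complex.Re (mix_exponent Phi y))%:E)%E.
    rewrite -[RHS]/((- \int[tau]_t complex.Re (Phi (scalev (H t) y)))%:E).
    rewrite -mulN1r -RintegralZl// /Rintegral fineK.
      by apply: eq_integral => t _; rewrite mulN1r.
    apply: integrable_fin_num => //.
    exact: (integrableZl measurableT (-1) iRe).
  rewrite lee_fin mixE (levy_khintchineE lM') /= /y mulmxv_scale inner_scalel inner_scaler.
  rewrite inner_ebasis mulmxv_ebasis opprD opprK.
  have S'j : 0 <= S' j j by have := S'p (ebasis j); rewrite inner_ebasis mulmxv_ebasis.
  have [s0 s1] := andP s01.
  apply: lerD.
    rewrite ler_wpM2l// mulrA -expr2 ler_piMl// exprn_ile1//.
  apply: le_trans (ler_norm _) _; rewrite normrN.
  apply: le_trans (le_normr_Rintegral measurableT (integrable_kRe lM' _)) _.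
  rewrite -RintegralZl//; last exact: integrable_sqtrunc.
  apply: le_Rintegral => //.
  - exact: integrable_norm (integrable_kRe lM' _).
  - exact: integrable_sqtruncZ.
  - move=> x _; apply: le_trans (kRe_bound _ _) _.
    rewrite ler_wpM2r ?sqtrunc_ge0//.
    have := @kbound_scale _ _ s 1 (ebasis j); rewrite scalev1; apply.
    by rewrite ger0_norm.
have /choice[B BP] := bound.
have iF j : (tau \x Ms)%E.-integrable setT (EFin \o (fun p => Num.min 1 (F j p ^+ 2))).
  have mm : measurable_fun setT (fun p => Num.min 1 (F j p ^+ 2)).
    by apply: measurable_minr => //; exact: measurable_funX.
  have i24 : (tau \x Ms)%E.-integrable setT (EFin \o (fun p => Num.min 1 (F j p ^+ 2) / 24)).
    apply/integrableP; split; first by apply/measurable_EFinP; exact: measurable_funM.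
    apply: le_lt_trans (ltry (B j)); apply: le_trans _ (BP j).
    rewrite le_eqVlt; apply/orP; left; apply/eqP; apply: eq_integral => p _ /=.
    by rewrite ger0_norm// divr_ge0// le_min ler01 sqr_ge0.
  apply: eq_integrable (integrableZl measurableT 24 i24) => // p _ /=.
  by rewrite -EFinM; congr EFin; field.
have iS : (tau \x Ms)%E.-integrable setT (EFin \o (fun p => \sum_(j < d) Num.min 1 (F j p ^+ 2))).
  have := @integrable_sum _ _ _ (tau \x Ms)%E _ measurableT _ (index_enum 'I_d) xpredT _ (fun j _ => iF j).
  by apply: eq_integrable => // p _ /=; rewrite sumEFin.
apply: le_integrableR iS => //.
move=> p; rewrite ger0_norm ?sqtrunc_ge0//.
apply: le_trans (sqtrunc_le_sum _) _; apply: ler_sum => j _.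
by rewrite tnth_mktuple.
Qed.


(** What is left of the imaginary part when the scaled jumps are compensated afresh. *)
Let drift y t := complex.Im (Phi (scalev (H t) y)) - \int[M]_x kIm y (scalev (H t) x).

Let integrable_kImZ s y : M.-integrable setT (EFin \o (fun x => kIm y (scalev s x))).
Proof.
apply: le_integrableR (integrable_sqtruncZ lM (kbound y * (1 + s ^+ 2))).
  exact: (measurableT_comp (measurable_kIm y) (mscalex s)).
move=> x; apply: le_trans (kIm_bound _ _) _; rewrite -mulrA ler_wpM2l ?sqtrunc_scale//.
by rewrite addr_ge0 ?sqr_ge0.
Qed.

(** The drift is a linear form in [y], so that it is integrable as soon as it is on the
    basis. *)
Let drift_linear y t : drift y t = \sum_(j < d) tnth y j * drift (ebasis j) t.
Proof.
have E w : drift w t = H t * inner w z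
    + \int[M]_x (kIm (scalev (H t) w) x - kIm w (scalev (H t) x)).
  by rewrite /drift PhiIm RintegralB// ?addrA//; exact: integrable_kIm.
have iD w : M.-integrable setT
    (EFin \o (fun x => kIm (scalev (H t) w) x - kIm w (scalev (H t) x))).
  by apply: (integrableB measurableT (integrable_kIm lM _) (integrable_kImZ (H t) w)).
rewrite E; under eq_Rintegral do rewrite kIm_defect.
rewrite Rintegral_sum => [|j]; last exact: (integrableZl measurableT (tnth y j) (iD (ebasis j))).
under [X in _ + X]eq_bigr do rewrite RintegralZl//.
rewrite {1}/inner mulr_sumr -big_split/=; apply: eq_bigr => j _.
by rewrite E inner_ebasis mulrDr mulrCA.
Qed.

Section integrable_jumps.
Hypotheses (jH : jumps_integrable) (vH : variance_integrable).

Let igRe y : (tau \x Ms)%E.-integrable setT (EFin \o (fun p => kRe y (scalev (H p.1) p.2))).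
Proof.
apply: le_integrableR (integrableZl measurableT (kbound y) jH).
  exact: (measurableT_comp (measurable_kRe y) mscale_prod).
by move=> p; exact: kRe_bound.
Qed.

Let igIm y : (tau \x Ms)%E.-integrable setT (EFin \o (fun p => kIm y (scalev (H p.1) p.2))).
Proof.
apply: le_integrableR (integrableZl measurableT (kbound y) jH).
  exact: (measurableT_comp (measurable_kIm y) mscale_prod).
by move=> p; exact: kIm_bound.
Qed.

Let iquad y : tau.-integrable setT (EFin \o (fun t => H t ^+ 2 * inner y (mulmxv S y))).
Proof.
have iS : tau.-integrable setT (EFin \o (fun t => \sum_(j < d) H t ^+ 2 * S j j)).
  have := @integrable_sum _ _ _ tau _ measurableT _ (index_enum 'I_d) xpredT _ (fun j _ => vH j).
  by apply: eq_integrable => // p _ /=; rewrite sumEFin.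
apply: le_integrableR (integrableZl measurableT (l1norm y ^+ 2) iS).
  by apply: measurable_funM => //; exact: measurable_funX.
move=> t; rewrite ger0_norm; last by apply: mulr_ge0; [exact: sqr_ge0|exact: cS.2].
by rewrite -mulr_sumr mulrCA ler_wpM2l ?sqr_ge0//; exact: quad_bound.
Qed.

Let ijRe y := integrable_Rfubini (igRe y).
Let ijIm y := integrable_Rfubini (igIm y).

(** Jumps and variance control everything but the drift, which is linear. *)
Lemma jumps_mix_integrable :
  (forall j, tau.-integrable setT
     (EFin \o (fun t => complex.Im (Phi (scalev (H t) (ebasis j)))))) ->
  mix_integrable Phi.
Proof.
move=> iIm y; split.
  under eq_fun do rewrite PhiRe.
  have := integrableD measurableT (integrableZl measurableT (- 2^-1) (iquad y)) (ijRe y).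
  by apply: eq_integrable => // t _; rewrite /comp/= -EFinM -EFinD mulNr.
have idr j : tau.-integrable setT (EFin \o (fun t => tnth y j * drift (ebasis j) t)).
  have i1 : tau.-integrable setT (EFin \o drift (ebasis j)).
    exact: (integrableB measurableT (iIm j) (ijIm (ebasis j))).
  exact: (integrableZl measurableT (tnth y j) i1).
have iD : tau.-integrable setT (EFin \o drift y).
  have := @integrable_sum _ _ _ tau _ measurableT _ (index_enum 'I_d) xpredT _ (fun j _ => idr j).
  by apply: eq_integrable => // t _ /=; rewrite drift_linear sumEFin.
have := integrableD measurableT iD (ijIm y).
by apply: eq_integrable => // t _ /=; rewrite -EFinD /drift subrK.
Qed.

(** The triplet of the mixture: the integrated drift, the covariance scaled by the second
    moment of [H], and the image of [tau x M] under [(t, x) |-> H t x], which does not charge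
    the origin since [H] does not vanish. *)
Lemma jumps_mix_exponent : (forall t, H t != 0) -> mix_integrable Phi ->
  levy_exponent (mix_exponent Phi).
Proof.
move=> H0 ii.
(* If the second moment of [H] is infinite then [S] is zero on the diagonal, hence zero, and
   the default value 0 of the integral does no harm. *)
pose c2 := \int[tau]_t (H t ^+ 2).
have c2_ge0 : 0 <= c2 by apply: Rintegral_ge0 => t _; exact: sqr_ge0.
have c2E y : \int[tau]_t (H t ^+ 2 * inner y (mulmxv S y)) = c2 * inner y (mulmxv S y).
  have [/existsP[j Sj]|] := boolP [exists j, S j j != 0].
    rewrite RintegralZr//.
    have := integrableZl measurableT ((S j j)^-1) (vH j).
    by apply: eq_integrable => // t _ /=; rewrite -EFinM; congr EFin; field.
  rewrite negb_exists => /forallP S0.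
  have -> : inner y (mulmxv S y) = 0.
    apply/eqP; rewrite eq_le cS.2 andbT; apply: le_trans (quad_bound y cS) _.
    rewrite big1 ?mulr0// => j _; apply/eqP; move: (S0 j); rewrite negbK//.
  by rewrite mulr0; under eq_Rintegral do rewrite mulr0; rewrite Rintegral_cst// mul0r.
have idr j : tau.-integrable setT (EFin \o drift (ebasis j)).
  exact: (integrableB measurableT (ii (ebasis j)).2 (ijIm (ebasis j))).
pose z' : V := [tuple \int[tau]_t drift (ebasis j) t | j < d].
pose M' := image_measure (tau \x Ms)%E mscale_prod.
have lM' : levy_measure M'.
  split.
    have E : (fun p : T * V => scalev (H p.1) p.2) @^-1` [set zerov] = setT `*` [set zerov].
      rewrite eqEsubset; split=> -[t x] /=; last first.
        by move=> [_ ->]; apply: eq_from_tnth => j; rewrite !tnth_mktuple mulr0.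
      move=> /eqP; rewrite -enorm_eq0 enorm_scale mulf_eq0 normr_eq0 (negbTE (H0 t)) /=.
      by rewrite enorm_eq0 => /eqP.
    apply: etrans (congr1 (tau \x Ms)%E E) _.
    rewrite product_measure1E//; last exact: measurable_zerov.
    by rewrite [X in (_ * X)%E](lM.1) mule0.
  rewrite (ge0_integral_image _ mscale_prod).
  - have /integrableP[_] := jH.
    apply: le_lt_trans; rewrite le_eqVlt; apply/orP; left; apply/eqP.
    by apply: eq_integral => p _ /=; rewrite ger0_norm ?sqtrunc_ge0.
  - by apply/measurable_EFinP; exact: measurable_sqtrunc.
  - by move=> x; rewrite lee_fin; exact: sqtrunc_ge0.
have qE y : inner y (mulmxv (c2 *: S) y) = c2 * inner y (mulmxv S y).
  by rewrite mulmxv_scalemx inner_scaler.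
exists z', (c2 *: S), M'; split=> //.
  split=> [|y]; first by rewrite linearZ /= cS.1.
  by rewrite qE mulr_ge0//; exact: cS.2.
apply/funext => y; rewrite (levy_khintchineE lM').
have fub (k : V -> V -> R) : (forall w, measurable_fun setT (k w)) ->
    (forall w, (tau \x Ms)%E.-integrable setT (EFin \o (fun p => k w (scalev (H p.1) p.2)))) ->
    \int[M']_x k y x = \int[tau]_t (\int[M]_x k y (scalev (H t) x)).
  move=> mk ik; rewrite (@Rintegral_image _ _ _ _ _ _ _ mscale_prod _ (mk y) (ik y)).
  by rewrite -(Rfubini (ik y)).
rewrite (fub kRe)//; last exact: measurable_kRe.
rewrite (fub kIm)//; last exact: measurable_kIm.
have -> : inner y z' = \int[tau]_t drift y t.
  under [RHS]eq_Rintegral do rewrite drift_linear.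
  rewrite Rintegral_sum => [|j]; last exact: (integrableZl measurableT (tnth y j) (idr j)).
  by apply: eq_bigr => j _; rewrite tnth_mktuple RintegralZl.
rewrite qE.
apply/eqP; rewrite eq_complex; apply/andP; split; apply/eqP.
  rewrite -[LHS]/(\int[tau]_t complex.Re (Phi (scalev (H t) y))).
  under eq_Rintegral do rewrite PhiRe.
  rewrite RintegralD//; last 2 first.
  - have := integrableZl measurableT (- 2^-1) (iquad y).
    by apply: eq_integrable => // t _; rewrite /comp/= -EFinM mulNr.
  - exact: ijRe.
  rewrite /=; congr (_ + _).
  rewrite -c2E -mulNr -RintegralZl//.
  by apply: eq_Rintegral => t _; rewrite mulNr.
rewrite -[LHS]/(\int[tau]_t complex.Im (Phi (scalev (H t) y))).
rewrite -[RHS]/(\int[tau]_t drift y t + \int[tau]_t (\int[M]_x kIm y (scalev (H t) x))).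
have i1 : tau.-integrable setT (EFin \o drift y).
  exact: (integrableB measurableT (ii y).2 (ijIm y)).
rewrite -(RintegralD measurableT i1 (ijIm y)).
by apply: eq_Rintegral => t _; rewrite subrK.
Qed.

End integrable_jumps.

End mixing.

(** * Mixtures over a product space *)

Section product_mixing.
Context {R : realType} {d : nat} {d1 d2 : measure_display} {T1 : measurableType d1}
  {T2 : measurableType d2}.
Local Notation V := (d.-tuple R).
Variables (tau1 : {sigma_finite_measure set T1 -> \bar R})
  (tau2 : {sigma_finite_measure set T2 -> \bar R}) (H1 : T1 -> R) (H2 : T2 -> R) (F : V -> R[i]).
Let H12 (p : T1 * T2) := H1 p.1 * H2 p.2.

Lemma mix_exponent_prod : mix_integrable (sfprod tau1 tau2) H12 F ->
  mix_integrable tau1 H1 (mix_exponent tau2 H2 F) /\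
  mix_exponent tau1 H1 (mix_exponent tau2 H2 F) = mix_exponent (sfprod tau1 tau2) H12 F.
Proof.
move=> ii.
have E y t s : F (scalev (H2 s) (scalev (H1 t) y)) = F (scalev (H12 (t, s)) y).
  by rewrite scalevA mulrC.
have ReE y t : complex.Re (mix_exponent tau2 H2 F (scalev (H1 t) y))
    = \int[tau2]_s complex.Re (F (scalev (H12 (t, s)) y)).
  by apply: eq_Rintegral => s _; rewrite E.
have ImE y t : complex.Im (mix_exponent tau2 H2 F (scalev (H1 t) y))
    = \int[tau2]_s complex.Im (F (scalev (H12 (t, s)) y)).
  by apply: eq_Rintegral => s _; rewrite E.
split=> [y|].
  split.
  - by under eq_fun do rewrite ReE; exact: (integrable_Rfubini (ii y).1).
  - by under eq_fun do rewrite ImE; exact: (integrable_Rfubini (ii y).2).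
apply/funext => y; apply/eqP; rewrite eq_complex; apply/andP; split; apply/eqP.
- by apply: etrans (Rfubini (ii y).1); apply: eq_Rintegral => t _; exact: ReE.
- by apply: etrans (Rfubini (ii y).2); apply: eq_Rintegral => t _; exact: ImE.
Qed.

Lemma mix_integrable_rescale (k : R) : k != 0 ->
  mix_integrable tau1 (fun t => k * H1 t) F -> mix_integrable tau1 H1 F.
Proof.
move=> k0 ii y; have := ii (scalev k^-1 y); rewrite /Cintegrable.
have E t : scalev (k * H1 t) (scalev k^-1 y) = scalev (H1 t) y.
  by rewrite scalevA mulrAC mulfV// mul1r.
by under eq_fun do rewrite E; under [X in _ /\ _.-integrable _ X]eq_fun do rewrite E.
Qed.

End product_mixing.

Section regular_mixing.
Context {R : realType} {d : nat}.
Local Notation V := (d.-tuple R).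
Variables (z : V) (S : 'M[R]_d) (M : {measure set V -> \bar R}).
Hypotheses (cS : covariance_mx S) (lM : levy_measure M).
Let Ms : {sigma_finite_measure set V -> \bar R} :=
  sigma_finite_copy (levy_measure_sigma_finite lM).
Let Phi := levy_khintchine z S M.

(** Convergence of the mixed exponent together with that of its jump and Gaussian parts. The
    latter two are positive, so that they pass to the factors of a product by Tonelli. *)
Definition regular_mixing {d'} {T : measurableType d'}
    (tau : {sigma_finite_measure set T -> \bar R}) (H : T -> R) :=
  [/\ mix_integrable tau H Phi, jumps_integrable lM tau H & variance_integrable S tau H].

Section one_factor.
Context {d' : measure_display} {T : measurableType d'}.
Variables (tau : {sigma_finite_measure set T -> \bar R}) (H : T -> R).
Hypothesis mH : measurable_fun setT H.

Lemma measurable_mix_scalev : measurable_fun setT (fun p : T * V => scalev (H p.1) p.2).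
Proof. by apply: measurable_scalev => //; exact: measurableT_comp. Qed.

Lemma integrable_sqtrunc_scale s :
  M.-integrable setT (EFin \o (fun x => sqtrunc (scalev s x))).
Proof.
apply: le_integrableR (integrable_sqtruncZ lM (1 + s ^+ 2)).
  by apply: (measurableT_comp measurable_sqtrunc); exact: measurable_scalev.
by move=> x; rewrite ger0_norm ?sqtrunc_ge0//; exact: sqtrunc_scale.
Qed.

Lemma jumps_integrableP : jumps_integrable lM tau H <->
  tau.-integrable setT (EFin \o (fun t => \int[M]_x sqtrunc (scalev (H t) x))).
Proof.
split=> [jH|iK]; first exact: (integrable_Rfubini jH).
have mG := measurableT_comp measurable_sqtrunc measurable_mix_scalev.
apply/(integrable12ltyP tau Ms); first exact/measurable_EFinP.
case/integrableP: iK => _; apply: le_lt_trans; rewrite le_eqVlt; apply/orP; left; apply/eqP.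
apply: eq_integral => t _ /=.
rewrite ger0_norm; last by apply: Rintegral_ge0 => x _; exact: sqtrunc_ge0.
rewrite /Rintegral fineK; last by apply: integrable_fin_num => //; exact: integrable_sqtrunc_scale.
by apply: eq_integral => x _; rewrite ger0_norm ?sqtrunc_ge0.
Qed.

Lemma regular_mixing_rescale (k : R) : k != 0 ->
  regular_mixing tau (fun t => k * H t) -> regular_mixing tau H.
Proof.
move=> k0 [ii jj vv]; split.
- exact: mix_integrable_rescale k0 ii.
- apply: le_integrableR (integrableZl measurableT (1 + k^-1 ^+ 2) jj).
    exact: (measurableT_comp measurable_sqtrunc measurable_mix_scalev).
  move=> p; rewrite ger0_norm ?sqtrunc_ge0//.
  apply: le_trans (sqtrunc_scale k^-1 (scalev (k * H p.1) p.2)).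
  by rewrite scalevA mulrA mulVf// mul1r.
- move=> j; have := integrableZl measurableT (k^-1 ^+ 2) (vv j).
  by apply: eq_integrable => // t _; rewrite /comp/= -EFinM; congr EFin; field.
Qed.

End one_factor.

Lemma ae_exists d' (T : measurableType d') (tau : {measure set T -> \bar R}) (P : T -> Prop) :
  (0 < tau setT)%E -> (\forall t \ae tau, P t) -> exists t, P t.
Proof.
move=> tau0 [A [mA A0 PA]]; apply: contrapT => nP.
have AT : A = setT.
  by apply/seteqP; split=> // t _; apply: PA => Pt; apply: nP; exists t.
by move: tau0; rewrite -AT A0 ltxx.
Qed.

Section two_factors.
Context {d1 d2 : measure_display} {T1 : measurableType d1} {T2 : measurableType d2}.
Variables (tau1 : {sigma_finite_measure set T1 -> \bar R})
  (tau2 : {sigma_finite_measure set T2 -> \bar R}) (H1 : T1 -> R) (H2 : T2 -> R).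
Hypotheses (mH1 : measurable_fun setT H1) (mH2 : measurable_fun setT H2).
Let H12 (p : T1 * T2) := H1 p.1 * H2 p.2.

Let mH12 : measurable_fun setT H12.
Proof. by apply: measurable_funM; exact: measurableT_comp. Qed.

(** By Fubini almost every section is regular for the integrand [H1 t * H2]; one such [t]
    suffices, because a regular mixing stays regular when its integrand is rescaled. *)
Lemma regular_mixing_snd : (0 < tau1 setT)%E -> (forall t, H1 t != 0) ->
  regular_mixing (sfprod tau1 tau2) H12 -> regular_mixing tau2 H2.
Proof.
move=> tau1_gt0 H1_neq0 [ii jj vv].
have aeF := ae_filter_ringOfSetsType tau1.
have ae1 := ae_integrable_section ((jumps_integrableP _ mH12).1 jj).
have ae2 := @filter_forall _ _ _ _ aeF (fun j => ae_integrable_section (vv j)).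
have ae3 := @filter_forall _ _ _ _ aeF (fun j => ae_integrable_section (ii (ebasis j)).2).
have [t [[t1 t2] t3]] := ae_exists tau1_gt0 (@filterI _ _ aeF _ _ (@filterI _ _ aeF _ _ ae1 ae2) ae3).
have mk : measurable_fun setT (fun s => H1 t * H2 s) by exact: measurable_funM.
have jk : jumps_integrable lM tau2 (fun s => H1 t * H2 s) by apply/jumps_integrableP.
apply: (regular_mixing_rescale mH2 (H1_neq0 t)); split=> //.
exact: (jumps_mix_integrable cS mk jk t2 t3).
Qed.

End two_factors.

End regular_mixing.

(** * Measures given by a time change *)

Section time_change_measure.
Context {R : realType}.
Implicit Types (a : R) (b : \bar R).

Lemma measurable_oc_itv a b : measurable (oc_itv a b).
Proof.
case: b => [b| |].
- rewrite (_ : oc_itv a _ = `]a, b]%classic); first exact: measurable_itv.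
  apply/seteqP; split=> t; rewrite /oc_itv /= in_itv /= lee_fin; first by move=> [-> ->].
  by move=> /andP[].
- rewrite (_ : oc_itv a _ = `]a, +oo[%classic); first exact: measurable_itv.
  apply/seteqP; split=> t; rewrite /oc_itv /= in_itv /= andbT; first by case.
  by move=> ->; split=> //; exact: leey.
- rewrite (_ : oc_itv a _ = set0)//; apply/seteqP; split=> t // [_].
  by rewrite leeNy_eq.
Qed.

Lemma oc_itv_nonempty a b : (a%:E < b)%E -> exists t, oc_itv a b t.
Proof.
case: b => [b| |]; rewrite ?lte_fin => ab; last by [].
- by exists b; split=> //=.
- by exists (a + 1); split; [rewrite ltrDl|rewrite leey].
Qed.

(** Exhaust the interval by compact pieces, on which the mass is a difference of values of
    the time change. *)
Lemma increments_sigma_finite a b (r : R -> R) (rho : {measure set R -> \bar R}) :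
  (a%:E < b)%E -> increments_of a b r rho ->
  sigma_finite setT (mrestr rho (measurable_oc_itv a b)).
Proof.
move=> ab inc.
pose T n : R := if b is b'%:E then b' else a + 1 + n%:R.
pose S n : R := a + (T 0 - a) / n.+2%:R.
have T0 : a < T 0%N.
  by rewrite /T; case: (b) ab => [b'| |]//; rewrite addr0 ltrDl.
have Tmono n : T 0%N <= T n.
  by rewrite /T; case: (b) => // [|]; rewrite lerD2l.
have Tb n : ((T n)%:E <= b)%E.
  by rewrite /T; case: (b) ab => [b'| |]//= _; rewrite leey.
have aS n : a < S n by rewrite /S ltrDl divr_gt0// subr_gt0.
have ST n : S n < T n.
  apply: lt_le_trans (Tmono n).
  have h : (T 0%N - a) / n.+2%:R < (T 0%N - a) / 1.
    by rewrite ltr_pM2l ?subr_gt0// ltf_pV2 ?posrE// ltr1n.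
  by rewrite /S -ltrBrDl -[ltRHS]divr1.
have ocT n : oc_itv a b (T n) by split=> //; exact: lt_trans (ST n).
have ocS n : oc_itv a b (S n).
  by split=> //; apply: le_trans (Tb n); rewrite lee_fin ltW.
have big x : a < x -> exists n, S n < x /\ x < a + 1 + n%:R.
  move=> ax; pose u := (T 0%N - a) / (x - a) + `|x - a|.
  pose n := Num.truncn u; have un : u < n.+1%:R by exact: truncnS_gt.
  exists n; have xa : 0 < x - a by rewrite subr_gt0.
  have h : x - a <= `|x - a| by exact: ler_norm.
  have q0 : 0 <= (T 0%N - a) / (x - a).
    by apply: divr_ge0; rewrite subr_ge0; exact: ltW.
  have n0 : 0 <= `|x - a| by [].
  split; last by move: un h q0; rewrite /u -(addn1 n) natrD; lra.
  rewrite /S -ltrBrDl ltr_pdivrMr// mulrC -ltr_pdivrMr//.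
  by apply: le_lt_trans (lt_trans un _); [rewrite /u lerDl|rewrite ltr_nat].
pose B : set R := if b is b'%:E then [set b'] else set0.
have mB : measurable B by rewrite /B; case: (b).
case: inc => [[_ inc]|[_ inc inc_b]].
- exists (fun n => ~` oc_itv a b `|` `]S n, T n]%classic).
    apply/esym; rewrite -subTset => x _; have [xab|nab] := pselect (oc_itv a b x); last by exists 0%N => //; left.
    have [n [Sx xn]] := big x xab.1; exists n => //; right => /=; rewrite in_itv /= Sx /=.
    by move: xab.2; rewrite /T; case: (b) ab => [b'| |] // _ _; exact: ltW.
  move=> n; split.
    by apply: measurableU => //; apply: measurableC; exact: measurable_oc_itv.
  rewrite /mrestr setIUl setICl set0U.
  apply: (@le_lt_trans _ _ (rho `]S n, T n]%classic)).
    by apply: le_measure; rewrite ?inE//; apply: measurableI => //; exact: measurable_oc_itv.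
  by rewrite inc ?ltry//; exact: ltW.
exists (fun n => ~` oc_itv a b `|` (`[S n, T n[%classic `|` B)).
  apply/esym; rewrite -subTset => x _; have [xab|nab] := pselect (oc_itv a b x); last by exists 0%N => //; left.
  have [n [Sx xn]] := big x xab.1; exists n => //; right; rewrite /B /=.
  move: xab.2; rewrite /T in_itv /= (ltW Sx) /=.
  case: (b) ab => [b'| |] // _ => [|_]; last by left.
  by rewrite lee_fin le_eqVlt => /orP[/eqP ->|->]; [right|left].
move=> n; split.
  apply: measurableU; last exact: measurableU.
  by apply: measurableC; exact: measurable_oc_itv.
rewrite /mrestr setIUl setICl set0U.
apply: (@le_lt_trans _ _ (rho (`[S n, T n[%classic `|` B))).
  apply: le_measure; rewrite ?inE//; first apply: measurableI => //; last exact: measurableU.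
    exact: measurableU.
  exact: measurable_oc_itv.
apply: le_lt_trans (measureU2 _ _ _) _ => //.
apply: lte_add_pinfty.
  by rewrite [X in (X < _)%E](inc _ _ (ocS n) (ocT n) (ltW (ST n))) ltry.
rewrite /B; case: (b) inc_b => [b'| |] inc_b; rewrite ?measure0//.
by apply: le_lt_trans (inc_b b' erefl) _; exact: ltry.
Qed.

End time_change_measure.

(** * Nested products of one-dimensional measures *)

Section rectangles.
Context {R : realType} {m : nat}.
Local Notation W := (m.-tuple R).

Definition rect (A : 'I_m -> set R) : set W := [set t | forall i, A i (tnth t i)].

Lemma measurable_rect A : (forall i, measurable (A i)) -> measurable (rect A).
Proof.
move=> mA; have -> : rect A = \bigcap_(i in [set: 'I_m]) ((fun t : W => tnth t i) @^-1` A i).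
  by apply/seteqP; split=> t h i; have := h i; last apply.
apply: fin_bigcap_measurable => // i _.
by have := measurable_tnth i measurableT (mA i); rewrite setTI.
Qed.

Let rects : set (set W) := [set B | exists2 A, (forall i, measurable (A i)) & B = rect A].

Let rects_generate : measurable = <<s rects >> :> set (set W).
Proof.
rewrite eqEsubset; split; last first.
  apply: smallest_sub; first exact: sigma_algebra_measurable.
  by move=> _ [A mA ->]; exact: measurable_rect.
have mid : measurable_fun setT (id : g_sigma_algebraType rects -> W).
  apply/measurable_fun_tnthP => j _ A mA; rewrite setTI.
  apply: sub_sigma_algebra; exists (fun i => if i == j then A else setT).
    by move=> i; case: ifP.
  apply/seteqP; split=> t h /=; last by have := h j; rewrite eqxx.
  by move=> i; case: eqVneq => [->|].
by move=> A mA; have := mid measurableT A mA; rewrite setTI.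
Qed.

Lemma rect_unique (mu nu : {measure set W -> \bar R}) (F : 'I_m -> nat -> set R) :
  (forall i n, measurable (F i n)) -> (forall i, {homo F i : n k / (n <= k)%N >-> n `<=` k}) ->
  (forall i, \bigcup_n F i n = setT) -> (forall n, mu (rect (F^~ n)) < +oo)%E ->
  (forall A, (forall i, measurable (A i)) -> mu (rect A) = nu (rect A)) ->
  forall B, measurable B -> mu B = nu B.
Proof.
move=> mF Fmono Fcover Ffin muE; apply: (measure_unique rects (fun n => rect (F^~ n))) => //.
- move=> _ _ [A mA ->] [B mB ->]; exists (fun i => A i `&` B i).
    by move=> i; exact: measurableI.
  by apply/seteqP; split=> [t [hA hB] i|t h]; split=> // i; have [] := h i.
- by move=> n; exists (F^~ n).
- rewrite -subTset => t _.
  have /choice[k kP] : forall i, exists n, F i n (tnth t i).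
    move=> i; have : (\bigcup_n F i n) (tnth t i) by rewrite Fcover.
    by move=> [n _ ?]; exists n.
  exists (\max_i k i)%N => // i; apply: Fmono (kP i); exact: leq_bigmax.
- by move=> _ [A mA ->]; exact: muE.
Qed.

End rectangles.

Section factors.
Context {R : realType} {m : nat}.
Variables (tau : 'I_m -> {sigma_finite_measure set R -> \bar R}) (g : 'I_m -> R -> R).
Local Notation W := (m.-tuple R).

(** Iterated random integrals mix over nested products whose type depends on the list of
    indices, so the space is packed with its measure and with the product [fval] of the
    integrands. The tuple [fpoint] names the coordinates; on it different orders of the same
    indices can be compared. *)
Record factor := Factor {
  fdisp : measure_display;
  fspace : measurableType fdisp;
  fmeas : {sigma_finite_measure set fspace -> \bar R};
  fval : fspace -> R;
  fpoint : fspace -> W }.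

Definition set_coord (i : 'I_m) (p : R * W) : W :=
  [tuple if j == i then p.1 else tnth p.2 j | j < m].

Fixpoint factors (s : seq 'I_m) : factor :=
  if s is i :: s' then
    let F := factors s' in
    @Factor _ _ (sfprod (tau i) (fmeas F)) (fun p => g i p.1 * fval p.2)
      (fun p => set_coord i (p.1, fpoint p.2))
  else @Factor _ unit \d_tt (fun=> 1) (fun=> [tuple 0 | _ < m]).

Hypotheses (mg : forall i, measurable_fun setT (g i)).

Lemma measurable_fval s : measurable_fun setT (@fval (factors s)).
Proof.
elim: s => [|i s IH] /=; first exact: measurable_cst.
by apply: measurable_funM; exact: measurableT_comp.
Qed.

Lemma fval_neq0 s x : (forall i t, g i t != 0) -> @fval (factors s) x != 0.
Proof.
move=> g0; elim: s x => [|i s IH] /= x; first exact: oner_neq0.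
by rewrite mulf_neq0.
Qed.

Lemma measurable_fpoint s : measurable_fun setT (@fpoint (factors s)).
Proof.
elim: s => [|i s IH] /=; first exact: measurable_cst.
apply/measurable_fun_tnthP => j.
have [ij|ij] := eqVneq j i.
  rewrite (_ : _ \o _ = fst)//; apply/funext => p /=.
  by rewrite tnth_mktuple ij eqxx.
rewrite (_ : _ \o _ = fun p => tnth (fpoint p.2) j); last first.
  by apply/funext => p /=; rewrite tnth_mktuple (negbTE ij).
apply: (measurableT_comp (measurable_tnth j)).
exact: (measurableT_comp IH).
Qed.

Lemma fval_fpoint s x : uniq s ->
  @fval (factors s) x = \prod_(i <- s) g i (tnth (fpoint x) i).
Proof.
elim: s x => [|i s IH] /= x; first by rewrite big_nil.
move=> /andP[is_ us]; rewrite big_cons tnth_mktuple eqxx IH//; congr (_ * _).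
apply: eq_big_seq => j js; rewrite tnth_mktuple; case: eqVneq => // ji.
by rewrite -ji js in is_.
Qed.

(** Coordinates that do not occur in [s] are left unconstrained: the measure only sees those
    which have been integrated. *)
Lemma fmeas_rect s (A : 'I_m -> set R) : uniq s -> (forall i, measurable (A i)) ->
  fmeas (factors s) [set x | forall i, i \in s -> A i (tnth (fpoint x) i)]
  = (\big[*%E/1%E]_(i <- s) tau i (A i))%E.
Proof.
move=> + mA; elim: s => [|i s IH] /=.
  move=> _; rewrite big_nil (_ : [set _ | _] = setT).
    by rewrite diracT.
  by apply/seteqP; split.
move=> /andP[is_ us].
rewrite (_ : [set _ | _]
    = A i `*` [set x | forall j, j \in s -> A j (tnth (fpoint x) j)]); last first.
  apply/seteqP; split=> -[t x] /= h.
    split=> [|j js]; first by have := h i (mem_head _ _); rewrite tnth_mktuple eqxx.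
    have := h j; rewrite inE js orbT tnth_mktuple => /(_ isT).
    by case: eqVneq => // ji; rewrite -ji js in is_.
  move=> j; rewrite inE tnth_mktuple; case: eqVneq => [-> _|_ /= js]; first exact: h.1.
  exact: h.2.
rewrite product_measure1E//.
  by rewrite big_cons IH.
rewrite (_ : [set _ | _] = (@fpoint (factors s)) @^-1` rect (fun j => if j \in s then A j else setT)).
  have mr : measurable (rect (fun j => if j \in s then A j else setT)).
    by apply: measurable_rect => j; case: ifP.
  by rewrite -[X in measurable X]setTI; exact: (@measurable_fpoint s).
apply/seteqP; split=> x h j; first by case: ifP => // js; exact: h.
by move=> js; have := h j; rewrite js.
Qed.

End factors.

(** * The image of the product measure under the tensor product *)

Section exponent_along_rays.
Context {R : realType} {d : nat}.

(** Borel measurability, from continuity along rays. *)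
Lemma measurable_exponent_ray (Phi : d.-tuple R -> R[i]) y : levy_exponent Phi ->
  measurable_fun setT (fun s => complex.Re (Phi (scalev s y))) /\
  measurable_fun setT (fun s => complex.Im (Phi (scalev s y))).
Proof.
move=> lPhi; have cont (f : R -> R) :
    (forall (u : nat -> R) (s : R), u n @[n --> \oo] --> s -> f (u n) @[n --> \oo] --> f s) ->
    measurable_fun setT f.
  move=> fc; apply: continuous_measurable_fun => s.
  by apply: (@cvg_nbhsP R R^o f s (f s)).2 => u; exact: fc.
by split; apply: cont => u s us; have [] := levy_exponent_ray y lPhi us.
Qed.

End exponent_along_rays.

Section tensor_factors.
Context {R : realType} {m : nat}.
Variables (a : 'I_m -> R) (b : 'I_m -> \bar R) (h : 'I_m -> R -> R) (r : 'I_m -> R -> R)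
  (rho : 'I_m -> {measure set R -> \bar R}) (prho : {measure set (m.-tuple R) -> \bar R})
  (c : R) (e : \bar R).
Hypotheses (hab : forall i, ((a i)%:E < b i)%E)
  (hcont : forall i, {within oc_itv (a i) (b i), continuous (h i)})
  (hrho : forall i, increments_of (a i) (b i) (r i) (rho i))
  (hprho : product_measure_on_box a b (fun i => rho i) prho)
  (hc : 0 <= c) (himg : tensor h @` oc_box a b = oc_itv c e).
Local Notation W := (m.-tuple R).

Definition restricted_measure i : {sigma_finite_measure set R -> \bar R} :=
  sigma_finite_copy (increments_sigma_finite (hab i) (hrho i)).

(** The value 1 off the interval keeps the integrand measurable and nonzero everywhere. *)
Definition extended_integrand i : R -> R := patch (fun=> 1) (oc_itv (a i) (b i)) (h i).

Local Notation tau := restricted_measure.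
Local Notation g := extended_integrand.
Local Notation fac := (factors tau g).

Lemma extended_integrandE i t : oc_itv (a i) (b i) t -> g i t = h i t.
Proof. by move=> ht; rewrite /extended_integrand patchT// inE. Qed.

Lemma measurable_extended_integrand i : measurable_fun setT (g i).
Proof.
have mD := measurable_oc_itv (a i) (b i).
have -> : g i = (h i \_ (oc_itv (a i) (b i))) \+ \1_(~` oc_itv (a i) (b i)).
  apply/funext => t; rewrite /extended_integrand /patch /= indicE in_setC.
  by case: ifP => tD /=; rewrite ?addr0 ?add0r.
apply: measurable_funD; last by apply: measurable_indic; exact: measurableC.
apply/(measurable_restrict _ mD measurableT); rewrite setTI.
exact: subspace_continuous_measurable_fun (mD) (@hcont i).
Qed.

(** A zero of one integrand would be a zero of the tensor product on the box, whose values
    are positive. *)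
Lemma extended_integrand_neq0 i t : g i t != 0.
Proof.
rewrite /extended_integrand /patch; case: ifPn => [|_]; last exact: oner_neq0.
rewrite inE => ti; apply/eqP => h0.
have /choice[u uP] : forall j, exists u, oc_itv (a j) (b j) u.
  by move=> j; exact: oc_itv_nonempty (hab j).
pose w : W := [tuple if j == i then t else u j | j < m].
have wbox : oc_box a b w.
  by move=> j; rewrite tnth_mktuple; case: eqVneq => [->|].
have : oc_itv c e (tensor h w) by rewrite -himg; exists w.
rewrite /tensor (bigD1 i)//= tnth_mktuple eqxx h0 mul0r => -[c0 _].
by move: hc; rewrite leNgt c0.
Qed.

Let measurable_box : measurable (oc_box a b).
Proof. by apply: (@measurable_rect _ _ (fun i => oc_itv (a i) (b i))) => i; exact: measurable_oc_itv. Qed.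

Let perm_big_enum (s : seq 'I_m) : perm_eq s (enum 'I_m) ->
  (forall F : 'I_m -> \bar R, \big[*%E/1%E]_(i <- s) F i = \big[*%E/1%E]_(i < m) F i) *
  (forall F : 'I_m -> R, \prod_(i <- s) F i = \prod_(i < m) F i).
Proof. by move=> es; split=> F; rewrite (perm_big _ es) /= big_enum. Qed.

(** Both sides are the product of the one-dimensional masses on rectangles, and a product does
    not depend on the order of its factors. *)
Lemma image_fpoint s : perm_eq s (enum 'I_m) -> forall B, measurable B ->
  fmeas (fac s) (@fpoint _ _ (fac s) @^-1` B) = prho (B `&` oc_box a b).
Proof.
move=> es; have us : uniq s by rewrite (perm_uniq es) enum_uniq.
have ms i : i \in s by rewrite (perm_mem es) mem_enum.
have mp := @measurable_fpoint _ _ tau g s.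
have /choice[F FP] : forall i, exists F : nat -> set R, [/\ setT = \bigcup_n F n,
    {homo F : n k / (n <= k)%N >-> (n <= k)%O}
    & forall n, measurable (F n) /\ (tau i (F n) < +oo)%E].
  by move=> i; exact/sigma_finiteP/sigma_finiteT.
have fr A : (forall i, measurable (A i)) ->
    fmeas (fac s) (@fpoint _ _ (fac s) @^-1` rect A) = (\big[*%E/1%E]_(i < m) tau i (A i))%E.
  move=> mA; rewrite -(perm_big_enum es).1 -(@fmeas_rect _ _ tau g _ _ us mA).
  by congr (fmeas _ _); apply/seteqP; split=> x hx i; [move=> _; exact: hx|exact: hx (ms i)].
apply: (rect_unique (mu := image_measure (fmeas (fac s)) mp) (nu := mrestr prho measurable_box)
  (F := F)).
- by move=> i n; have [_ _ /(_ n)[]] := FP i.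
- by move=> i n k nk; have [_ + _] := FP i; move=> /(_ _ _ nk)/subsetPset.
- by move=> i; have [] := FP i.
- move=> n; rewrite [X in (X < _)%E](fr (F^~ n)); last by move=> i; have [_ _ /(_ n)[]] := FP i.
  rewrite -ge0_fin_numE; last by apply: prode_ge0 => i _; exact: measure_ge0.
  apply: prode_fin_num => i _; rewrite ge0_fin_numE; last exact: measure_ge0.
  by have [_ _ /(_ n)[]] := FP i.
- move=> A mA; apply: etrans (fr A mA) _.
  apply: etrans _ (etrans (esym (hprho mA)) (congr1 prho (setIC _ _))).
  by apply: eq_bigr => i _; exact: (congr1 (rho i) (setIC _ _)).
Qed.


Let mtensor : measurable_fun setT (tensor g : W -> R).
Proof.
apply: measurable_prod => i _.
exact: (measurableT_comp (measurable_extended_integrand i) (measurable_tnth i)).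
Qed.

Let mval s : measurable_fun setT (@fval _ _ (fac s)).
Proof. exact: (@measurable_fval _ _ tau g measurable_extended_integrand s). Qed.

(** [tensor_image] as a measure: the extended integrands agree with [h] on the box. *)
Let tmeas : {measure set R -> \bar R} := image_measure (mrestr prho measurable_box) mtensor.

Let tensor_imageE : tensor_image a b h prho = tmeas.
Proof.
apply/funext => A; apply: (congr1 prho); apply/seteqP.
have E t : oc_box a b t -> tensor g t = tensor h t.
  by move=> tb; apply: eq_bigr => i _; rewrite extended_integrandE.
by split=> t /=; [move=> [tb At]|move=> [At tb]]; split=> //; move: At; rewrite E.
Qed.

Let tmeas_restr : mrestr tmeas (measurable_oc_itv c e) = tmeas.
Proof.
rewrite -tensor_imageE; apply/funext => A; apply: (congr1 prho); apply/seteqP.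
split=> t; first by move=> [tb [At _]].
by move=> [tb At]; split=> //; split=> //; rewrite -himg; exists t.
Qed.

Let tmeas_fval s : perm_eq s (enum 'I_m) -> forall A, measurable A ->
  tmeas A = image_measure (fmeas (fac s)) (@mval s) A.
Proof.
move=> es A mA; have us : uniq s by rewrite (perm_uniq es) enum_uniq.
have mB : measurable (tensor g @^-1` A) by rewrite -[X in measurable X]setTI; exact: mtensor.
apply: etrans (esym (image_fpoint es mB)) _; apply: (congr1 (fmeas (fac s))).
have E x : tensor g (fpoint x) = @fval _ _ (fac s) x.
  by rewrite fval_fpoint// (perm_big_enum es).2.
by apply/seteqP; split=> x /=; rewrite E.
Qed.

(** Change of variables along [fval], whose image measure is the image of the product measure
    under the tensor product of the integrands. *)
Lemma tensor_image_integral s (f : R -> R) : perm_eq s (enum 'I_m) -> measurable_fun setT f ->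
  (tensor_image a b h prho).-integrable (oc_itv c e) (EFin \o f) ->
  (fmeas (fac s)).-integrable setT (EFin \o (f \o @fval _ _ (fac s))) /\
  fine (\int[tensor_image a b h prho]_(t in oc_itv c e) (f t)%:E)
    = \int[fmeas (fac s)]_x f (fval x).
Proof.
move=> es mf; rewrite tensor_imageE => itf.
have mEf : measurable_fun setT (EFin \o f) by exact/measurable_EFinP.
have iT : tmeas.-integrable setT (EFin \o f).
  by have := (integrable_mrestr tmeas (measurable_oc_itv c e) mEf).2 itf; rewrite tmeas_restr.
have eqI k : (\int[tmeas]_x k x = \int[image_measure (fmeas (fac s)) (@mval s)]_x k x)%E.
  by apply: eq_measure_integral => A mA _; exact: tmeas_fval.
have iI : (image_measure (fmeas (fac s)) (@mval s)).-integrable setT (EFin \o f).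
  by case/integrableP: iT => _ fi; apply/integrableP; split=> //; rewrite -eqI.
have iF := integrable_image_inv mf iI.
split=> //; apply: etrans _ (@Rintegral_image _ _ _ _ _ _ _ (@mval s) f mf iF).
rewrite /Rintegral -eqI; congr fine.
by rewrite -(integral_mrestr _ (measurable_oc_itv c e) mEf) tmeas_restr.
Qed.

End tensor_factors.

(** * Composition of random integrals *)

Section iterated_random_integrals.
Context {R : realType} {d m : nat}.
Local Notation V := (d.-tuple R).
Variables (a : 'I_m -> R) (b : 'I_m -> \bar R) (h : 'I_m -> R -> R) (r : 'I_m -> R -> R)
  (rho : 'I_m -> {measure set R -> \bar R}) (prho : {measure set (m.-tuple R) -> \bar R})
  (c : R) (e : \bar R).
Hypotheses (hab : forall i, ((a i)%:E < b i)%E)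
  (hcont : forall i, {within oc_itv (a i) (b i), continuous (h i)})
  (hrho : forall i, increments_of (a i) (b i) (r i) (rho i))
  (hrho0 : forall i, (0 < rho i (oc_itv (a i) (b i)))%E)
  (hprho : product_measure_on_box a b (fun i => rho i) prho)
  (hc : 0 <= c) (himg : tensor h @` oc_box a b = oc_itv c e).
Local Notation tau := (restricted_measure hab hrho).
Local Notation g := (extended_integrand a b h).
Local Notation fac := (factors tau g).
Local Notation comp := (ri_comp a b h (fun i => rho i)).
Local Notation comp_domain := (ri_comp_domain a b h (fun i => rho i)).

Let mg i : measurable_fun setT (g i).
Proof. exact: (measurable_extended_integrand hcont). Qed.

Let g0 i t : g i t != 0.
Proof. exact: (extended_integrand_neq0 hab hc himg). Qed.

Lemma restricted_integral i (f : R -> R) (k : R -> R) :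
  (forall t, oc_itv (a i) (b i) t -> f t = k t) ->
  (tau i).-integrable setT (EFin \o f) ->
  (rho i).-integrable (oc_itv (a i) (b i)) (EFin \o k) /\
  fine (\int[rho i]_(t in oc_itv (a i) (b i)) (k t)%:E) = \int[tau i]_t f t.
Proof.
move=> fk itf; have mf : measurable_fun setT (EFin \o f) by case/integrableP: itf.
have mD := measurable_oc_itv (a i) (b i).
have itf' := (integrable_mrestr (rho i) mD mf).1 itf.
split.
  by apply: eq_integrable itf' => // t; rewrite inE => ht /=; rewrite fk.
rewrite /Rintegral [in RHS](integral_mrestr _ mD mf); congr fine.
by apply: eq_integral => t; rewrite inE => ht /=; rewrite fk.
Qed.

Lemma ri_exponent_restricted i (F : V -> R[i]) : mix_integrable (tau i) (g i) F ->
  ri_exponent_integrable (a i) (b i) (h i) (rho i) F /\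
  ri_exponent (a i) (b i) (h i) (rho i) F = mix_exponent (tau i) (g i) F.
Proof.
move=> ii.
have gh y t : oc_itv (a i) (b i) t -> F (scalev (g i t) y) = F (scalev (h i t) y).
  by move=> ht; rewrite extended_integrandE.
have Re y := @restricted_integral i _ (fun t => complex.Re (F (scalev (h i t) y)))
  (fun t ht => congr1 (@complex.Re R) (gh y t ht)) (ii y).1.
have Im y := @restricted_integral i _ (fun t => complex.Im (F (scalev (h i t) y)))
  (fun t ht => congr1 (@complex.Im R) (gh y t ht)) (ii y).2.
split=> [y|]; first by split; [exact: (Re y).1|exact: (Im y).1].
apply/funext => y; apply/eqP; rewrite eq_complex; apply/andP; split; apply/eqP.
  exact: (Re y).2.
exact: (Im y).2.
Qed.

Section one_law.
Variables (nu : probability V R) (z : V) (S : 'M[R]_d) (M : {measure set V -> \bar R}).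
Hypotheses (cS : covariance_mx S) (lM : levy_measure M) (idnu : infinitely_divisible nu)
  (nuPhi : levy_exponent_of nu (levy_khintchine z S M)).

(** Regularity descends from the whole product to the inner factors, so each intermediate
    exponent is a Levy exponent and each random integral in the composition exists. *)
Lemma ri_comp_law s : regular_mixing z S lM (fmeas (fac s)) (@fval _ _ (fac s)) ->
  [/\ comp_domain s nu, infinitely_divisible (comp s nu)
    & levy_exponent_of (comp s nu)
        (mix_exponent (fmeas (fac s)) (@fval _ _ (fac s)) (levy_khintchine z S M))].
Proof.
elim: s => [_|i s IH reg].
  split=> //; rewrite (_ : mix_exponent _ _ _ = levy_khintchine z S M)//.
  apply/funext => y; apply/eqP; rewrite eq_complex; apply/andP; split; apply/eqP.
    by apply: etrans (Rintegral_dirac _ _) _ => //; rewrite scalev1.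
  by apply: etrans (Rintegral_dirac _ _) _ => //; rewrite scalev1.
have mval := @measurable_fval _ _ tau g mg s.
have tau_gt0 : (0 < tau i setT)%E.
  by have := hrho0 i; rewrite -[oc_itv _ _]setTI.
have [dom ids lws] := IH (regular_mixing_snd cS (mg i) mval tau_gt0 (g0 i) reg).
have [ii jj vv] := reg.
have [ii1 E1] := mix_exponent_prod ii.
have [ri1 E2] := ri_exponent_restricted ii1.
have mvals := @measurable_fval _ _ tau g mg (i :: s).
have nz x := @fval_neq0 _ _ tau g (i :: s) x g0.
have lev := jumps_mix_exponent cS mvals jj vv nz ii.
have E : ri_exponent (a i) (b i) (h i) (rho i)
      (mix_exponent (fmeas (fac s)) (@fval _ _ (fac s)) (levy_khintchine z S M))
    = mix_exponent (fmeas (fac (i :: s))) (@fval _ _ (fac (i :: s))) (levy_khintchine z S M).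
  by rewrite E2 E1.
have lev' := lev; rewrite -E in lev'.
have [id1 law1] := random_integralP lws lev'.
split; [|exact: id1|by rewrite -E].
split; first exact: dom.
split; first exact: ids.
exists (mix_exponent (fmeas (fac s)) (@fval _ _ (fac s)) (levy_khintchine z S M)).
by split; [exact: lws|exact: ri1|exact: lev'].
Qed.

End one_law.

(** The composition and the single integral have the same exponent, namely the mixture over
    the full product, and hence the same law; the order of [s] does not enter. *)
Lemma ri_comp_tensor (nu : probability V R) s : perm_eq s (enum 'I_m) ->
  ri_domain c e idfun (tensor_image a b h prho) nu ->
  comp_domain s nu /\
  measure_eq (comp s nu) (random_integral c e idfun (tensor_image a b h prho) nu).
Proof.
move=> es [idnu [Phi [nuPhi ri lri]]].
have E y := tensor_image_integral hab hcont hrho hprho himg es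
  (measurable_exponent_ray y nuPhi.1).1 (ri y).1.
have E' y := tensor_image_integral hab hcont hrho hprho himg es
  (measurable_exponent_ray y nuPhi.1).2 (ri y).2.
have mixE : mix_exponent (fmeas (fac s)) (@fval _ _ (fac s)) Phi
    = ri_exponent c e idfun (tensor_image a b h prho) Phi.
  apply/funext => y; apply/eqP; rewrite eq_complex; apply/andP; split; apply/eqP.
    exact: esym (E y).2.
  exact: esym (E' y).2.
have ii : mix_integrable (fmeas (fac s)) (@fval _ _ (fac s)) Phi.
  by move=> y; split; [exact: (E y).1|exact: (E' y).1].
have lev := lri; rewrite -mixE in lev.
have [_ lawR] := random_integralP nuPhi lri.
have [z [S [M [cS lM PhiE]]]] := nuPhi.1; rewrite PhiE in ii lev nuPhi mixE lawR.
have [jj vv] := mix_levy_integrable cS lM (@measurable_fval _ _ tau g mg s) ii lev.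
have reg : regular_mixing z S lM (fmeas (fac s)) (@fval _ _ (fac s)) by split.
have [dom _ law] := ri_comp_law cS idnu nuPhi reg.
split=> //; apply: charfun_inj => y.
by rewrite law.2 mixE -lawR.2.
Qed.

End iterated_random_integrals.

Theorem theorem1 (R : realType) (d m : nat) (hm : (0 < m)%N)
    (a : 'I_m -> R) (b : 'I_m -> \bar R)
    (h : 'I_m -> R -> R) (r : 'I_m -> R -> R)
    (rho : 'I_m -> {measure set R -> \bar R})
    (prho : {measure set (m.-tuple R) -> \bar R})
    (c : R) (e : \bar R)
    (ha : forall i, 0 <= a i)
    (hab : forall i, ((a i)%:E < b i)%E)
    (hcont : forall i, {within oc_itv (a i) (b i), continuous (h i)})
    (hbv : forall i, bounded_variation_oc (a i) (b i) (h i))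
    (hrho : forall i, increments_of (a i) (b i) (r i) (rho i))
    (hrho0 : forall i, (0 < rho i (oc_itv (a i) (b i)))%E)
    (hprho : product_measure_on_box a b (fun i => rho i) prho)
    (hc : 0 <= c)
    (himg : tensor h @` oc_box a b = oc_itv c e)
    (nu : probability (d.-tuple R) R)
    (hnu : ri_domain c e idfun (tensor_image a b h prho) nu) :
  (ri_comp_domain a b h (fun i => rho i) (enum 'I_m) nu /\
   measure_eq (ri_comp a b h (fun i => rho i) (enum 'I_m) nu)
              (random_integral c e idfun (tensor_image a b h prho) nu)) /\
  (forall p : {perm 'I_m},
     ri_comp_domain a b h (fun i => rho i) [seq p i | i <- enum 'I_m] nu /\
     measure_eq (ri_comp a b h (fun i => rho i) [seq p i | i <- enum 'I_m] nu)
                (ri_comp a b h (fun i => rho i) (enum 'I_m) nu)).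
Proof.
have any s := @ri_comp_tensor R d m a b h r rho prho c e hab hcont hrho hrho0 hprho hc himg nu s.
have [dom1 eq1] := any _ (perm_refl _) hnu.
split=> // p.
have pe : perm_eq [seq p i | i <- enum 'I_m] (enum 'I_m).
  apply: uniq_perm; [|exact: enum_uniq|move=> i].
    by rewrite (map_inj_uniq perm_inj) enum_uniq.
  by rewrite mem_enum; apply/mapP; exists (p^-1 i)%g; rewrite ?mem_enum ?permKV.
have [dom2 eq2] := any _ pe hnu; split=> // A mA.
by rewrite eq2// eq1.
Qed.
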